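(* Let $(X,d_X,\mu)$ and $(Y,d_Y,\nu)$ be metric measure spaces, where $\mu$ is a Radon measure, let $1\le q<p<\infty$ with $\frac1\sigma=\frac1q-\frac1p$, and let $\varphi\colon X\to Y$ be a continuous mapping which induces the bounded composition operator $\varphi^{*}\colon D^{1,p}(Y)\cap\operatorname{Lip}(Y)\to D^{1,q}(X)$, $\varphi^*(u)=u\circ\varphi$. For Borel $B\subset Y$ define $\Psi(B)$ by $$\Psi(B)^{\frac1\sigma}=\sup\bigg(\int_{\varphi^{-1}(B)}|\nabla_q(u\circ\varphi)|^q\,d\mu\bigg)^{\frac1q},$$ the supremum being over all $u\in\operatorname{Lip}(Y)$ with $\int_B|\nabla_p u|^p\,d\nu\le1$. Then the set function $\Psi$ extends to a finite regular Borel measure $\widetilde\Psi$ on $Y$ given by $$\widetilde\Psi(A)=\inf\{\Psi(U)\mid A\subset U,\ U\subset Y\text{ open}\},\qquad A\subset Y.$$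
   Context: A metric measure space $(X,d_X,\mu)$ is a separable metric space $(X,d_X)$ with a nontrivial regular Borel measure $\mu$ that is finite on bounded sets. Measures are outer measures; a regular Borel measure is an outer measure for which all Borel sets are measurable and every set is contained in a Borel set of the same measure. $\mu$ is a Radon measure if it is a regular Borel measure, $\mu(K)<\infty$ for compact $K$, and $\mu(A)=\sup\{\mu(K)\mid K\subset A \text{ compact}\}$ for every $\mu$-measurable $A$. For $1\le p<\infty$, $D^{1,p}(X)$ is the Dirichlet (homogeneous Sobolev) space of measurable functions $u\colon X\to\mathbb R$ having an upper gradient in $L^p(X,\mu)$; $|\nabla_p u|$ denotes the minimal $p$-weak upper gradient of $u$ (also for functions that are only locally in $D^{1,p}$). $\operatorname{Lip}(Y)$ is the space of Lipschitz functions $Y\to\mathbb R$. Lipschitz functions on $Y$ are locally in $D^{1,p}(Y)$, and for $u\in\operatorname{Lip}(Y)$ the gradient $|\nabla_q(u\circ\varphi)|$ is understood locally: on $\varphi^{-1}(G)$, $G\subset Y$ bounded open, it equals $|\nabla_q(v\circ\varphi)|$ a.e. for any $v\in D^{1,p}(Y)\cap\operatorname{Lip}(Y)$ with $v=u$ on $G$. $\varphi$ induces the bounded composition operator $\varphi^*\colon D^{1,p}(Y)\cap\operatorname{Lip}(Y)\to D^{1,q}(X)$ if $u\circ\varphi\in D^{1,q}(X)$ for every $u\in D^{1,p}(Y)\cap\operatorname{Lip}(Y)$ and there is a constant $C<\infty$ with $\big(\int_X|\nabla_q(u\circ\varphi)|^q\,d\mu\big)^{1/q}\le C\big(\int_Y|\nabla_p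 u|^p\,d\nu\big)^{1/p}$ for all such $u$. *)

(* Defs.v *)
From HB Require Import structures.
From mathcomp Require Import all_boot all_order all_algebra.
From mathcomp Require Import all_classical all_reals all_analysis.
From mathcomp Require Import measurable_realfun.

Set Implicit Arguments.
Unset Strict Implicit.
Unset Printing Implicit Defensive.

Import Order.TTheory GRing.Theory Num.Theory.
Import numFieldNormedType.Exports.

Local Open Scope classical_set_scope.
Local Open Scope ring_scope.
Local Open Scope ereal_scope.

(* The library's measurable types are pointed, so metric spaces carry a base
   point as well. A space with a nontrivial measure is nonempty, and nothing
   below depends on which point is chosen. *)
#[short(type="pmetricType")]
HB.structure Definition PointedMetric (R : numDomainType) :=
  {T of Pointed T & Metric R T}.

Section metric_spaces.
Context {R : realType}.

Definition mbounded {X : pmetricType R} (A : set X) :=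
  exists M : R, forall x y, A x -> A y -> (mdist x y <= M)%R.

Definition separable_space (X : pmetricType R) :=
  exists2 D : set X, countable D & dense D.

Definition Lip {Y : pmetricType R} : set (Y -> R) :=
  [set u | exists L : R, forall x y, (`|u x - u y| <= L * mdist x y)%R].

Definition borel {X : pmetricType R} : set (set X) := <<s open >>.

Definition borel_fun {X : pmetricType R} (g : X -> \bar R) :=
  measurable_fun [set: g_sigma_algebraType (@open X)]
    (g : g_sigma_algebraType (@open X) -> \bar R).

End metric_spaces.

Section measures.
Context {R : realType} {X : pmetricType R}.
Implicit Types (mu : {outer_measure set X -> \bar R}).

Definition borel_regular mu :=
  (forall B, borel B -> mu.-caratheodory B) /\
  (forall A, exists B, [/\ borel B, A `<=` B & mu B = mu A]).

Definition radon mu :=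
  [/\ borel_regular mu,
      forall K, compact K -> mu K < +oo &
      forall A, mu.-caratheodory A ->
        mu A = ereal_sup [set mu K | K in [set K | compact K /\ K `<=` A]]].

Definition metric_measure_space mu :=
  [/\ separable_space X,
      borel_regular mu,
      mu setT != 0 &
      forall A, mbounded A -> mu A < +oo].

Definition measurable_for mu (u : X -> R) :=
  measurable_fun [set: caratheodory_type mu] (u : caratheodory_type mu -> R).

Definition integral_of mu (A : set X) (g : X -> \bar R) : \bar R :=
  \int[(mu : set (caratheodory_type mu) -> \bar R)]_(x in A) g x.

Definition Lp_fun mu (p : R) (g : X -> \bar R) :=
  integral_of mu setT (fun x => g x `^ p) < +oo.

Definition Lp_loc_fun mu (p : R) (g : X -> \bar R) :=
  forall x, exists U : set X,
    [/\ open U, U x & integral_of mu U (fun y => g y `^ p) < +oo].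

End measures.

Section curves.
Context {R : realType} {X : pmetricType R}.

(* Only the values of [cmap] on [cleft, cright] are relevant. *)
Record curve := Curve {
  cleft : R;
  cright : R;
  cmap :> R -> X;
  cleft_le_cright : (cleft <= cright)%R;
  cmap_continuous : {within `[cleft, cright], continuous cmap} }.

Definition path_length (f : R -> X) (a b : R) : \bar R :=
  ereal_sup [set (\sum_(i < size s)
      mdist (f (nth b (a :: s) i)) (f (nth b (a :: s) i.+1)))%:E
    | s in itv_partition a b].

Definition curve_length (c : curve) := path_length c (cleft c) (cright c).

Definition rectifiable (c : curve) := curve_length c < +oo.

(* The arc length parametrization of a rectifiable curve c: [arc_param c s] is
   the common value of c at all times t at which c has travelled length s. *)
Definition arc_param (c : curve) (s : R) : X :=
  xget (c (cleft c))
    [set c t | t in [set t | t \in `[cleft c, cright c] /\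
                             path_length c (cleft c) t = s%:E]].

Definition line_integral (c : curve) (g : X -> \bar R) : \bar R :=
  \int[lebesgue_measure]_(s in `[0%R, fine (curve_length c)]) g (arc_param c s).

Definition ug_ineq (u : X -> R) (g : X -> \bar R) (c : curve) :=
  (`|u (c (cleft c)) - u (c (cright c))|)%:E <= line_integral c g.

Definition upper_gradient (u : X -> R) (g : X -> \bar R) :=
  [/\ borel_fun g, forall x, 0 <= g x &
      forall c, rectifiable c -> ug_ineq u g c].

End curves.
Arguments curve {R} X.

Section sobolev.
Context {R : realType} {X : pmetricType R}.
Implicit Types (mu : {outer_measure set X -> \bar R}) (p : R) (u : X -> R)
  (g h : X -> \bar R).

Definition modulus mu p (Gamma : set (curve X)) : \bar R :=
  ereal_inf [set integral_of mu setT (fun x => rho x `^ p) |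
    rho in [set rho | [/\ borel_fun rho, forall x, 0 <= rho x &
      forall c, Gamma c -> rectifiable c -> 1 <= line_integral c rho]]].

Definition weak_upper_gradient mu p u g :=
  [/\ borel_fun g, forall x, 0 <= g x &
      modulus mu p [set c | rectifiable c /\ ~ ug_ineq u g c] = 0].

Definition dirichlet mu p : set (X -> R) :=
  [set u | measurable_for mu u /\
    exists2 g, upper_gradient u g & Lp_fun mu p g].

(* Minimality is among locally p-integrable weak upper gradients, so that it
   makes sense for functions that are only locally in the Dirichlet space; when
   u is in the Dirichlet space, it is minimality among p-integrable ones. *)
Definition is_min_grad mu p u g :=
  [/\ weak_upper_gradient mu p u g, Lp_loc_fun mu p g &
      forall h, weak_upper_gradient mu p u h -> Lp_loc_fun mu p h ->
        mu [set x | ~ (g x <= h x)] = 0].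

(* A representative of the gradient, which is unique up to null sets. The
   default value +oo only occurs for u not locally in the Dirichlet space. *)
Definition min_grad mu p u : X -> \bar R :=
  xget (cst +oo) [set g | is_min_grad mu p u g].

End sobolev.

Section composition.
Context {R : realType} {X Y : pmetricType R}.
Variables (mu : {outer_measure set X -> \bar R}).
Variables (nu : {outer_measure set Y -> \bar R}).
Variables (p q : R) (phi : X -> Y).

Definition induces_bounded_composition :=
  (forall u : Y -> R, dirichlet nu p u -> Lip u -> dirichlet mu q (u \o phi)) /\
  exists C : R, forall u : Y -> R, dirichlet nu p u -> Lip u ->
    integral_of mu setT (fun x => min_grad mu q (u \o phi) x `^ q) `^ q^-1
    <= C%:E * integral_of nu setT (fun y => min_grad nu p u y `^ p) `^ p^-1.

(* For a Lipschitz u that need not be in the Dirichlet space, the gradient of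
   u \o phi is glued from those of v \o phi, with v equal to u on a bounded
   open set. *)
Definition is_comp_grad (u : Y -> R) (g : X -> \bar R) :=
  [/\ borel_fun g, forall x, 0 <= g x &
      forall (G : set Y) (v : Y -> R), open G -> mbounded G ->
        dirichlet nu p v -> Lip v -> (forall y, G y -> v y = u y) ->
        mu (phi @^-1` G `&` [set x | g x <> min_grad mu q (v \o phi) x]) = 0].

Definition comp_grad (u : Y -> R) : X -> \bar R :=
  xget (cst +oo) [set g | is_comp_grad u g].

(* [sigma] is the exponent with 1 / sigma = 1 / q - 1 / p. *)
Definition Psi (sigma : R) (B : set Y) : \bar R :=
  (ereal_sup
    [set integral_of mu (phi @^-1` B) (fun x => comp_grad u x `^ q) `^ q^-1
      | u in [set u | Lip u /\
          integral_of nu B (fun y => min_grad nu p u y `^ p) <= 1]]) `^ sigma.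

End composition.

(* Main.v *)
(* [Psi] is shown to be a finite Borel measure; outer regularity of finite Borel
   measures on metric spaces then identifies the infimum over open sets.

   Superadditivity: almost optimal u1, u2 for disjoint B1, B2 must be combined
   into one test function, although their gradients overlap outside B1 and B2.
   Since mu is Radon, the energy of the compositions is almost carried by
   disjoint compact sets phi(K1), phi(K2). Folding the range of u_i repeatedly
   makes u_i arbitrarily small near phi(K_i) without changing its gradient, so
   that the minimum with a cutoff of small slope has its support in a given
   neighbourhood of phi(K_i) and hardly more energy than u_i. Two such
   functions with disjoint supports are added with Hölder weights.

   Countable subadditivity: u is scaled on each piece by its own energy there,
   and the resulting terms a^(q/p) r^(q/sigma) are linearized by Young's
   inequality.

   All this needs the calculus of minimal weak upper gradients (existence,
   locality, gluing), which is obtained by splitting curves at the boundary of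
   open sets and approximating Borel sets through a sigma-algebra argument. *)
Require Import Defs.
From HB Require Import structures.
From mathcomp Require Import all_boot all_order all_algebra.
From mathcomp Require Import all_classical all_reals all_analysis.
From mathcomp Require Import measurable_realfun.
From mathcomp Require Import ring lra.
Set Implicit Arguments.
Unset Strict Implicit.
Unset Printing Implicit Defensive.
Import Order.TTheory GRing.Theory Num.Theory.
Import numFieldNormedType.Exports.
Local Open Scope classical_set_scope.
Local Open Scope ring_scope.
Local Open Scope ereal_scope.

(** * Length and arc length parametrization of curves *)

Section path_length.
Context {R : realType} {X : pmetricType R}.
Implicit Types (f : R -> X) (a b c : R) (s : seq R).

(** Not even monotonicity of [Psi] is visible from its definition: a larger [B] tightens the energy
    constraint and admits fewer test functions. It comes out as superadditivity with an empty set,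
    hence only after localization. Compact sets are found in [X], where [mu] is Radon, and carried
    to [Y] by [phi]. They must be found before their neighbourhoods, because two of these
    neighbourhoods have to be disjoint. The exponents enter through [q / p + q / sigma = 1]: the
    numbers p/q and sigma/q are conjugate, and this one pair governs both the Hölder weights and
    Young's inequality. Suprema are replaced by real levels with one witness each, which avoids
    arithmetic with infinite values. Almost every curve means every curve along which some fixed
    weight [rho] in L^p is integrable. Gradients are then glued curve by curve, without estimates of
    moduli. Since Lipschitz functions have only locally integrable gradients, separability and the
    compactness of curves reduce everything to countably many integrable pieces. *)

Fixpoint chain_length f a s : R :=
  if s is x :: s' then (mdist (f a) (f x) + chain_length f x s')%R else 0%R.

Lemma path_lengthE f a b :
  path_length f a b =
  ereal_sup [set (chain_length f a s)%:E | s in itv_partition a b].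
Proof.
rewrite /path_length; congr ereal_sup; apply: eq_imagel => s _; congr EFin.
by elim: s a => [|x s IH] a; rewrite ?big_ord0// big_ord_recl/= -IH.
Qed.

Lemma chain_length_cat f a s t :
  chain_length f a (s ++ t) =
  (chain_length f a s + chain_length f (last a s) t)%R.
Proof. by elim: s a => [|x s IH] a /=; rewrite ?add0r// IH addrA. Qed.

Lemma chain_length_le f a b s :
  itv_partition a b s -> (chain_length f a s)%:E <= path_length f a b.
Proof. by move=> abs; rewrite path_lengthE; apply: ereal_sup_ubound; exists s. Qed.

Lemma mdist_path_length f a b :
  (a <= b)%R -> (mdist (f a) (f b))%:E <= path_length f a b.
Proof.
rewrite le_eqVlt => /predU1P[<-|ab].
  by rewrite mdistxx; apply: (@chain_length_le f a a [::]).
have := @chain_length_le f a b [:: b] (itv_partition1 ab).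
by rewrite /= addr0.
Qed.

Lemma path_length_ge0 f a b : (a <= b)%R -> 0 <= path_length f a b.
Proof.
by move=> /(mdist_path_length f); apply: le_trans; rewrite lee_fin mdist_ge0.
Qed.

Lemma path_lengthxx f a : path_length f a a = 0.
Proof.
apply/eqP; rewrite eq_le path_length_ge0// andbT path_lengthE.
by apply: ge_ereal_sup => _ [s /itv_partitionxx -> <-].
Qed.

Lemma itv_partition_ex a b : (a <= b)%R -> exists s, itv_partition a b s.
Proof.
rewrite le_eqVlt => /predU1P[->|ab]; first by exists [::].
by exists [:: b]; exact: itv_partition1.
Qed.

(** Inserting [b] into the partition can only lengthen the polygon, by the triangle inequality. *)
Lemma itv_partition_split f a b c s : (a <= b)%R -> (b <= c)%R ->
  itv_partition a c s ->
  exists s1 s2, [/\ itv_partition a b s1, itv_partition b c s2 &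
    (chain_length f a s <= chain_length f a s1 + chain_length f b s2)%R].
Proof.
elim: s a => [|x s IH] a ab bc acs.
  have ac := itv_partition_nil acs; subst c.
  have ba : a = b by apply/eqP; rewrite eq_le ab bc.
  by subst b; exists [::], [::]; rewrite /= addr0.
have [/= /andP[ax xs] lc] := acs.
have [xb|bx] := leP x b.
  have [s1 [s2 [p1 p2 le12]]] := IH x xb bc (itv_partition_cons acs).
  exists (x :: s1), s2; split=> //=; last by rewrite -addrA lerD2l.
  by case: p1 => p1 l1; split => //=; rewrite ax.
move: ab; rewrite le_eqVlt => /predU1P[ab|ab].
  by subst b; exists [::], (x :: s); rewrite /= add0r.
exists [:: b], (x :: s); split=> //=.
- exact: itv_partition1.
- by split => //=; rewrite bx.
- by rewrite addr0 addrA lerD2r metric_triangle.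
Qed.

Lemma path_lengthD f a b c : (a <= b)%R -> (b <= c)%R ->
  path_length f a c = path_length f a b + path_length f b c.
Proof.
move=> ab bc; apply/eqP; rewrite eq_le; apply/andP; split.
  rewrite [leLHS]path_lengthE; apply: ge_ereal_sup => _ [s acs <-].
  have [s1 [s2 [p1 p2 le12]]] := itv_partition_split f ab bc acs.
  apply: (@le_trans _ _ ((chain_length f a s1)%:E + (chain_length f b s2)%:E)).
    by rewrite -EFinD lee_fin.
  by apply: leeD; exact: chain_length_le.
(* The two suprema are taken one after the other: when the total is finite, a fixed partition of the
   first piece can be subtracted to bound the second length, and then the first length is bounded in
   the same way. *)
have abcle s t : itv_partition a b s -> itv_partition b c t ->
    (chain_length f a s + chain_length f b t)%:E <= path_length f a c.
  move=> abs bct; apply: le_trans (chain_length_le _ (itv_partition_cat abs bct)).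
  by rewrite chain_length_cat; case: abs => _ /eqP ->.
move: abcle; have := path_length_ge0 f (le_trans ab bc).
case: (path_length f a c) => [r _|_|//] abcle; last exact: leey.
have bcle s : itv_partition a b s ->
    path_length f b c <= (r - chain_length f a s)%:E.
  move=> abs; rewrite path_lengthE; apply: ge_ereal_sup => _ [t bct <-].
  by rewrite lee_fin lerBrDl -lee_fin abcle.
have [s0 abs0] := itv_partition_ex ab.
move: bcle; have := path_length_ge0 f bc.
case: (path_length f b c) => [q _|_|//] bcle; last first.
  by have := bcle _ abs0; rewrite leNgt ltry.
rewrite addeC -leeBrDl// path_lengthE; apply: ge_ereal_sup => _ [s abs <-].
by have := bcle _ abs; rewrite -EFinB !lee_fin lerBrDl addrC -lerBrDl.
Qed.

End path_length.

Section arc_length.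
Context {R : realType} {X : pmetricType R}.
Implicit Types (c : curve X) (s t : R).

Definition arc_length c t : R := fine (path_length c (cleft c) t).

Lemma arc_length_left c : arc_length c (cleft c) = 0%R.
Proof. by rewrite /arc_length path_lengthxx. Qed.

Lemma arc_lengthB c s t : rectifiable c ->
  (cleft c <= s)%R -> (s <= t)%R -> (t <= cright c)%R ->
  path_length c s t = (arc_length c t - arc_length c s)%:E.
Proof.
move=> rc ls st tr.
have lt := le_trans ls st.
have := rc; rewrite /rectifiable /curve_length (path_lengthD c lt tr).
rewrite (path_lengthD c ls st) /arc_length (path_lengthD c ls st).
have := path_length_ge0 c ls; have := path_length_ge0 c st.
have := path_length_ge0 c tr.
case: (path_length c t _) => [x| |]//; case: (path_length c _ s) => [y| |]//;
  case: (path_length c s t) => [z| |]//= _ _ _ _.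
by congr EFin; ring.
Qed.

Lemma arc_length_le c s t : rectifiable c ->
  (cleft c <= s)%R -> (s <= t)%R -> (t <= cright c)%R ->
  (arc_length c s <= arc_length c t)%R.
Proof.
move=> rc ls st tr; rewrite -subr_ge0 -lee_fin -arc_lengthB//.
exact: path_length_ge0.
Qed.

Lemma curve_lengthE c : rectifiable c ->
  curve_length c = (arc_length c (cright c))%:E.
Proof.
by move=> rc; rewrite [LHS]arc_lengthB ?cleft_le_cright// arc_length_left subr0.
Qed.

Lemma curve_cvg c t (e : R) : (cleft c <= t <= cright c)%R -> (0 < e)%R ->
  exists2 d : R, (0 < d)%R & forall s, (cleft c <= s <= cright c)%R ->
    (`|t - s| < d)%R -> (mdist (c t) (c s) < e)%R.
Proof.
move=> tI e0; have /subspace_continuousP/(_ t) := @cmap_continuous _ _ c.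
rewrite /= in_itv/= => /(_ tI) /(_ _ (nbhsx_ballx (c t) e e0)).
rewrite /nbhs/= /within/= => -[d d0 dP]; exists d => // s sI ts.
by have := dP s ts; rewrite in_itv/= ballEmdist/= => /(_ sI).
Qed.

(** A partition that almost attains the length up to [t] still almost does so when its last point is
    moved to a nearby [s], by continuity of [c]. Half of [e] pays for each of the two errors. *)
Lemma arc_length_left_cvg c t (e : R) : rectifiable c ->
  (cleft c < t)%R -> (t <= cright c)%R -> (0 < e)%R ->
  exists2 d : R, (0 < d)%R & forall s, (cleft c <= s)%R -> (s <= t)%R ->
    (t - s < d)%R -> (arc_length c t - arc_length c s <= e)%R.
Proof.
move=> rc lt tr e0.
have e20 : (0 < e / 2)%R by rewrite divr_gt0.
have := arc_lengthB rc (lexx _) (ltW lt) tr; rewrite arc_length_left subr0.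
move=> ltE; have : (arc_length c t - e / 2)%:E < path_length c (cleft c) t.
  by rewrite ltE lte_fin ltrBlDr ltrDl.
rewrite path_lengthE => /ereal_sup_gt[_ [p pP <-]]; rewrite lte_fin => pgt.
case/lastP: p => [|p y] in pP pgt *.
  by have := itv_partition_nil pP => tE; move: lt; rewrite tE ltxx.
have yt : y = t by case: pP => _; rewrite last_rcons => /eqP.
subst y.
have lpt : (last (cleft c) p < t)%R by case: pP; rewrite rcons_path => /andP[].
have [|d d0 dP] := @curve_cvg c t (e / 2) _ e20; first by rewrite (ltW lt).
exists (Num.min d (t - last (cleft c) p))%R; first by rewrite lt_min d0 subr_gt0.
move=> s ls st; rewrite lt_min => /andP[tsd tsp].
have lps : (last (cleft c) p < s)%R by move: tsp; lra.
have sP : itv_partition (cleft c) s (rcons p s).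
  case: pP; rewrite rcons_path => /andP[pp _] _.
  by split; rewrite ?last_rcons ?eqxx// rcons_path pp lps.
have := chain_length_le c sP.
rewrite arc_lengthB// ?(le_trans st)// arc_length_left subr0 lee_fin.
move: pgt; rewrite -!cats1 !chain_length_cat/= !addr0.
have := dP s; rewrite ls (le_trans st tr) ger0_norm ?subr_ge0//.
move=> /(_ isT tsd)/ltW.
have := metric_triangle (c (last (cleft c) p)) (c s) (c t).
rewrite (metric_sym (c s)).
set a := mdist _ _; set b := mdist _ _; set z := mdist _ _; lra.
Qed.

Lemma arc_length_right_cvg c t (e : R) : rectifiable c ->
  (cleft c <= t)%R -> (t < cright c)%R -> (0 < e)%R ->
  exists2 d : R, (0 < d)%R & forall s, (t <= s)%R -> (s <= cright c)%R ->
    (s - t < d)%R -> (arc_length c s - arc_length c t <= e)%R.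
Proof.
move=> rc lt tr e0.
have e20 : (0 < e / 2)%R by rewrite divr_gt0.
have ltE := arc_lengthB rc lt (ltW tr) (lexx _).
have : (arc_length c (cright c) - arc_length c t - e / 2)%:E <
    path_length c t (cright c).
  by rewrite ltE lte_fin ltrBlDr ltrDl.
rewrite path_lengthE => /ereal_sup_gt[_ [[|y p] pP <-]]; rewrite lte_fin => pgt.
  by have := itv_partition_nil pP => tE; move: tr; rewrite tE ltxx.
have ty : (t < y)%R by case: pP => /andP[].
have [|d d0 dP] := @curve_cvg c t (e / 2) _ e20; first by rewrite (ltW tr) lt.
exists (Num.min d (y - t))%R; first by rewrite lt_min d0 subr_gt0.
move=> s ts sr; rewrite lt_min => /andP[tsd tsp].
have sy : (s < y)%R by move: tsp; lra.
have sP : itv_partition s (cright c) (y :: p).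
  by case: pP => /= /andP[_ yp] lp; split; rewrite //= sy.
have := chain_length_le c sP.
rewrite arc_lengthB// ?(le_trans lt)// lee_fin/=.
move: pgt => /=.
have := dP s; rewrite sr (le_trans lt ts) distrC ger0_norm ?subr_ge0//.
move=> /(_ isT tsd)/ltW.
have := metric_triangle (c t) (c s) (c y).
set a := mdist _ _; set b := mdist _ _; set z := mdist _ _; lra.
Qed.

Lemma arc_length_continuous c : rectifiable c ->
  {within `[cleft c, cright c], continuous (arc_length c)}.
Proof.
move=> rc; apply/subspace_continuousP => t; rewrite /= in_itv/= => /andP[lt tr].
apply/cvgrPdist_le => e e0.
have [d1 d10 d1P] : exists2 d : R, (0 < d)%R & forall s, (cleft c <= s)%R ->
    (s <= t)%R -> (t - s < d)%R -> (arc_length c t - arc_length c s <= e)%R.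
  move: lt; rewrite le_eqVlt => /predU1P[<-|lt].
    exists 1%R => // s ls sl _; have -> : s = cleft c.
      by apply/eqP; rewrite eq_le ls sl.
    by rewrite subrr ltW.
  exact: arc_length_left_cvg.
have [d2 d20 d2P] : exists2 d : R, (0 < d)%R & forall s, (t <= s)%R ->
    (s <= cright c)%R -> (s - t < d)%R ->
    (arc_length c s - arc_length c t <= e)%R.
  move: tr; rewrite le_eqVlt => /predU1P[->|tr].
    exists 1%R => // s ls sl _; have -> : s = cright c.
      by apply/eqP; rewrite eq_le ls sl.
    by rewrite subrr ltW.
  exact: arc_length_right_cvg.
rewrite /within/=; exists (Num.min d1 d2)%R; first by rewrite /= lt_min d10.
move=> s; rewrite /= lt_min => /andP[sd1 sd2]; rewrite in_itv/= => /andP[ls sr].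
have [st|ts] := leP s t.
  rewrite ger0_norm; last by rewrite subr_ge0 arc_length_le.
  by apply: d1P => //; rewrite -[ltLHS]ger0_norm ?subr_ge0.
rewrite distrC ger0_norm; last by rewrite subr_ge0 arc_length_le// ltW.
by apply: d2P; rewrite ?(ltW ts)// -[ltLHS]ger0_norm ?subr_ge0 1?distrC// ltW.
Qed.

Lemma arc_length_surj c s : rectifiable c ->
  (0 <= s <= arc_length c (cright c))%R ->
  exists2 t, (cleft c <= t <= cright c)%R & arc_length c t = s.
Proof.
move=> rc /andP[s0 sL].
have lr := cleft_le_cright c.
have [|t] := IVT lr (arc_length_continuous rc) (v := s).
  by rewrite ge_min le_max arc_length_left s0 sL orbT.
by rewrite in_itv/=; exists t.
Qed.

(** The piece between [s] and [t] has length zero and so cannot join distinct points. This makes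
    [arc_param] well defined. *)
Lemma arc_length_inj c s t : rectifiable c ->
  (cleft c <= s <= cright c)%R -> (cleft c <= t <= cright c)%R ->
  arc_length c s = arc_length c t -> c s = c t.
Proof.
move=> rc; wlog st : s t / (s <= t)%R.
  move=> H; have [st|ts] := leP s t; first exact: H.
  by move=> *; apply/esym/H => //; exact: ltW.
move=> /andP[ls sr] /andP[lt tr] st_eq.
apply: mdist_positivity; apply/eqP; rewrite eq_le mdist_ge0 andbT -lee_fin.
by rewrite (le_trans (mdist_path_length c st))// arc_lengthB// st_eq subrr.
Qed.

Lemma arc_paramE c t : rectifiable c -> (cleft c <= t <= cright c)%R ->
  arc_param c (arc_length c t) = c t.
Proof.
move=> rc tI; rewrite /arc_param.
have pE s : (cleft c <= s <= cright c)%R ->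
    path_length c (cleft c) s = (arc_length c s)%:E.
  by move=> /andP[ls sr]; rewrite arc_lengthB// arc_length_left subr0.
set P := (P in xget _ P); have : P (xget (c (cleft c)) P).
  apply: xgetPex; exists (c t), t => //; split; first by rewrite in_itv.
  by rewrite pE.
move=> [s [+ +] <-]; rewrite in_itv/= => sI; rewrite pE// => -[sE].
exact: arc_length_inj.
Qed.

Lemma mdist_arc_param c s t : rectifiable c ->
  (0 <= s)%R -> (s <= t)%R -> (t <= arc_length c (cright c))%R ->
  (mdist (arc_param c s) (arc_param c t) <= t - s)%R.
Proof.
move=> rc s0 st tL.
have [|s' s'I s'E] := arc_length_surj (s := s) rc.
  by rewrite s0 (le_trans st).
have [|t' t'I t'E] := arc_length_surj (s := t) rc.
  by rewrite tL (le_trans s0).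
rewrite -s'E -t'E !arc_paramE//.
move: s'I t'I => /andP[? ?] /andP[? ?].
have [s't'|t's'] := leP s' t'.
  by rewrite -lee_fin (le_trans (mdist_path_length c s't'))// arc_lengthB.
have st' : arc_length c s' = arc_length c t'.
  by apply/eqP; rewrite eq_le s'E t'E st -s'E -t'E arc_length_le// ltW.
by rewrite st' subrr (@arc_length_inj c s' t') ?mdistxx//; apply/andP.
Qed.

End arc_length.

(** * Line integrals *)

Lemma ge0_integral_mrestr d (T : measurableType d) (R : realType)
    (m : {measure set T -> \bar R}) (D : set T) (mD : measurable D)
    (f : T -> \bar R) : measurable_fun setT f -> (forall x, 0 <= f x) ->
  \int[mrestr m mD]_x f x = \int[m]_(x in D) f x.
Proof.
move=> mf f0.
rewrite (@ge0_negligible_integral _ _ _ (mrestr m mD) setT (~` D))//; last first.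
  by rewrite /= /mrestr setICl measure0.
  exact: measurableC.
rewrite setTD setCK; apply: eq_measure_integral => A mA AD.
by rewrite /= /mrestr setIidl.
Qed.

Section line_integral.
Context {R : realType} {X : pmetricType R}.
Implicit Types (c : curve X) (s t : R) (g : X -> \bar R).

Local Notation mu := (@lebesgue_measure R).
Local Notation XB := (g_sigma_algebraType (@open X)).

(** Clamping the parameter to [0, L] extends the parametrization to a 1-Lipschitz map of the whole
    line, so that measurability is available without restricting to the interval. *)
Lemma arc_param_continuous c : rectifiable c ->
  continuous (fun s : R =>
    arc_param c (Num.max 0 (Num.min s (arc_length c (cright c))))%R).
Proof.
move=> rc s; set L := arc_length _ _.
have L0 : (0 <= L)%R.
  by rewrite -(arc_length_left c) arc_length_le// cleft_le_cright.
have lip a b : (a <= b)%R -> (mdist (arc_param c (Num.max 0 (Num.min a L)))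
    (arc_param c (Num.max 0 (Num.min b L))) <= b - a)%R.
  move=> ab; apply: (@le_trans _ _
      (Num.max 0 (Num.min b L) - Num.max 0 (Num.min a L)))%R.
    apply: mdist_arc_param => //; first by rewrite le_max lexx.
      rewrite ge_max !le_max lexx/=; apply/orP; right.
      by rewrite le_min !ge_min ab lexx orbT.
    by rewrite ge_max L0 ge_min lexx orbT.
  by move: ab L0; rewrite /Num.max /Num.min; do 4 case: ifPn => //; lra.
move=> B; rewrite -nbhs_ballE => -[e /= e0 eB].
exists e => // t /= st; apply: eB; rewrite ballEmdist/=.
have [ab|ba] := leP s t.
  by rewrite (le_lt_trans (lip _ _ ab))// (le_lt_trans (ler_norm _))// distrC.
by rewrite metric_sym (le_lt_trans (lip _ _ (ltW ba)))// (le_lt_trans (ler_norm _)).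
Qed.

Lemma continuous_borel {R' : realType} {Y : pmetricType R'} (f : R -> Y) :
  continuous f ->
  measurable_fun setT (f : R -> g_sigma_algebraType (@open Y)).
Proof.
move=> cf; apply: (@measurability _ _ _ (g_sigma_algebraType (@open Y)) setT f (@open Y)) => //.
by move=> _ [U oU <-]; rewrite setTI; apply: open_measurable; move/continuousP: cf; apply.
Qed.

(** The measure is the image of length under the arc length parametrization. Through it every rule
    for line integrals becomes one for integrals against a measure. *)
Lemma line_integral_measure c : rectifiable c ->
  exists m : {measure set XB -> \bar R}, forall g, borel_fun g ->
    (forall x, 0 <= g x) -> line_integral c g = \int[m]_x g x.
Proof.
move=> rc; have cf := arc_param_continuous rc; set L := arc_length _ _ in cf.
set f := (fun s => _) in cf.
have mf := continuous_borel cf.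
have mI : measurable (`[0%R, L]%classic : set R) by [].
exists (pushforward (mrestr mu mI) (f : R -> XB)) => g mg g0.
rewrite ge0_integral_pushforward//= preimage_setT.
rewrite ge0_integral_mrestr//; last exact: (measurableT_comp mg mf).
rewrite /line_integral curve_lengthE//= -/L; apply: eq_integral => s.
rewrite inE/= in_itv/= => /andP[s0 sL].
by rewrite /f (min_idPl sL) (max_idPr s0).
Unshelve. exact: mf. Qed.

Lemma line_integral_ge0 c g : rectifiable c -> borel_fun g ->
  (forall x, 0 <= g x) -> 0 <= line_integral c g.
Proof. by move=> rc mg g0; apply: integral_ge0. Qed.

End line_integral.

(** * Translation of the parameter, subcurves and splitting of curves *)

Section translation.
Context {R : realType}.
Local Notation mu := (@lebesgue_measure R).

Let measurable_addl (a : R) :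
  measurable_fun setT ((fun x => a + x)%R : R -> measurableTypeR R).
Proof. exact: measurable_funD. Qed.

Lemma lebesgue_measureD (a : R) (A : set R) : measurable A ->
  pushforward mu ((fun x => a + x)%R : _ -> measurableTypeR R) A = mu A.
Proof.
move=> mA; apply/esym/lebesgue_measure_unique => //=.
  exact: measurable_addl.
  move=> _ _ [[x y]] _ <-; rewrite /pushforward.
  have -> : (fun z => a + z)%R @^-1` `]x, y] = `](x - a)%R, (y - a)%R]%classic.
    by apply/seteqP; split => z /=; rewrite !in_itv/= ltrBlDl lerBrDl.
  rewrite !lebesgue_measure_itv/= !lte_fin ltrD2r.
  by case: ifPn => // _; rewrite -!EFinB; congr EFin; ring.
Qed.

Lemma ge0_integral_translation (f : R -> \bar R) (a b : R) :
  measurable_fun setT f -> (forall x, 0 <= f x) ->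
  \int[mu]_(x in `[a, b]) f x =
  \int[mu]_(x in `[0%R, (b - a)%R]) f (a + x)%R.
Proof.
move=> mf f0.
have -> : `[0%R, (b - a)%R]%classic =
    ((fun x => a + x)%R : _ -> measurableTypeR R) @^-1` `[a, b].
  by apply/seteqP; split => z /=; rewrite !in_itv/= lerDl lerBrDl.
have mfI : measurable_fun (`[a, b]%classic : set (measurableTypeR R)) f.
  exact: measurable_funTS.
have fI : {in `[a, b]%classic, forall y, 0 <= f y} by [].
have := @ge0_integral_pushforward _ _ (measurableTypeR R) (measurableTypeR R) R _
  (measurable_addl a) (lebesgue_measure : {measure set _ -> \bar R}) _ f (measurable_itv _) mfI fI.
move=> /= <-; apply: eq_measure_integral => /=.
  exact: measurable_addl.
by move=> _ A mA AS; exact/esym/lebesgue_measureD.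
Qed.

End translation.

Section subcurve.
Context {R : realType} {X : pmetricType R}.
Implicit Types (c : curve X) (s t : R) (g : X -> \bar R).
Local Notation mu := (@lebesgue_measure R).

Let subcurve_continuous c s t : (cleft c <= s)%R -> (t <= cright c)%R ->
  {within `[s, t], continuous c}.
Proof.
move=> ls tr; apply: continuous_subspaceW (@cmap_continuous _ _ c).
by move=> x /=; rewrite !in_itv/= => /andP[? ?]; apply/andP; split; lra.
Qed.

Definition subcurve c s t (ls : (cleft c <= s)%R) (st : (s <= t)%R)
    (tr : (t <= cright c)%R) : curve X :=
  Curve st (subcurve_continuous ls tr).

Variables (c : curve X) (s t : R).
Hypotheses (rc : rectifiable c).
Hypotheses (ls : (cleft c <= s)%R) (st : (s <= t)%R) (tr : (t <= cright c)%R).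

Let d := subcurve ls st tr.

Lemma rectifiable_subcurve : rectifiable d.
Proof.
rewrite /rectifiable -[curve_length d]/(path_length c s t).
by rewrite arc_lengthB// ltry.
Qed.

Lemma arc_length_subcurve x : (s <= x)%R -> (x <= t)%R ->
  arc_length d x = (arc_length c x - arc_length c s)%R.
Proof.
move=> sx xt; rewrite [LHS]/arc_length -[path_length _ _ _]/(path_length c s x).
by rewrite arc_lengthB//; exact: le_trans tr.
Qed.

(** The arc length of [d] starts from zero at [s], so its parametrization is that of [c] shifted by
    [arc_length c s]; translation invariance of Lebesgue measure absorbs the shift. *)
Lemma line_integral_subcurve g : borel_fun g -> (forall x, 0 <= g x) ->
  line_integral d g =
  \int[mu]_(x in `[arc_length c s, arc_length c t]) g (arc_param c x).
Proof.
move=> mg g0; have rd := rectifiable_subcurve.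
set L := arc_length c (cright c).
pose F x := g (arc_param c (Num.max 0 (Num.min x L))%R).
have mF : measurable_fun setT F.
  exact: (measurableT_comp mg (continuous_borel (arc_param_continuous rc))).
have clampE x : (0 <= x)%R -> (x <= L)%R -> F x = g (arc_param c x).
  by move=> x0 xL; rewrite /F (min_idPl xL) (max_idPr x0).
have Ls0 : (0 <= arc_length c s)%R.
  by rewrite -(arc_length_left c) arc_length_le// (le_trans st).
have LtL : (arc_length c t <= L)%R by rewrite arc_length_le// (le_trans ls).
transitivity (\int[mu]_(x in `[arc_length c s, arc_length c t]) F x); last first.
  apply: eq_integral => x; rewrite inE/= in_itv/= => /andP[sx xt].
  by rewrite clampE//; [exact: le_trans sx|exact: le_trans LtL].
rewrite ge0_integral_translation//; last by move=> x; exact: g0.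
rewrite /line_integral curve_lengthE//.
rewrite [fine _]arc_length_subcurve//=; apply: eq_integral => x.
rewrite inE/= in_itv/= => /andP[x0 xt].
rewrite clampE; [|by rewrite addr_ge0|by lra].
congr g; have [|y yI <-] := @arc_length_surj _ _ d x rd.
  by rewrite x0/= arc_length_subcurve.
rewrite arc_paramE// arc_length_subcurve; [|by case/andP: yI..].
rewrite addrC subrK arc_paramE//.
by move: yI; rewrite /d/= => /andP[sy yt]; rewrite (le_trans ls)// (le_trans yt).
Qed.

End subcurve.

Lemma curve_split {R : realType} {X : pmetricType R} (c : curve X) (t : R) :
  rectifiable c -> (cleft c <= t <= cright c)%R ->
  exists c1 c2 : curve X, [/\ rectifiable c1, rectifiable c2,
    arc_length c1 (cright c1) = arc_length c t,
    arc_length c2 (cright c2) =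
      (arc_length c (cright c) - arc_length c t)%R &
    [/\ c1 (cleft c1) = c (cleft c), c1 (cright c1) = c t,
      c2 (cleft c2) = c t, c2 (cright c2) = c (cright c) &
      forall g, borel_fun g -> (forall x, 0 <= g x) ->
      line_integral c g = line_integral c1 g + line_integral c2 g]].
Proof.
move=> rc /andP[lt tr].
exists (subcurve (lexx _) lt tr), (subcurve lt tr (lexx _)).
split; [exact: rectifiable_subcurve|exact: rectifiable_subcurve| | |].
- by rewrite arc_length_subcurve// arc_length_left subr0.
- by rewrite arc_length_subcurve.
split => // g mg g0.
rewrite !line_integral_subcurve// arc_length_left.
set L := arc_length c (cright c).
pose F x := g (arc_param c (Num.max 0 (Num.min x L))%R).
have mF : measurable_fun setT F.
  exact: (measurableT_comp mg (continuous_borel (arc_param_continuous rc))).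
have clampE x : (0 <= x)%R -> (x <= L)%R -> F x = g (arc_param c x).
  by move=> x0 xL; rewrite /F (min_idPl xL) (max_idPr x0).
have Lt0 : (0 <= arc_length c t)%R by rewrite -(arc_length_left c) arc_length_le.
have LtL : (arc_length c t <= L)%R by rewrite arc_length_le.
rewrite /line_integral curve_lengthE//= -/L.
transitivity (\int[lebesgue_measure]_(x in `[0%R, L]) F x).
  by apply: eq_integral => x; rewrite inE/= in_itv/= => /andP[x0 xL]; rewrite clampE.
transitivity (\int[lebesgue_measure]_(x in `[0%R, arc_length c t]) F x +
    \int[lebesgue_measure]_(x in `[arc_length c t, L]) F x); last first.
  congr (_ + _); apply: eq_integral => x; rewrite inE/= in_itv/= => /andP[x0 xL].
    by rewrite clampE// (le_trans xL).
  by rewrite clampE// (le_trans Lt0).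
(* Removing the common end point from the second interval makes the two pieces disjoint. *)
rewrite -[in RHS]integral_itv_obnd_cbnd; last exact: measurable_funTS.
rewrite -ge0_integral_setU//=.
- by rewrite -itv_bndbnd_setU ?bnd_simp.
- exact: measurable_funTS.
- by move=> x _; exact: g0.
- apply/disj_setPS => x [] /=; rewrite !in_itv/= => /andP[_ xt] /andP[tx _].
  by move: xt; rewrite leNgt tx.
Qed.

(** * Borel functions, Lipschitz functions and rules for line integrals *)

Lemma ge0_dominated_le d (T : measurableType d) (R : realType)
    (m : {measure set T -> \bar R}) (f_ : (T -> \bar R)^nat)
    (f h : T -> \bar R) (a : \bar R) :
  (forall n, measurable_fun setT (f_ n)) -> measurable_fun setT f ->
  measurable_fun setT h -> (forall n x, 0 <= f_ n x <= h x) ->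
  \int[m]_x h x < +oo -> (forall x, f_ ^~ x @ \oo --> f x) ->
  (forall n, a <= \int[m]_x f_ n x) -> a <= \int[m]_x f x.
Proof.
move=> mf_ mf mh f_h hoo f_f af.
have h0 x : 0 <= h x by have /andP[] := f_h 0%N x; exact: le_trans.
have ih : m.-integrable setT h.
  apply/integrableP; split => //.
  by under eq_integral do rewrite gee0_abs//.
have [] := @dominated_convergence _ _ _ m setT measurableT f_ f h mf_ mf.
- exact: aeW.
- exact: ih.
- by apply: aeW => x n _; have /andP[fx0 fxh] := f_h n x; rewrite gee0_abs.
by move=> _ _; apply: cvge_ge; exact: nearW.
Qed.

Section borel_functions.
Context {R : realType} {X : pmetricType R}.
Implicit Types (g : X -> \bar R) (B O : set X).
Local Notation XB := (g_sigma_algebraType (@open X)).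

Lemma open_borel O : open O -> borel O.
Proof. by move=> oO; apply: sub_gen_smallest. Qed.

Lemma closed_borel O : closed O -> borel O.
Proof.
move=> cO; rewrite -(setCK O).
by apply: (@measurableC _ XB); exact: (open_borel (closed_openC cO)).
Qed.

Lemma borel_fun_patch g g' B : borel B -> borel_fun g -> borel_fun g' ->
  borel_fun (patch g B g').
Proof.
move=> mB mg mg'; apply: (@measurable_fun_ifT _ _ XB) => //.
apply: (@measurable_fun_bool _ XB _ _ true) => //.
rewrite setTI (_ : _ @^-1` _ = B)//; apply/seteqP.
by split => x /= => [/set_mem|/mem_set].
Qed.

End borel_functions.

Section lipschitz.
Context {R : realType} {X : pmetricType R}.

Lemma lipschitz_continuous (u : X -> R) (L : R) :
  (forall x y, `|u x - u y| <= L * mdist x y)%R -> continuous u.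
Proof.
move=> lip x; apply/cvgrPdist_lt => e e0; apply/nbhs_ballP.
exists (e / (`|L| + 1))%R; first by rewrite /= divr_gt0// ltr_wpDl.
move=> y; rewrite ballEmdist/= ltr_pdivlMr ?ltr_wpDl// => xy.
apply: le_lt_trans (lip x y) _; apply: le_lt_trans xy.
rewrite mulrC ler_wpM2l ?mdist_ge0//.
by rewrite (le_trans (ler_norm L))// lerDl.
Qed.

Lemma mdistl_lip (y x z : X) : (`|mdist x y - mdist z y| <= 1 * mdist x z)%R.
Proof.
rewrite mul1r ler_norml lerBlDr lerNl opprB lerBlDr metric_triangle andbT.
by rewrite (metric_sym x) metric_triangle.
Qed.

End lipschitz.

Section line_integral_theory.
Context {R : realType} {X : pmetricType R}.
Implicit Types (c : curve X) (g h : X -> \bar R).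
Local Notation XB := (g_sigma_algebraType (@open X)).

Lemma le_line_integral c g h : rectifiable c ->
  borel_fun g -> (forall x, 0 <= g x) -> borel_fun h ->
  (forall x, g x <= h x) -> line_integral c g <= line_integral c h.
Proof.
move=> rc mg g0 mh gh; have [m mE] := line_integral_measure rc.
have h0 x : 0 <= h x by exact: le_trans (gh x).
by rewrite !mE//; apply: ge0_le_integral => // x _.
Qed.

Lemma line_integralD c g h : rectifiable c ->
  borel_fun g -> (forall x, 0 <= g x) ->
  borel_fun h -> (forall x, 0 <= h x) ->
  line_integral c (fun x => g x + h x) = line_integral c g + line_integral c h.
Proof.
move=> rc mg g0 mh h0; have [m mE] := line_integral_measure rc.
rewrite !mE//; last by move=> x; exact: adde_ge0.
  exact: ge0_integralD.
exact: (@emeasurable_funD _ XB).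
Qed.

Lemma line_integralZ c g (k : R) : rectifiable c -> (0 <= k)%R ->
  borel_fun g -> (forall x, 0 <= g x) ->
  line_integral c (fun x => k%:E * g x) = k%:E * line_integral c g.
Proof.
move=> rc k0 mg g0; have [m mE] := line_integral_measure rc.
rewrite !mE//; last by move=> x; rewrite mule_ge0.
  exact: ge0_integralZl_EFin.
exact: (@measurable_funeM _ XB).
Qed.

Lemma line_integral_cst c (k : R) : rectifiable c -> (0 <= k)%R ->
  line_integral c (cst k%:E) = (k * arc_length c (cright c))%:E.
Proof.
move=> rc k0; rewrite /line_integral integral_cst//= lebesgue_measure_itv/=.
rewrite curve_lengthE//= lte_fin; case: ltP => // L0.
  by rewrite sube0.
have -> : arc_length c (cright c) = 0%R; last by rewrite mulr0 mule0.
apply/eqP; rewrite eq_le L0 -(arc_length_left c) arc_length_le//.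
exact: cleft_le_cright.
Qed.

Lemma line_integral_dominated c (g_ : (X -> \bar R)^nat) g h (a : \bar R) :
  rectifiable c -> (forall n, borel_fun (g_ n)) -> borel_fun g -> borel_fun h ->
  (forall n x, 0 <= g_ n x <= h x) -> (forall x, g_ ^~ x @ \oo --> g x) ->
  line_integral c h < +oo -> (forall n, a <= line_integral c (g_ n)) ->
  a <= line_integral c g.
Proof.
move=> rc mg_ mg mh g_h g_g; have [m mE] := line_integral_measure rc.
have h0 x : 0 <= h x by have /andP[] := g_h 0%N x; exact: le_trans.
have g0 x : 0 <= g x.
  by apply: cvge_ge (g_g x); apply: nearW => n; have /andP[] := g_h n x.
rewrite !mE// => hoo ag.
apply: (@ge0_dominated_le _ XB _ m g_ g h) => // n.
by rewrite -mE// => x; have /andP[] := g_h n x.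
Qed.

Lemma mdist_curve_length c s t : rectifiable c ->
  (cleft c <= s)%R -> (s <= t)%R -> (t <= cright c)%R ->
  (mdist (c s) (c t) <= arc_length c (cright c))%R.
Proof.
move=> rc ls st tr.
rewrite -lee_fin (le_trans (mdist_path_length c st))// arc_lengthB// lee_fin.
rewrite lerBlDr (le_trans (arc_length_le rc (le_trans ls st) tr (lexx _)))//.
by rewrite lerDl -(arc_length_left c) arc_length_le// (le_trans st).
Qed.

Lemma arc_param_in c s : rectifiable c ->
  (0 <= s <= arc_length c (cright c))%R ->
  exists2 t, (cleft c <= t <= cright c)%R & arc_param c s = c t.
Proof.
move=> rc sI; have [t tI <-] := arc_length_surj rc sI.
by exists t => //; rewrite arc_paramE.
Qed.

Lemma eq_line_integral c g h : rectifiable c ->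
  (forall t, (cleft c <= t <= cright c)%R -> g (c t) = h (c t)) ->
  line_integral c g = line_integral c h.
Proof.
move=> rc gh; rewrite /line_integral curve_lengthE//; apply: eq_integral => s.
rewrite inE/= in_itv/= => sI.
by have [t tI ->] := arc_param_in rc sI; exact: gh.
Qed.

End line_integral_theory.

(** * Upper gradients along the curves of finite weight *)

Section upper_gradients_along.
Context {R : realType} {X : pmetricType R}.
Implicit Types (c : curve X) (g h rho : X -> \bar R) (u v : X -> R).
Local Notation XB := (g_sigma_algebraType (@open X)).

(* The gradients that are tested on the curves along which [rho] is integrable:
   for [rho] in L^p these are almost all curves, but unlike that class this one
   is visibly closed under passing to subcurves. *)
Definition ug_along rho u g :=
  [/\ borel_fun g, forall x, 0 <= g x &
    forall c, rectifiable c -> line_integral c rho < +oo ->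
      line_integral c g < +oo /\ ug_ineq u g c].

Lemma ug_alongW rho rho' u g :
  (forall c, rectifiable c -> line_integral c rho' < +oo ->
    line_integral c rho < +oo) ->
  ug_along rho u g -> ug_along rho' u g.
Proof.
move=> rr' [mg g0 ugg]; split => // c rc /(rr' _ rc); exact: ugg.
Qed.

Lemma ug_along_le rho u v g : (forall x y, `|v x - v y| <= `|u x - u y|)%R ->
  ug_along rho u g -> ug_along rho v g.
Proof.
move=> vu [mg g0 ugg]; split => // c rc /(ugg _ rc)[goo ineq]; split=> //.
by apply: le_trans ineq; rewrite lee_fin.
Qed.

(** Only the values at the two ends of a curve enter, so this covers the minimum of [u1] and [u2].
    The gradients are not added, which is what later keeps a cutoff cheap. *)
Lemma ug_along_max rho u1 u2 v g1 g2 :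
  (forall x y, `|v x - v y| <= Num.max `|u1 x - u1 y| `|u2 x - u2 y|)%R ->
  ug_along rho u1 g1 -> ug_along rho u2 g2 ->
  ug_along rho v (fun x => maxe (g1 x) (g2 x)).
Proof.
move=> vu [mg1 g10 ug1] [mg2 g20 ug2].
have mm : borel_fun (fun x => maxe (g1 x) (g2 x)).
  exact: (@measurable_maxe _ XB).
split => // [x|c rc rhooo]; first by rewrite le_max g10.
have [goo1 ineq1] := ug1 c rc rhooo; have [goo2 ineq2] := ug2 c rc rhooo.
split.
  apply: (@le_lt_trans _ _ (line_integral c (fun x => g1 x + g2 x))).
    apply: le_line_integral => // [x||x]; first by rewrite le_max g10.
      exact: (@emeasurable_funD _ XB).
    by rewrite ge_max leeDl// leeDr.
  by rewrite line_integralD// lte_add_pinfty.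
apply: (@le_trans _ _ (maxe (line_integral c g1) (line_integral c g2))).
  apply: le_trans (_ : (Num.max `|u1 (c (cleft c)) - u1 (c (cright c))|
    `|u2 (c (cleft c)) - u2 (c (cright c))|)%:E <= _).
    by rewrite lee_fin.
  by rewrite EFin_max; apply: le_max2; [exact: ineq1|exact: ineq2].
by rewrite ge_max !le_line_integral// => x; rewrite le_max lexx ?orbT.
Qed.

Lemma ug_along_add rho u1 u2 v g1 g2 :
  (forall x y, `|v x - v y| <= `|u1 x - u1 y| + `|u2 x - u2 y|)%R ->
  ug_along rho u1 g1 -> ug_along rho u2 g2 ->
  ug_along rho v (fun x => g1 x + g2 x).
Proof.
move=> vu [mg1 g10 ug1] [mg2 g20 ug2].
split => [|x|c rc rhooo]; first exact: (@emeasurable_funD _ XB).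
  by rewrite adde_ge0.
have [goo1 ineq1] := ug1 c rc rhooo; have [goo2 ineq2] := ug2 c rc rhooo.
rewrite /ug_ineq line_integralD//; split; first by rewrite lte_add_pinfty.
by apply: le_trans (leeD ineq1 ineq2); rewrite -EFinD lee_fin.
Qed.

Lemma ug_alongZ rho u v g (k : R) : (0 <= k)%R ->
  (forall x y, `|v x - v y| <= k * `|u x - u y|)%R ->
  ug_along rho u g -> ug_along rho v (fun x => k%:E * g x).
Proof.
move=> k0 vu [mg g0 ug1].
split => [|x|c rc rhooo]; first exact: (@measurable_funeM _ XB).
  by rewrite mule_ge0.
have [goo ineq] := ug1 c rc rhooo.
rewrite /ug_ineq line_integralZ//; split.
  by rewrite lte_mul_pinfty// lee_fin.
apply: (@le_trans _ _ (k%:E * (`|u (c (cleft c)) - u (c (cright c))|)%:E)).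
  by rewrite -EFinM lee_fin.
by apply: lee_wpmul2l => //; rewrite lee_fin.
Qed.

Lemma ug_along_lip rho u (L : R) : (0 <= L)%R ->
  (forall x y, `|u x - u y| <= L * mdist x y)%R -> ug_along rho u (cst L%:E).
Proof.
move=> L0 lip; split => [|x|c rc _]; first exact: (@measurable_cst _ _ XB).
  by rewrite lee_fin.
rewrite /ug_ineq line_integral_cst// ltry lee_fin; split => //.
rewrite (le_trans (lip _ _))// ler_wpM2l//.
by apply: mdist_curve_length; rewrite ?cleft_le_cright.
Qed.

Section fixed_rho.
Variable rho : X -> \bar R.
Hypotheses (mrho : borel_fun rho) (rho0 : forall x, 0 <= rho x).

(** Bisecting by arc length reaches pieces shorter than [e], and the inequalities of the pieces add
    up: increments by the triangle inequality, line integrals by [curve_split]. The pieces stay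
    admissible because [rho] is integrable along them too. *)
Lemma ug_ineq_short u g (e : R) : borel_fun g -> (forall x, 0 <= g x) ->
  (0 < e)%R ->
  (forall c, rectifiable c -> line_integral c rho < +oo ->
    (arc_length c (cright c) < e)%R -> ug_ineq u g c) ->
  forall c, rectifiable c -> line_integral c rho < +oo -> ug_ineq u g c.
Proof.
move=> mg g0 e0 short c rc rhoc.
have [n cn] : exists n, (arc_length c (cright c) < e * 2 ^+ n)%R.
  have := archi_boundP (normr_ge0 (arc_length c (cright c) / e)%R).
  set n := Num.bound _ => nP; exists n; rewrite -ltr_pdivrMl// mulrC.
  rewrite (le_lt_trans (ler_norm _))// (lt_trans nP)// -natrX ltr_nat.
  exact: ltn_expl.
elim: n => [|n IH] in c rc rhoc cn *; first by apply: short => //; move: cn; rewrite expr0 mulr1.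
have L0 : (0 <= arc_length c (cright c))%R.
  by rewrite -(arc_length_left c) arc_length_le// cleft_le_cright.
have [|t tI tE] := @arc_length_surj _ _ c (arc_length c (cright c) / 2) rc.
  by rewrite divr_ge0//= ler_pdivrMr// ler_peMr// ler1n.
have [c1 [c2 [rc1 rc2 L1 L2 [c1l c1r c2l c2r LI]]]] := curve_split rc tI.
have := rhoc; rewrite LI// => rhoc12.
have LI0 c' g' : rectifiable c' -> borel_fun g' -> (forall x, 0 <= g' x) ->
  0 <= line_integral c' g' by exact: line_integral_ge0.
have i1 : ug_ineq u g c1.
  apply: IH => //; last by rewrite L1 tE ltr_pdivrMr// -mulrA -exprSr.
  by apply: le_lt_trans rhoc12; rewrite leeDl// LI0.
have i2 : ug_ineq u g c2.
  apply: IH => //; last first.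
    rewrite L2 tE; move: cn; rewrite exprS mulrCA.
    set x := arc_length _ _; set y := (e * _)%R; lra.
  by apply: le_lt_trans rhoc12; rewrite leeDr// LI0.
move: i1 i2; rewrite /ug_ineq c1l c1r c2l c2r LI// => i1 i2.
apply: le_trans (leeD i1 i2); rewrite -EFinD lee_fin.
by rewrite (le_trans _ (ler_normD _ _))// subrKA.
Qed.

(** The points of [K n] have distance at least 1/(n+1) from the complement of [O]. A curve shorter
    than that either meets [K n] and stays in [O], where [h] may be used, or misses [K n], where [g]
    may be used off [K n]. The function [H n] serves both cases and counts both gradients on the
    collar between [K n] and the boundary of [O]. The collars shrink to the empty set, and the sum
    of [h] and [g] dominates. *)
Lemma ug_along_open u v g h (O : set X) : open O ->
  (forall x, O x -> u x = v x) -> ug_along rho u g -> ug_along rho v h ->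
  ug_along rho u (patch g O h).
Proof.
move=> oO uv [mg g0 ugg] [mh h0 ugh].
have bO := open_borel oO.
have mp := borel_fun_patch bO mg mh.
pose K n := [set x | forall y, ~ O y -> (n.+1%:R^-1 <= mdist x y :> R)%R].
have bK n : borel (K n).
  apply: closed_borel; apply: closed_bigI => y _.
  apply: (closed_comp (f := mdist^~ y) _ (@closed_ge _ _)) => x _.
  exact: lipschitz_continuous (@mdistl_lip _ _ y) x.
pose H n x := patch (cst 0) O h x + patch g (K n) (cst 0) x.
have m0 : borel_fun (cst 0 : X -> \bar R) by exact: (@measurable_cst _ _ XB).
have mH n : borel_fun (H n).
  by apply: (@emeasurable_funD _ XB); exact: borel_fun_patch.
have mgh : borel_fun (fun x => h x + g x) by exact: (@emeasurable_funD _ XB).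
have patch0 (f f' : X -> \bar R) (D : set X) : (forall x, 0 <= f x) ->
    (forall x, 0 <= f' x) -> forall x, 0 <= patch f D f' x.
  by move=> f0 f'0 x; rewrite /patch; case: ifP.
have H0 n x : 0 <= H n x by rewrite adde_ge0//; apply: patch0.
have KO n x : K n x -> O x.
  move=> Kx; apply: contrapT => /Kx; rewrite mdistxx.
  by rewrite leNgt invr_gt0 ltr0n.
have Hineq n c : rectifiable c -> line_integral c rho < +oo ->
    ug_ineq u (H n) c.
  have n0 : (0 < n.+1%:R^-1 :> R)%R by rewrite invr_gt0.
  apply: (ug_ineq_short (mH n) (H0 n) n0) => {}c rc rhoc cn.
  have lr := cleft_le_cright c.
  have [[t [tI Kt]]|noK] := pselect (exists t,
      (cleft c <= t <= cright c)%R /\ K n (c t)).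
    have allO s : (cleft c <= s <= cright c)%R -> O (c s).
      move=> sI; apply: contrapT => /Kt; rewrite leNgt => /negP; apply.
      apply: le_lt_trans cn; move: sI tI => /andP[? ?] /andP[? ?].
      have [ts|st] := leP t s; first exact: mdist_curve_length.
      by rewrite metric_sym mdist_curve_length// ltW.
    rewrite /ug_ineq !uv; [|apply: allO; by rewrite lr lexx..].
    have [_ i] := ugh c rc rhoc; apply: le_trans i _.
    rewrite (@eq_line_integral _ _ c h (patch (cst 0) O h))//.
      apply: le_line_integral => //; first exact: borel_fun_patch.
        exact: patch0.
      by move=> x; rewrite /H leeDl// patch0.
    by move=> s sI; rewrite /patch mem_set//; exact: allO.
  have [_ i] := ugg c rc rhoc; apply: le_trans i _.
  rewrite (@eq_line_integral _ _ c g (patch g (K n) (cst 0)))//.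
    apply: le_line_integral => //; first exact: borel_fun_patch.
      exact: patch0.
    by move=> x; rewrite /H leeDr// patch0.
  move=> s sI; rewrite /patch memNset// => Ks; apply: noK.
  by exists s.
split => // [|c rc rhoc]; first exact: patch0.
have [goo _] := ugg c rc rhoc; have [hoo _] := ugh c rc rhoc.
have ghoo : line_integral c (fun x => h x + g x) < +oo.
  by rewrite line_integralD// lte_add_pinfty.
split.
  apply: le_lt_trans ghoo; apply: le_line_integral => //; first exact: patch0.
  by move=> x; rewrite /patch; case: ifP => _; rewrite ?leeDl// leeDr.
apply: (line_integral_dominated rc mH mp mgh _ _ ghoo) => [n x|x|n].
- rewrite H0/=; apply: leeD; rewrite /patch; case: ifP => //.
- apply: cvg_near_cst; rewrite /H /patch; case: ifPn => xO; last first.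
    apply: nearW => n; rewrite ifN ?add0e//; apply: contra xO.
    by rewrite !inE; exact: KO.
  have /set_mem Ox := xO.
  have /nbhs_ballP[e /= e0 eO] : nbhs x O by exact: open_nbhs_nbhs.
  near=> n; rewrite ifT ?adde0//; apply/mem_set => y nOy.
  rewrite leNgt; apply/negP => xy; apply: nOy; apply: eO.
  rewrite ballEmdist/=; apply: lt_trans xy _; near: n.
  exact: near_infty_natSinv_lt (PosNum e0).
- exact: Hineq.
Unshelve. all: end_near. Qed.

End fixed_rho.

End upper_gradients_along.

(** * Exchange, infima, supports and folding of gradients *)

Lemma ler_normB_same_sign (R : realFieldType) (x y : R) : (0 <= x * y)%R ->
  (`|x - y| <= `| `|x| - `|y| |)%R.
Proof.
have [x0|x0] := leP 0%R x; have [y0|y0] := leP 0%R y => xy.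
- by rewrite (ger0_norm x0) (ger0_norm y0).
- have -> : x = 0%R.
    by apply/eqP; rewrite eq_le x0 andbT -(nmulr_lge0 _ y0).
  by rewrite !sub0r normr0 sub0r !normrN normr_id.
- have -> : y = 0%R.
    by apply/eqP; rewrite eq_le y0 andbT -(nmulr_rge0 _ x0).
  by rewrite normr0 !subr0 normr_id.
- by rewrite (ltr0_norm x0) (ltr0_norm y0) -[leLHS]normrN opprB opprK [in leRHS]addrC.
Qed.

Lemma opposite_signs (R : realFieldType) (x y : R) : (x * y < 0)%R ->
  (((x <= 0) || (y <= 0)) && ((0 <= x) || (0 <= y)))%R.
Proof.
by case: (leP x 0%R) => ?; case: (leP y 0%R) => ? //=; nra.
Qed.

Lemma soft_threshold_lip (R : realFieldType) (k a b : R) : (0 < k)%R ->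
  (`|(a - Num.max (- k) (Num.min a k)) - (b - Num.max (- k) (Num.min b k))| <=
   `|a - b|)%R.
Proof.
move=> k0; have [ab|ab] := leP b a.
  rewrite (@ger0_norm _ (a - b)) ?subr_ge0// ler_norml.
  by case: (leP a k) => ?; case: (leP b k) => ?; case: (leP (- k)%R a) => ?;
    case: (leP (- k)%R b) => ?; case: (leP (- k)%R k) => ?;
    apply/andP; split; lra.
rewrite (@ltr0_norm _ (a - b)) ?subr_lt0// ler_norml.
by case: (leP a k) => ?; case: (leP b k) => ?; case: (leP (- k)%R a) => ?;
  case: (leP (- k)%R b) => ?; case: (leP (- k)%R k) => ?;
  apply/andP; split; lra.
Qed.

Lemma soft_threshold_dist (R : realFieldType) (k a : R) : (0 < k)%R ->
  (`|a - (a - Num.max (- k) (Num.min a k))| <= k)%R.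
Proof.
move=> k0; rewrite subKr ler_norml.
by case: (leP a k) => ?; case: (leP (- k)%R a) => ?;
  case: (leP (- k)%R k) => ?; apply/andP; split; lra.
Qed.

Section upper_gradients_along_closure.
Context {R : realType} {X : pmetricType R}.
Implicit Types (c : curve X) (g h : X -> \bar R) (u : X -> R).
Local Notation XB := (g_sigma_algebraType (@open X)).
Variable rho : X -> \bar R.
Hypotheses (mrho : borel_fun rho) (rho0 : forall x, 0 <= rho x).

Lemma ug_along_dominated u (g_ : (X -> \bar R)^nat) g h : borel_fun g ->
  (forall n, ug_along rho u (g_ n)) -> borel_fun h ->
  (forall c, rectifiable c -> line_integral c rho < +oo ->
    line_integral c h < +oo) ->
  (forall n x, g_ n x <= h x) -> (forall x, g_ ^~ x @ \oo --> g x) ->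
  ug_along rho u g.
Proof.
move=> mg ug_ mh hoo gh gg.
have g_0 n x : 0 <= g_ n x by have [_ + _] := ug_ n.
have g0 x : 0 <= g x by apply: cvge_ge (gg x); exact: nearW.
split => // c rc rhoc; have ch := hoo c rc rhoc; split.
  apply: le_lt_trans ch; apply: le_line_integral => // x.
  by apply: cvge_le (gg x); exact: nearW.
apply: (line_integral_dominated rc _ mg mh _ gg ch) => [n|n x|n].
- by have [] := ug_ n.
- by rewrite g_0 gh.
- by have [_ _ /(_ c rc rhoc)[]] := ug_ n.
Qed.

(** The admissible sets form a sigma-algebra containing the open sets. Since [G] quantifies over all
    pairs of gradients, complements follow by swapping the two, unions by patching twice, and
    countable unions by dominated convergence. *)
Lemma ug_along_patch u g h (E : set X) : borel E ->
  ug_along rho u g -> ug_along rho u h -> ug_along rho u (patch g E h).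
Proof.
pose G : set (set X) := [set E | borel E /\ forall g h, ug_along rho u g ->
  ug_along rho u h -> ug_along rho u (patch g E h)].
suff : <<s open>> `<=` G by move=> EG bE; have [_] := EG _ bE; exact.
apply: smallest_sub; last first.
  move=> O oO; split => [|g' h' ug' uh']; first exact: open_borel.
  exact: (ug_along_open mrho rho0 oO _ ug' uh').
have GC A : G A -> G (~` A).
  move=> [bA ugA]; split => [|g' h' ug' uh'].
    exact: (@measurableC _ XB).
  rewrite (_ : patch _ _ _ = patch h' A g'); first exact: ugA.
  apply/funext => x; rewrite /patch in_setC; by case: (x \in A).
have GU A B : G A -> G B -> G (A `|` B).
  move=> [bA ugA] [bB ugB]; split => [|g' h' ug' uh'].
    exact: (@measurableU _ XB).
  rewrite (_ : patch _ _ _ = patch (patch g' A h') B h').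
    by apply: ugB => //; exact: ugA.
  apply/funext => x; rewrite /patch in_setU.
  by case: (x \in A); case: (x \in B).
have G0 : G set0.
  split => [|g' h' ug' uh']; first exact: (@measurable0 _ XB).
  by rewrite patch_set0.
split => //; first by move=> A GA; rewrite setTD; exact: GC.
move=> F GF; pose F' n := \big[setU/set0]_(i < n) F i.
have GF' n : G (F' n).
  by rewrite /F'; elim/big_ind : _.
split => [|g' h' ug' uh'].
  by apply: (@bigcupT_measurable _ XB) => n; have [] := GF n.
have [mg' g'0 _] := ug'; have [mh' h'0 _] := uh'.
have bF : borel (\bigcup_n F n).
  by apply: (@bigcupT_measurable _ XB) => n; have [] := GF n.
apply: (@ug_along_dominated _ (fun n => patch g' (F' n) h') _
  (fun x => g' x + h' x)).
- exact: borel_fun_patch.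
- by move=> n; have [_] := GF' n; exact.
- exact: (@emeasurable_funD _ XB).
- move=> c rc rhoc; rewrite line_integralD//.
  have [_ _ /(_ c rc rhoc)[+ _]] := ug'; have [_ _ /(_ c rc rhoc)[+ _]] := uh'.
  by move=> *; rewrite lte_add_pinfty.
- by move=> n x; rewrite /patch; case: ifP; rewrite ?leeDl ?leeDr.
- move=> x; apply: cvg_near_cst; rewrite /patch; case: ifPn => xF; last first.
    apply: nearW => n; rewrite ifN//; apply: contra xF; rewrite !inE.
    by move=> xF'; apply: (@bigsetU_bigcup _ F n).
  have /set_mem[k _ Fkx] := xF.
  near=> n; rewrite ifT//; apply/mem_set.
  rewrite /F' -bigcup_mkord; exists k => //=.
  by near: n; exact: nbhs_infty_gt.
Unshelve. all: end_near. Qed.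

Lemma ug_along_mine u g h : ug_along rho u g -> ug_along rho u h ->
  ug_along rho u (fun x => mine (g x) (h x)).
Proof.
move=> ug uh; have [mg _ _] := ug; have [mh _ _] := uh.
pose E := [set x | h x <= g x].
have bE : borel E.
  rewrite -[E]setTI.
  by have := @measurable_lee _ XB R setT measurableT h g mh mg; apply.
rewrite (_ : (fun x => _) = patch g E h); first exact: ug_along_patch.
apply/funext => x; rewrite /patch; case: ifPn => [/set_mem/min_idPr//|].
move=> /negP xE; apply/min_idPl; rewrite leNgt; apply/negP => /ltW hg.
by apply: xE; apply/mem_set.
Qed.

(** The infimum is the limit of decreasing finite minima, which are dominated by [g_ 0], and its
    line integrals along the admissible curves are finite. *)
Lemma ug_along_einfs u (g_ : (X -> \bar R)^nat) :
  (forall n, ug_along rho u (g_ n)) ->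
  ug_along rho u (fun x => ereal_inf (range (g_ ^~ x))).
Proof.
move=> ug_.
pose G n := fun x => \big[mine/+oo]_(i < n.+1) g_ i x.
have GS n : G n.+1 = fun x => mine (G n x) (g_ n.+1 x).
  apply/funext => x; rewrite /G big_ord_recr//.
have G0 : G 0%N = g_ 0%N.
  by apply/funext => x; rewrite /G big_ord_recr big_ord0/= minye.
have uG n : ug_along rho u (G n).
  elim: n => [|n IH]; first by rewrite G0.
  by rewrite GS; exact: ug_along_mine.
have Gg n k x : (k <= n)%N -> G n x <= g_ k x.
  by move=> kn; rewrite /G (bigD1 (inord k))//= inordK// ge_min lexx.
have ginf x k : ereal_inf (range (g_ ^~ x)) <= g_ k x.
  by apply: ereal_inf_lbound; exists k.
have infG x n : ereal_inf (range (g_ ^~ x)) <= G n x.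
  rewrite /G; apply: (big_ind (fun y => ereal_inf (range (g_ ^~ x)) <= y)).
  - exact: leey.
  - by move=> y z yi zi; rewrite le_min yi.
  - by move=> i _; exact: ginf.
have Gcvg x : G ^~ x @ \oo --> ereal_inf (range (g_ ^~ x)).
  have : nonincreasing_seq (G ^~ x).
    by apply/nonincreasing_seqP => n; rewrite GS ge_min lexx.
  move/ereal_nonincreasing_cvgn; suff -> : ereal_inf (range (G ^~ x)) =
    ereal_inf (range (g_ ^~ x)) by [].
  apply/eqP; rewrite eq_le; apply/andP; split.
    apply: le_ereal_inf_tmp => _ [k _ <-].
    by apply: le_trans (Gg k k x _) => //; apply: ereal_inf_lbound; exists k.
  by apply: le_ereal_inf_tmp => _ [k _ <-].
have mG n : borel_fun (G n) by have [] := uG n.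
apply: (@ug_along_dominated _ G _ (g_ 0%N)) => //.
- exact: (@emeasurable_fun_cvg _ XB R setT G _ mG (fun x _ => Gcvg x)).
- by have [] := ug_ 0%N.
- by move=> c rc rhoc; have [_ _ /(_ c rc rhoc)[]] := ug_ 0%N.
- by move=> n x; exact: Gg.
Qed.

(** The zero set of [u] is closed, so the exchange on open sets does not apply to it directly. A
    soft threshold of [u] vanishes on an open neighbourhood of the zero set, where it can be
    compared with the zero function, and it differs from [u] by at most [k], which is arbitrarily
    small. *)
Lemma ug_along_support u g : continuous u -> ug_along rho u g ->
  ug_along rho u (patch (cst 0) [set x | u x != 0%R] g).
Proof.
move=> cu ugu; have [mg g0 ug] := ugu.
have bu : borel [set x | u x != 0%R].
  rewrite (_ : [set x | _] = ~` (u @^-1` [set 0%R])).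
    apply: open_borel; apply: closed_openC.
    by apply: closed_comp => // x _; exact: cu.
  by apply/seteqP; split => x /= /eqP.
have m0 : borel_fun (cst 0 : X -> \bar R) by exact: (@measurable_cst _ _ XB).
have mp := borel_fun_patch bu m0 mg.
have p0 x : 0 <= patch (cst 0) [set x | u x != 0%R] g x.
  by rewrite /patch; case: ifP.
split => // c rc rhoc; have [goo _] := ug c rc rhoc; split.
  apply: le_lt_trans goo; apply: le_line_integral => // x.
  by rewrite /patch; case: ifP => //= _; exact: g0.
apply/lee_addgt0Pr => e e0.
have [k k0 ek] : exists2 k : R, (0 < k)%R & (k + k <= e)%R.
  by exists (e / 2)%R; [rewrite divr_gt0|rewrite -splitr].
(* the soft threshold vanishes on the open set where |u| < k *)
pose w x := (u x - Num.max (- k) (Num.min (u x) k))%R.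
pose O := [set x | `|u x| < k]%R.
have oO : open O.
  apply: (@open_comp _ _ (fun x => `|u x|)%R) (@open_lt _ k) => x _.
  by apply: continuous_comp (@norm_continuous _ _ _); exact: cu.
have wu x y : (`|w x - w y| <= `|u x - u y|)%R.
  exact: soft_threshold_lip.
have uw x : (`|u x - w x| <= k)%R by exact: soft_threshold_dist.
have ugw := ug_along_le wu ugu.
have ug0 : ug_along rho (cst 0%R : X -> R) (cst 0).
  by apply: ug_along_lip => // x y; rewrite subrr normr0 mul0r.
have w0 x : O x -> w x = cst 0%R x.
  rewrite /O/w/= ltr_norml => /andP[ux1 ux2].
  by rewrite (min_idPl (ltW ux2)) (max_idPr (ltW ux1)) subrr.
have [_ _ /(_ c rc rhoc)[_ iw]] := ug_along_open mrho rho0 oO w0 ugw ug0.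
have LIle : line_integral c (patch g O (cst 0)) <=
    line_integral c (patch (cst 0) [set x | u x != 0%R] g).
  apply: le_line_integral => //.
  - by apply: borel_fun_patch => //; exact: open_borel.
  - by move=> x; rewrite /patch; case: ifP.
  - move=> x; rewrite {1}/patch; case: ifPn => // xO; rewrite /patch ifT//.
    apply/mem_set => /=; apply: contra xO => /eqP ux0; apply/mem_set.
    by rewrite /O/= ux0 normr0.
apply: le_trans (leeD2r _ (le_trans iw LIle)).
rewrite -EFinD lee_fin.
set a := c (cleft c); set b := c (cright c).
have := uw a; have := uw b.
move: (u a) (u b) (w a) (w b) => ua ub wa wb.
have -> : (ua - ub = (wa - wb) + ((ua - wa) - (ub - wb)))%R by ring.
move=> h1 h2; apply: le_trans (ler_normD _ _) _; rewrite lerD2l.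
apply: le_trans (ler_normB _ _) _; apply: le_trans ek.
by rewrite lerD.
Qed.

(** Nothing is lost if both ends of the curve lie on the same side of the level [k]. Otherwise [u]
    takes the value [k] somewhere on the curve, by the intermediate value theorem, and cutting there
    reduces to pieces on which the absolute value sees the whole increment. *)
Lemma ug_along_fold u g (k : R) : continuous u ->
  ug_along rho (fun x => `|u x - k|)%R g -> ug_along rho u g.
Proof.
move=> cu [mg g0 ug]; split => // c rc rhoc.
have [goo i] := ug c rc rhoc; split => //.
have lr := cleft_le_cright c.
pose f t := (u (c t) - k)%R.
have [sgn|sgn] := leP 0%R (f (cleft c) * f (cright c))%R.
  apply: le_trans i; rewrite lee_fin -/(f _) -/(f (cright c)).
  have -> : (u (c (cleft c)) - u (c (cright c)) = f (cleft c) - f (cright c))%R.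
    by rewrite /f; ring.
  exact: ler_normB_same_sign.
have cf : {within `[cleft c, cright c], continuous f}.
  apply/subspace_continuousP => t tI.
  have /subspace_continuousP/(_ t tI) ct := @cmap_continuous _ _ c.
  have uk : (fun x => u x - k)%R @ nbhs (c t) --> (u (c t) - k)%R.
    by apply: cvgB; [exact: cu|exact: cvg_cst].
  exact: (cvg_comp _ _ ct uk).
have [|t tI ft0] := IVT lr cf (v := 0%R).
  by rewrite ge_min le_max; exact: opposite_signs.
move: tI; rewrite in_itv/= => tI.
have [c1 [c2 [rc1 rc2 _ _ [c1l c1r c2l c2r LI]]]] := curve_split rc tI.
have := rhoc; rewrite LI// => rhoc12.
have LI0 c' g' : rectifiable c' -> borel_fun g' -> (forall x, 0 <= g' x) ->
  0 <= line_integral c' g' by exact: line_integral_ge0.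
have [|_ i1] := ug c1 rc1.
  by apply: le_lt_trans rhoc12; rewrite leeDl// LI0.
have [|_ i2] := ug c2 rc2.
  by apply: le_lt_trans rhoc12; rewrite leeDr// LI0.
rewrite /ug_ineq LI//; apply: le_trans (leeD i1 i2).
rewrite c1l c1r c2l c2r -/(f _) -/(f t) -/(f (cright c)) ft0 normr0 subr0 sub0r.
rewrite normrN !normr_id -EFinD lee_fin.
by rewrite [X in (_ <= _ + X)%R]distrC ler_distD.
Qed.

End upper_gradients_along_closure.

(** * Weak upper gradients and minimal gradients *)

Section poweR_extra.
Context {R : realType}.
Implicit Types (x y : \bar R) (r : R).

Lemma lee_poweR x y r : (0 <= r)%R -> 0 <= x -> x <= y -> x `^ r <= y `^ r.
Proof.
move=> r0 x0 xy; apply: gt0_ler_poweR => //; rewrite in_itv/= leey andbT//.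
exact: le_trans xy.
Qed.

Lemma poweRK x r : (0 < r)%R -> 0 <= x -> (x `^ r^-1) `^ r = x.
Proof. by move=> r0 x0; rewrite -poweRrM mulVf ?gt_eqF// poweRe1. Qed.

Lemma poweRVK x r : (0 < r)%R -> 0 <= x -> (x `^ r) `^ r^-1 = x.
Proof. by move=> r0 x0; rewrite -poweRrM mulfV ?gt_eqF// poweRe1. Qed.

Lemma poweR_le_inj x y r : (0 < r)%R -> 0 <= x -> 0 <= y ->
  x `^ r <= y `^ r -> x <= y.
Proof.
move=> r0 x0 y0 xy; rewrite -(poweRVK r0 x0) -(poweRVK r0 y0).
by apply: lee_poweR => //; [rewrite invr_ge0 ltW|exact: poweR_ge0].
Qed.

End poweR_extra.

Section p_integrable.
Context d (T : measurableType d) (R : realType).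
Variables (m : {measure set T -> \bar R}) (p : R).
Hypothesis p0 : (0 < p)%R.
Implicit Types (f : T -> \bar R).

Lemma measurable_poweR_comp f (D : set T) : measurable_fun D f ->
  measurable_fun D (fun x => f x `^ p).
Proof. by move=> mf; exact: (measurableT_comp (measurable_poweR p)). Qed.

Lemma integral_poweRZ f (k : R) (D : set T) : measurable D -> (0 <= k)%R ->
  measurable_fun D f -> (forall x, 0 <= f x) ->
  \int[m]_(x in D) (k%:E * f x) `^ p = (k `^ p)%:E * \int[m]_(x in D) f x `^ p.
Proof.
move=> mD k0 mf f0; rewrite -ge0_integralZl_EFin//.
- by apply: eq_integral => x _; rewrite poweRM// poweR_EFin.
- by move=> x _; exact: poweR_ge0.
- exact: measurable_poweR_comp.
- exact: powR_ge0.
Qed.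

Lemma p_integrable_rescale f (e : R) : measurable_fun setT f ->
  (forall x, 0 <= f x) -> \int[m]_x f x `^ p < +oo -> (0 < e)%R ->
  exists2 k : R, (0 < k)%R & \int[m]_x (k%:E * f x) `^ p <= e%:E.
Proof.
move=> mf f0 foo e0.
have I0 : 0 <= \int[m]_x f x `^ p.
  by apply: integral_ge0 => x _; exact: poweR_ge0.
have If : \int[m]_x f x `^ p \is a fin_num by rewrite ge0_fin_numE.
set I := fine (\int[m]_x f x `^ p).
have i0 : (0 <= I)%R by rewrite fine_ge0.
(* The summand 1 keeps the quotient meaningful when the integral vanishes. *)
have eI : (0 < e / (1 + I))%R by rewrite divr_gt0// ltr_wpDr.
exists ((e / (1 + I)) `^ p^-1)%R; first by rewrite powR_gt0.
rewrite integral_poweRZ ?powR_ge0// -powRrM mulVf ?gt_eqF// powRr1; last exact: ltW.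
rewrite -(fineK If) -/I -EFinM lee_fin mulrAC ler_pdivrMr; last by rewrite ltr_wpDr.
by rewrite ler_pM2l// lerDr.
Qed.

(** The dominating function is the pointwise l^p norm of the sequence: its p-th power is a series
    that integrates term by term, so Minkowski's inequality is avoided. *)
Lemma p_integrable_dominate (f_ : (T -> \bar R)^nat) :
  (forall n, measurable_fun setT (f_ n)) -> (forall n x, 0 <= f_ n x) ->
  (forall n, \int[m]_x f_ n x `^ p <= (1 / (2 ^ n.+1)%:R)%:E) ->
  exists f, [/\ measurable_fun setT f, forall x, 0 <= f x,
    \int[m]_x f x `^ p < +oo & forall n x, f_ n x <= f x].
Proof.
move=> mf_ f_0 If_.
pose S x := \sum_(n <oo) f_ n x `^ p.
have t0 n x : 0 <= f_ n x `^ p by exact: poweR_ge0.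
have mt n : measurable_fun setT (fun x => f_ n x `^ p).
  exact: measurable_poweR_comp.
have S0 x : 0 <= S x by apply: nneseries_ge0.
have mS : measurable_fun setT S by exact: ge0_emeasurable_sum.
exists (fun x => S x `^ p^-1); split.
- exact: (measurableT_comp (measurable_poweR p^-1)).
- by move=> x; exact: poweR_ge0.
- under eq_integral do rewrite poweRK//.
  rewrite integral_nneseries//.
  apply: (@le_lt_trans _ _ (\sum_(n <oo) (1 / (2 ^ n.+1)%:R)%:E)).
    by apply: lee_nneseries => // n _ _; exact: integral_ge0.
  by apply: le_lt_trans (epsilon_trick0 _ _) _ => //; rewrite ltry.
- move=> n x; apply: (poweR_le_inj p0) => //; first exact: poweR_ge0.
  rewrite poweRK// /S (@nneseriesD1 _ _ n)//.
  by rewrite leeDl// nneseries_ge0.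
Qed.

End p_integrable.

(** * Integration on the Borel sigma-algebra and exceptional families of curves *)

Section borel_trace.
Context {R : realType} {X : pmetricType R}.
Local Notation XB := (g_sigma_algebraType (@open X)).
Implicit Types (mu : {outer_measure set X -> \bar R}).

(** Gradients are Borel functions, while [integral_of] works on the Caratheodory sigma-algebra.
    Pushing [mu] forward under the identity moves all integrals to the Borel sets. The first clause
    ranges over all sets, so a null set of [mu] is one of [m] without further argument. *)
Definition borel_trace mu (m : {measure set XB -> \bar R}) :=
  (forall B : set X, m B = mu B) /\
  (forall (A : set X) (g : X -> \bar R), borel A -> borel_fun g ->
    (forall x, 0 <= g x) -> integral_of mu A g = \int[m]_(x in A) g x).

Lemma borel_trace_ex mu : (forall B, borel B -> mu.-caratheodory B) ->
  exists m, borel_trace mu m.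
Proof.
move=> cmu; pose T := caratheodory_type mu.
have mid : measurable_fun setT (id : T -> XB).
  by move=> _ B bB; rewrite setTI; exact: cmu.
exists (pushforward (mu : set T -> \bar R) (id : T -> XB)).
split => // A g bA mg g0; rewrite ge0_integral_pushforward//.
exact: (@measurable_funTS _ _ XB).
Unshelve. exact: mid. Qed.

End borel_trace.

Section borel_trace_power.
Context {R : realType} {X : pmetricType R}.
Local Notation XB := (g_sigma_algebraType (@open X)).
Variables (mu : {outer_measure set X -> \bar R}) (m : {measure set XB -> \bar R}).
Hypothesis mu_m : borel_trace mu m.
Variable p : R.
Implicit Types (g : X -> \bar R).

Lemma integral_of_poweR (A : set X) g : borel A -> borel_fun g ->
  (forall x, 0 <= g x) ->
  integral_of mu A (fun x => g x `^ p) = \int[m]_(x in A) g x `^ p.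
Proof.
move=> bA mg g0; rewrite mu_m.2//; first exact: (@measurable_poweR_comp _ XB).
by move=> x; exact: poweR_ge0.
Qed.

Lemma integral_of_poweRT g : borel_fun g -> (forall x, 0 <= g x) ->
  integral_of mu setT (fun x => g x `^ p) = \int[m]_x g x `^ p.
Proof. by move=> *; rewrite integral_of_poweR//; exact: (@measurableT _ XB). Qed.

End borel_trace_power.

Section exceptional_curves.
Context {R : realType} {X : pmetricType R}.
Local Notation XB := (g_sigma_algebraType (@open X)).
Variables (mu : {outer_measure set X -> \bar R}) (m : {measure set XB -> \bar R}).
Hypothesis mu_m : borel_trace mu m.
Variable p : R.
Hypothesis p0 : (0 < p)%R.
Implicit Types (c : curve X) (g rho : X -> \bar R) (u : X -> R).

Definition Lp_weight rho :=
  [/\ borel_fun rho, forall x, 0 <= rho x & \int[m]_x rho x `^ p < +oo].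

Lemma line_integral_scale_lty c g (k : R) : rectifiable c -> (0 < k)%R ->
  borel_fun g -> (forall x, 0 <= g x) ->
  line_integral c (fun x => k%:E * g x) < +oo -> line_integral c g < +oo.
Proof.
move=> rc k0 mg g0; rewrite line_integralZ ?(ltW k0)//.
have := line_integral_ge0 rc mg g0.
by case: (line_integral c g) => [r||]// _; rewrite ?ltry// gt0_muley ?lte_fin.
Qed.

(** A positive factor does not change the curves along which a weight is integrable, so the energies
    can be made summable and one function dominates all rescaled weights. *)
Lemma Lp_weight_seq (rho_ : (X -> \bar R)^nat) :
  (forall n, Lp_weight (rho_ n)) ->
  exists2 rho, Lp_weight rho & forall n c, rectifiable c ->
    line_integral c rho < +oo -> line_integral c (rho_ n) < +oo.
Proof.
move=> H.
have e0 n : (0 < 1 / (2 ^ n.+1)%:R :> R)%R by rewrite divr_gt0// ltr0n expn_gt0.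
have /choice[k kP] : forall n, exists k : R, (0 < k)%R /\
    \int[m]_x (k%:E * rho_ n x) `^ p <= (1 / (2 ^ n.+1)%:R)%:E.
  move=> n; have [mr r0 roo] := H n.
  by have [k k0 kP] := p_integrable_rescale (m := m) p0 mr r0 roo (e0 n); exists k.
have kr0 n x : 0 <= (k n)%:E * rho_ n x.
  by have [k0 _] := kP n; have [_ r0 _] := H n; rewrite mule_ge0// lee_fin ltW.
have mkr n : borel_fun (fun x => (k n)%:E * rho_ n x).
  by have [mr _ _] := H n; exact: (@measurable_funeM _ XB).
have [|rho [mrho rho0 rhooo rhole]] := p_integrable_dominate (m := m) p0 mkr kr0.
  by move=> n; have [] := kP n.
exists rho => // n c rc rhoc; have [mr r0 _] := H n; have [k0 _] := kP n.
apply: (line_integral_scale_lty rc k0) => //.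
by apply: le_lt_trans rhoc; apply: le_line_integral.
Qed.

Lemma Lp_weight_pair rho1 rho2 : Lp_weight rho1 -> Lp_weight rho2 ->
  exists2 rho, Lp_weight rho & forall c, rectifiable c ->
    line_integral c rho < +oo ->
    line_integral c rho1 < +oo /\ line_integral c rho2 < +oo.
Proof.
move=> H1 H2; have [|rho Hrho rhoP] :=
  @Lp_weight_seq (fun n => if n is 0%N then rho1 else rho2); first by case.
by exists rho => // c rc rhoc; split; [exact: (rhoP 0%N)|exact: (rhoP 1%N)].
Qed.

(** On a curve violating the inequality [rho] has infinite integral, so every positive multiple of
    [rho] is admissible for the modulus, with energy as small as desired. *)
Lemma ug_along_weak rho u g : Lp_weight rho -> ug_along rho u g ->
  weak_upper_gradient mu p u g.
Proof.
move=> [mrho rho0 rhooo] [mg g0 ug]; split => //.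
apply/eqP; rewrite eq_le; apply/andP; split; last first.
  by apply: le_ereal_inf_tmp => _ [h _ <-]; apply: integral_ge0 => x _; exact: poweR_ge0.
apply/lee_addgt0Pr => e e0; rewrite add0e.
have [k k0 kP] := p_integrable_rescale p0 mrho rho0 rhooo e0.
have mk : borel_fun (fun x => k%:E * rho x) by exact: (@measurable_funeM _ XB).
have kr0 x : 0 <= k%:E * rho x by rewrite mule_ge0// lee_fin ltW.
apply: le_trans kP; apply: ereal_inf_lbound; exists (fun x => k%:E * rho x).
  split => // c [_ bad] rc; rewrite leNgt; apply/negP => lt1.
  apply: bad; have [|//] := ug c rc.
  apply: (line_integral_scale_lty rc k0) => //.
  by apply: lt_trans lt1 _; rewrite ltry.
rewrite mu_m.2//.
- exact: (@measurableT _ XB).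
- exact: (@measurable_poweR_comp _ XB).
- by move=> x; exact: poweR_ge0.
Qed.

(** The converse direction, in the spirit of Fuglede's lemma: admissible functions of tiny energy,
    enlarged by the factors [k n], are dominated by one weight, whose integral along a curve of the
    family exceeds every [k n]. *)
Lemma modulus0_weight (Gamma : set (curve X)) : modulus mu p Gamma = 0 ->
  exists2 rho, Lp_weight rho & forall c, rectifiable c -> Gamma c ->
    line_integral c rho = +oo.
Proof.
move=> mod0.
pose k n : R := (2 ^+ n)%R.
have k0 n : (0 < k n)%R by rewrite exprn_gt0.
(* The first factor compensates the p-th power of [k n], so that the enlarged functions still have
   summable energies. *)
pose e n : R := ((k n `^ p)^-1 * (1 / (2 ^ n.+1)%:R))%R.
have e0 n : (0 < e n)%R.
  by rewrite mulr_gt0 ?invr_gt0 ?powR_gt0// divr_gt0// ltr0n expn_gt0.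
have /choice[r rP] : forall n, exists r : X -> \bar R,
    [/\ borel_fun r, forall x, 0 <= r x,
      forall c, Gamma c -> rectifiable c -> 1 <= line_integral c r &
      \int[m]_x r x `^ p <= (e n)%:E].
  move=> n; have : modulus mu p Gamma < (e n)%:E by rewrite mod0 lte_fin.
  move=> /ereal_inf_lt[_ [r [mr r0 rP] <-] re]; exists r; split => //.
  rewrite -mu_m.2 ?ltW//.
  - exact: (@measurableT _ XB).
  - exact: (@measurable_poweR_comp _ XB).
  - by move=> x; exact: poweR_ge0.
have mkr n : borel_fun (fun x => (k n)%:E * r n x).
  by have [mr _ _ _] := rP n; exact: (@measurable_funeM _ XB).
have kr0 n x : 0 <= (k n)%:E * r n x.
  by have [_ r0 _ _] := rP n; rewrite mule_ge0// lee_fin ltW.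
have [|rho [mrho rho0 rhooo rhole]] := p_integrable_dominate (m := m) p0 mkr kr0.
  move=> n; have [mr r0 _ re] := rP n.
  rewrite integral_poweRZ// ?(ltW (k0 n))//.
  apply: (@le_trans _ _ ((k n `^ p)%:E * (e n)%:E)).
    by apply: lee_wpmul2l re; rewrite lee_fin powR_ge0.
  by rewrite -EFinM lee_fin /e mulVKf// gt_eqF// powR_gt0.
exists rho => // c rc Gc; apply/eqyP => A A0.
have [n An] : exists n, (A <= k n)%R.
  exists (Num.bound A); have := archi_boundP (ltW A0) => /ltW/le_trans; apply.
  by rewrite /k -natrX ler_nat ltnW// ltn_expl.
have [mr r0 r1 _] := rP n.
apply: (@le_trans _ _ (k n)%:E); first by rewrite lee_fin.
apply: le_trans (le_line_integral rc (mkr n) (kr0 n) mrho (rhole n)).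
rewrite line_integralZ// ?(ltW (k0 n))//.
by apply: lee_pemulr; [rewrite lee_fin ltW|exact: r1].
Qed.

End exceptional_curves.

Lemma ge0_integral_setU_le d (T : measurableType d) (R : realType)
    (m : {measure set T -> \bar R}) (A B : set T) (f : T -> \bar R) :
  measurable A -> measurable B -> measurable_fun setT f ->
  (forall x, 0 <= f x) ->
  \int[m]_(x in A `|` B) f x <= \int[m]_(x in A) f x + \int[m]_(x in B) f x.
Proof.
move=> mA mB mf f0; have mBA : measurable (B `\` A) by exact: measurableD.
have -> : A `|` B = A `|` (B `\` A).
  by apply/seteqP; split => x /=; have := pselect (A x); tauto.
rewrite ge0_integral_setU//.
- apply: leeD => //; apply: ge0_subset_integral => //.
  exact: measurable_funTS.
- exact: measurable_funTS.
- by rewrite disj_set2E setDE setICA setICr setI0.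
Qed.

(** * From local to countably many integrable pieces *)

Lemma separable_seq {R : realType} (X : pmetricType R) : separable_space X ->
  exists e : nat -> X, forall (x : X) (r : R), (0 < r)%R ->
    exists n, (mdist (e n) x < r)%R.
Proof.
move=> [D cD dD]; have [D0|[e]] := pfcard_geP cD.
  have [] := dD setT; [by exists point|exact: openT|].
  by move=> x; rewrite D0 => -[].
exists e => x r r0.
have [|z [bz Dz]] := dD (ball x r)° _ (open_interior _).
  exists x; exact: nbhsx_ballx.
have /(_ z Dz)[n _ en] : set_surj [set: nat] D e by exact: surj.
exists n; rewrite en metric_sym; move/interior_subset: bz.
by rewrite ballEmdist.
Qed.

Lemma compact_in_exhaustion (T : ptopologicalType) (K : set T)
    (V : nat -> set T) : compact K -> (forall n, open (V n)) ->
  (forall n k, (n <= k)%N -> V n `<=` V k) -> K `<=` \bigcup_n V n ->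
  exists n, K `<=` V n.
Proof.
rewrite compact_cover => cK oV ndV KV.
have [D _ Dcov] := cK nat setT V (fun n _ => oV n) KV.
exists (\max_(i <- finmap.enum_fset D) i)%N => x Kx.
have [n /= nD Vn] := Dcov x Kx.
by apply: ndV Vn; exact: leq_bigmax_seq.
Qed.

Section local_covers.
Context {R : realType} {X : pmetricType R}.

(** Balls of radius 1/(k+1) about a dense sequence form a countable base. Those on which [Q] fails
    are replaced by the empty set, and finite unions of the remaining ones keep [Q] and increase. *)
Lemma Lindelof_exhaustion (Q : set (set X)) : separable_space X ->
  (forall A B, open A -> open B -> Q A -> Q B -> Q (A `|` B)) -> Q set0 ->
  (forall A B, open A -> open B -> A `<=` B -> Q B -> Q A) ->
  (forall x, exists U, [/\ open U, U x & Q U]) ->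
  exists V : nat -> set X, [/\ forall n, open (V n), forall n, Q (V n),
    forall n k, (n <= k)%N -> V n `<=` V k & \bigcup_n V n = setT].
Proof.
move=> sX QU Q0 QS Qloc; have [e eP] := separable_seq sX.
pose r (k : nat) : R := k.+1%:R^-1%R.
have r0 k : (0 < r k)%R by rewrite invr_gt0 ltr0n.
pose B n k := [set x | (mdist (e n) x < r k)%R].
have oB n k : open (B n k).
  apply: (open_comp (f := mdist (e n)) _ (@open_lt _ (r k))) => x _.
  apply: (@lipschitz_continuous _ _ _ 1%R) => y z.
  by rewrite !(metric_sym (e n)); exact: mdistl_lip.
pose W n k := if pselect (Q (B n k)) is left _ then B n k else set0.
have oW n k : open (W n k) by rewrite /W; case: pselect => // _; exact: open0.
have QW n k : Q (W n k) by rewrite /W; case: pselect.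
pose V N := \bigcup_(n in `I_N) \bigcup_(k in `I_N) W n k.
have VE N : V N = \big[setU/set0]_(n < N) \big[setU/set0]_(k < N) W n k.
  by rewrite /V bigcup_mkord; apply: eq_bigr => i _; rewrite bigcup_mkord.
exists V; split.
- by move=> N; apply: bigcup_open => n _; apply: bigcup_open => k _.
- move=> N; rewrite VE; suff [] : open (\big[setU/set0]_(n < N)
    \big[setU/set0]_(k < N) W n k) /\ Q (\big[setU/set0]_(n < N)
    \big[setU/set0]_(k < N) W n k) by [].
  have P0 : open (set0 : set X) /\ Q set0 by split => //; exact: open0.
  have PU A A' : open A /\ Q A -> open A' /\ Q A' ->
      open (A `|` A') /\ Q (A `|` A').
    by move=> [oA QA] [oA' QA']; split; [exact: openU|exact: QU].
  apply: (big_ind (fun A => open A /\ Q A)) => // n _.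
  by apply: (big_ind (fun A => open A /\ Q A)).
- move=> N M NM x [n /= nN [k /= kN Wx]].
  by exists n => /=; [exact: leq_trans NM|exists k => //=; exact: leq_trans NM].
- apply/seteqP; split => // x _; have [U [oU Ux QUU]] := Qloc x.
  have /nbhs_ballP[d /= d0 dU] : nbhs x U by exact: open_nbhs_nbhs.
  have d20 : (0 < d / 2)%R by rewrite divr_gt0.
  have [k kd] : exists k, (r k < d / 2)%R.
    have [k _ kP] := near_infty_natSinv_lt (PosNum d20).
    by exists k; apply: kP => /=.
  have [n en] := eP x (r k) (r0 k).
  exists (maxn n k).+1 => //; exists n => /=; first by rewrite ltnS leq_maxl.
  exists k => /=; first by rewrite ltnS leq_maxr.
  rewrite /W; case: pselect => // -[]; apply: (QS _ U) => // y By.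
  apply: dU; rewrite ballEmdist/=.
  apply: le_lt_trans (metric_triangle _ (e n) _) _.
  by rewrite metric_sym (splitr d) ltrD// (lt_trans _ kd).
Qed.

(** The image of a curve is compact. Hence a function integrable on each [V n] can be treated along
    a given curve as globally integrable. *)
Lemma curve_in_exhaustion (c : curve X) (V : nat -> set X) :
  (forall n, open (V n)) -> (forall n k, (n <= k)%N -> V n `<=` V k) ->
  \bigcup_n V n = setT ->
  exists n, forall t, (cleft c <= t <= cright c)%R -> V n (c t).
Proof.
move=> oV ndV VT.
have cK := continuous_compact (@cmap_continuous _ _ c) (@segment_compact _ _ _).
have [|n nP] := compact_in_exhaustion cK oV ndV; first by rewrite VT.
by exists n => t tI; apply: nP; exists t; rewrite //= in_itv.
Qed.

End local_covers.

Section weak_gradients.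
Context {R : realType} {X : pmetricType R}.
Local Notation XB := (g_sigma_algebraType (@open X)).
Variables (mu : {outer_measure set X -> \bar R}) (m : {measure set XB -> \bar R}).
Hypothesis mu_m : borel_trace mu m.
Hypothesis sX : separable_space X.
Variable p : R.
Hypothesis p0 : (0 < p)%R.
Implicit Types (c : curve X) (g h rho : X -> \bar R) (u : X -> R).

Lemma Lp_loc_exhaustion g : borel_fun g -> (forall x, 0 <= g x) ->
  Lp_loc_fun mu p g ->
  exists V : nat -> set X, [/\ forall n, open (V n),
    forall n, \int[m]_(x in V n) g x `^ p < +oo,
    forall n k, (n <= k)%N -> V n `<=` V k & \bigcup_n V n = setT].
Proof.
move=> mg g0 gloc.
have mgp : measurable_fun [set: XB] (fun x => g x `^ p).
  exact: (@measurable_poweR_comp _ XB).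
apply: (@Lindelof_exhaustion _ _ (fun V => \int[m]_(x in V) g x `^ p < +oo)) => //.
- move=> A B oA oB Aoo Boo.
  apply: le_lt_trans (lte_add_pinfty Aoo Boo).
  apply: (@ge0_integral_setU_le _ XB) => //; [exact: open_borel|exact: open_borel|].
  by move=> x; exact: poweR_ge0.
- by rewrite integral_set0.
- move=> A B oA oB AB; apply: le_lt_trans.
  apply: (@ge0_subset_integral _ XB) => //; [exact: open_borel|exact: open_borel| |].
    exact: measurable_funTS.
  by move=> x _; exact: poweR_ge0.
- move=> x; have [U [oU Ux Uoo]] := gloc x; exists U; split => //.
  by rewrite -(integral_of_poweR mu_m)//; exact: open_borel.
Qed.

(** One weight rules out the exceptional curves; the others are the restrictions of [g] to the sets
    of an exhaustion. Every curve lies in one of these sets, so integrability of the common weight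
    also makes the line integral of [g] finite. *)
Lemma weak_ug_along u g : weak_upper_gradient mu p u g -> Lp_loc_fun mu p g ->
  exists2 rho, Lp_weight m p rho & ug_along rho u g.
Proof.
move=> [mg g0 mod0] gloc.
have [rho1 H1 bad] := modulus0_weight mu_m p0 mod0.
have [V [oV Voo ndV VT]] := Lp_loc_exhaustion mg g0 gloc.
have m0 : borel_fun (cst 0 : X -> \bar R) by exact: (@measurable_cst _ _ XB).
have bV n : borel (V n) by exact: open_borel.
pose rho_ n := if n is k.+1 then patch (cst 0) (V k) g else rho1.
have Hrho n : Lp_weight m p (rho_ n).
  case: n => [//|n]; split => /= [|x|]; first exact: borel_fun_patch.
    by rewrite /patch; case: ifP.
  rewrite (_ : \int[m]_x _ = \int[m]_(x in V n) g x `^ p)//.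
  rewrite [RHS]integral_mkcond; apply: eq_integral => x _.
  by rewrite /patch; case: ifP => // _; rewrite poweR0r// gt_eqF.
have [rho [mrho rho0 rhooo] rhoP] := Lp_weight_seq p0 Hrho.
exists rho => //; split => // c rc rhoc; split; last first.
  apply: contrapT => nug; have /= := rhoP 0%N c rc rhoc.
  by rewrite bad// ltxx.
have [n nP] := curve_in_exhaustion c oV ndV VT.
rewrite (@eq_line_integral _ _ c g (rho_ n.+1)); [exact: rhoP|exact: rc|].
by move=> t tI; rewrite /= /patch mem_set//; exact: nP.
Qed.

(** [dirichlet] demands a genuine upper gradient. The maximum with a weight that has infinite
    integral along the exceptional curves repairs [g] there and remains p-integrable. *)
Lemma weak_ug_upper_gradient u g : weak_upper_gradient mu p u g ->
  integral_of mu setT (fun x => g x `^ p) < +oo ->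
  exists2 h, upper_gradient u h & Lp_fun mu p h.
Proof.
move=> [mg g0 mod0]; rewrite (integral_of_poweR mu_m)//; last exact: (@measurableT _ XB).
move=> goo; have [rho [mrho rho0 rhooo] bad] := modulus0_weight mu_m p0 mod0.
pose h x := maxe (g x) (rho x).
have mh : borel_fun h by exact: (@measurable_maxe _ XB).
have h0 x : 0 <= h x by rewrite le_max g0.
exists h.
  split => // c rc; have [//|nug] := pselect (ug_ineq u g c).
    move=> i; apply: le_trans i _; apply: le_line_integral => // x.
    by rewrite le_max lexx.
  rewrite /ug_ineq (_ : line_integral c h = +oo) ?leey//.
  apply/eqP; rewrite -leye_eq -(bad c rc)//.
  by apply: le_line_integral => // x; rewrite le_max lexx orbT.
rewrite /Lp_fun (integral_of_poweR mu_m)//; last exact: (@measurableT _ XB).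
apply: le_lt_trans (lte_add_pinfty goo rhooo).
rewrite -ge0_integralD//; last 4 first.
- by move=> x _; exact: poweR_ge0.
- exact: (@measurable_poweR_comp _ XB).
- by move=> x _; exact: poweR_ge0.
- exact: (@measurable_poweR_comp _ XB).
apply: ge0_le_integral => //.
- by move=> x _; exact: poweR_ge0.
- exact: (@measurable_poweR_comp _ XB).
- by apply: (@emeasurable_funD _ XB); exact: (@measurable_poweR_comp _ XB).
- move=> x _; rewrite /h /maxe; case: ifP => _.
    by rewrite leeDr// poweR_ge0.
  by rewrite leeDl// poweR_ge0.
Qed.

End weak_gradients.

(** * Existence of minimal gradients *)

Lemma ge0_integral_le_null d (T : measurableType d) (R : realType)
    (m : {measure set T -> \bar R}) (V : set T) (f g : T -> \bar R) :
  measurable V -> measurable_fun setT f -> measurable_fun setT g ->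
  (forall x, 0 <= f x) -> (forall x, f x <= g x) ->
  \int[m]_(x in V) f x < +oo -> \int[m]_(x in V) g x <= \int[m]_(x in V) f x ->
  m (V `&` [set x | f x < g x]) = 0.
Proof.
move=> mV mf mg f0 fg foo gf.
have g0 x : 0 <= g x by exact: le_trans (fg x).
pose e n : R := n.+1%:R^-1%R.
have e0 n : (0 < e n)%R by rewrite invr_gt0.
pose A n := V `&` [set x | f x + (e n)%:E <= g x].
have mA n : measurable (A n).
  apply: measurable_lee; [exact: mV| |exact: measurable_funTS].
  by apply: emeasurable_funD; [exact: measurable_funTS|exact: measurable_cst].
have A0 n : m (A n) = 0.
  have : \int[m]_(x in V) f x + (e n)%:E * m (A n) <= \int[m]_(x in V) f x + 0.
    rewrite adde0; apply: le_trans gf.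
    have -> : (e n)%:E * m (A n) = \int[m]_(x in V) ((e n)%:E * (\1_(A n) x)%:E).
      rewrite ge0_integralZl_EFin//; last 2 first.
      - exact/measurable_EFinP/measurable_funTS.
      - exact: ltW.
      by rewrite integral_indic// (_ : A n `&` V = A n)// /A setIAC setIid.
    have m1 : measurable_fun V (fun x => (e n)%:E * (\1_(A n) x)%:E).
      by apply: measurable_funeM; exact/measurable_EFinP/measurable_funTS.
    have mfV : measurable_fun V f by exact: measurable_funTS.
    have i0 x : 0 <= (e n)%:E * (\1_(A n) x)%:E by rewrite mule_ge0// lee_fin ltW.
    rewrite -ge0_integralD//.
    apply: ge0_le_integral => //.
    - by move=> x _; rewrite adde_ge0.
    - exact: emeasurable_funD.
    - exact: measurable_funTS.
    - move=> x Vx; rewrite indicE; have [/set_mem[_ Ax]|_] := boolP (x \in A n).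
        by rewrite mule1.
      by rewrite mule0 adde0.
  rewrite leeD2lE; last by rewrite ge0_fin_numE// integral_ge0.
  move=> le0; apply/eqP; rewrite eq_le measure_ge0 andbT.
  by rewrite -(@lee_pmul2l _ (e n)%:E)// ?mule0// lte_fin.
have sub : V `&` [set x | f x < g x] `<=` \bigcup_n A n.
  move=> x [Vx /= fgx]; suff [n fn] : exists n, f x + (e n)%:E <= g x.
    by exists n.
  move: fgx (f0 x); case: (f x) => [r| |]//; case: (g x) => [s| |]//=; last first.
    by move=> _ _; exists 0%N; rewrite leey.
  rewrite lte_fin -subr_gt0 => rs _.
  have [n _ nP] := near_infty_natSinv_lt (PosNum rs).
  exists n; rewrite -EFinD lee_fin -lerBrDl ltW//; exact: (nP n (leqnn n)).
have mN : measurable (V `&` [set x | f x < g x]).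
  by apply: measurable_lte => //; exact: measurable_funTS.
apply/eqP; rewrite eq_le measure_ge0 andbT.
have := @measure_sigma_subadditive _ _ _ m _ _ mA mN sub.
move=> /le_trans; apply.
by rewrite eseries0// => n _ _; exact: A0.
Qed.

Section minimal_gradients.
Context {R : realType} {X : pmetricType R}.
Local Notation XB := (g_sigma_algebraType (@open X)).
Variables (mu : {outer_measure set X -> \bar R}) (m : {measure set XB -> \bar R}).
Hypothesis mu_m : borel_trace mu m.
Hypothesis sX : separable_space X.
Variable p : R.
Hypothesis p0 : (0 < p)%R.
Implicit Types (g h rho : X -> \bar R) (u v : X -> R).

(** For locally p-integrable [g] this is equivalent to [weak_upper_gradient]. In this form, merging
    the weights of two or countably many gradients carries over all closure properties of
    [ug_along]. *)
Definition p_gradient u g := exists2 rho, Lp_weight m p rho & ug_along rho u g.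

Lemma p_gradient_borel u g : p_gradient u g -> borel_fun g.
Proof. by move=> [rho _ []]. Qed.

Lemma p_gradient_ge0 u g : p_gradient u g -> forall x, 0 <= g x.
Proof. by move=> [rho _ []]. Qed.

Lemma p_gradient_weak u g : p_gradient u g -> weak_upper_gradient mu p u g.
Proof. by move=> [rho]; exact: ug_along_weak. Qed.

Lemma weak_p_gradient u g : weak_upper_gradient mu p u g ->
  Lp_loc_fun mu p g -> p_gradient u g.
Proof. by move=> wg gloc; exact: (weak_ug_along mu_m). Qed.

Lemma p_gradient_pair u v g h : p_gradient u g -> p_gradient v h ->
  exists rho, [/\ Lp_weight m p rho, ug_along rho u g & ug_along rho v h].
Proof.
move=> [r1 H1 u1] [r2 H2 u2]; have [rho H rhoP] := Lp_weight_pair p0 H1 H2.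
exists rho; split => //.
  by apply: ug_alongW u1 => c rc rhoc; have [] := rhoP c rc rhoc.
by apply: ug_alongW u2 => c rc rhoc; have [] := rhoP c rc rhoc.
Qed.

Lemma p_gradient_open u v g h (O : set X) : open O ->
  (forall x, O x -> u x = v x) -> p_gradient u g -> p_gradient v h ->
  p_gradient u (patch g O h).
Proof.
move=> oO uv pu pv; have [rho [H ug vh]] := p_gradient_pair pu pv.
by have [mrho rho0 _] := H; exists rho => //; exact: ug_along_open vh.
Qed.

Lemma p_gradient_mine u g h : p_gradient u g -> p_gradient u h ->
  p_gradient u (fun x => mine (g x) (h x)).
Proof.
move=> pu pv; have [rho [H ug vh]] := p_gradient_pair pu pv.
by have [mrho rho0 _] := H; exists rho => //; exact: ug_along_mine.
Qed.

Lemma p_gradient_einfs u (g_ : (X -> \bar R)^nat) :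
  (forall n, p_gradient u (g_ n)) ->
  p_gradient u (fun x => ereal_inf (range (g_ ^~ x))).
Proof.
move=> pu; have /choice[rho_ rho_P] : forall n, exists rho,
    Lp_weight m p rho /\ ug_along rho u (g_ n).
  by move=> n; have [rho] := pu n; exists rho.
have [|rho H rhoP] := @Lp_weight_seq _ _ m _ p0 rho_.
  by move=> n; have [] := rho_P n.
have [mrho rho0 _] := H; exists rho => //; apply: ug_along_einfs => // n.
by apply: ug_alongW (rho_P n).2 => c rc rhoc; exact: rhoP.
Qed.

Lemma Lp_loc_le_max g1 g2 h :
  borel_fun g1 -> (forall x, 0 <= g1 x) -> borel_fun g2 ->
  (forall x, 0 <= g2 x) -> borel_fun h -> (forall x, 0 <= h x) ->
  (forall x, h x <= maxe (g1 x) (g2 x)) ->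
  Lp_loc_fun mu p g1 -> Lp_loc_fun mu p g2 -> Lp_loc_fun mu p h.
Proof.
move=> mg1 g10 mg2 g20 mh h0 hg l1 l2 x.
have [U1 [oU1 U1x U1oo]] := l1 x; have [U2 [oU2 U2x U2oo]] := l2 x.
exists (U1 `&` U2); split => //; first exact: openI.
have bU1 := open_borel oU1; have bU2 := open_borel oU2.
have bU := open_borel (openI oU1 oU2).
move: U1oo U2oo; rewrite !(integral_of_poweR mu_m)// => U1oo U2oo.
have mp (g : X -> \bar R) : borel_fun g -> forall A : set XB,
    measurable_fun A (fun x => g x `^ p).
  by move=> mg A; apply: measurable_funTS; exact: (@measurable_poweR_comp _ XB).
apply: le_lt_trans (lte_add_pinfty U1oo U2oo).
apply: (@le_trans _ _ (\int[m]_(x in U1 `&` U2) (g1 x `^ p + g2 x `^ p))).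
  apply: ge0_le_integral => //.
  - by move=> y _; exact: poweR_ge0.
  - exact: mp.
  - by apply: emeasurable_funD; exact: mp.
  - move=> y _; apply: le_trans (lee_poweR (ltW p0) (h0 y) (hg y)) _.
    rewrite /maxe; case: ifP => _.
      by rewrite leeDr// poweR_ge0.
    by rewrite leeDl// poweR_ge0.
rewrite ge0_integralD//; try by move=> *; exact: poweR_ge0.
- apply: leeD; apply: ge0_subset_integral => //; try exact: mp;
    by move=> *; exact: poweR_ge0.
- exact: mp.
- exact: mp.
Qed.

Lemma Lp_loc_le g h : borel_fun g -> (forall x, 0 <= g x) ->
  borel_fun h -> (forall x, 0 <= h x) -> (forall x, h x <= g x) ->
  Lp_loc_fun mu p g -> Lp_loc_fun mu p h.
Proof.
move=> mg g0 mh h0 hg l; apply: (@Lp_loc_le_max g g) => // x.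
by rewrite maxxx.
Qed.

(** Gradients are closed under countable infima, so the infimum of a minimizing sequence attains the
    least energy on [V n]. This lattice argument needs no weak compactness and thus covers the
    exponent 1 as well. A further infimum over [n] minimizes on all [V n] at once. *)
Lemma is_min_grad_ex u g0 : p_gradient u g0 -> Lp_loc_fun mu p g0 ->
  exists g, is_min_grad mu p u g.
Proof.
move=> pg0 lg0.
have mg0 := p_gradient_borel pg0; have g00 := p_gradient_ge0 pg0.
have [V [oV Voo ndV VT]] := Lp_loc_exhaustion mu_m sX mg0 g00 lg0.
have bV n : borel (V n) by exact: open_borel.
pose F n (g : X -> \bar R) := \int[m]_(x in V n) g x `^ p.
have mp (g : X -> \bar R) : borel_fun g -> forall A : set XB,
    measurable_fun A (fun x => g x `^ p).
  by move=> mg A; apply: measurable_funTS; exact: (@measurable_poweR_comp _ XB).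
have F_le n g h : p_gradient u g -> p_gradient u h ->
    (forall x, g x <= h x) -> F n g <= F n h.
  move=> pg ph gh; apply: ge0_le_integral => //.
  - exact: bV.
  - by move=> x _; exact: poweR_ge0.
  - by apply: mp; exact: p_gradient_borel pg.
  - by apply: mp; exact: p_gradient_borel ph.
  - by move=> x _; apply: lee_poweR (ltW p0) (p_gradient_ge0 pg x) (gh x).
have F0 n g : 0 <= F n g by apply: integral_ge0 => x _; exact: poweR_ge0.
pose I n := ereal_inf [set F n g | g in p_gradient u].
have Ifin n : I n \is a fin_num.
  rewrite ge0_fin_numE; last by apply: le_ereal_inf_tmp => _ [g _ <-].
  by apply: le_lt_trans (Voo n); apply: ereal_inf_lbound; exists g0.
have e0 k : (0 < k.+1%:R^-1 :> R)%R by rewrite invr_gt0.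
have /choice[G GP] : forall n, exists G : X -> \bar R,
    p_gradient u G /\ F n G <= I n.
  move=> n.
  have /choice[h hP] : forall k, exists h : X -> \bar R,
      p_gradient u h /\ F n h <= I n + (k.+1%:R^-1)%:E.
    move=> k; have [_ [h ph <-] hI] := lb_ereal_inf_adherent (e0 k) (Ifin n).
    by exists h; split => //; exact: ltW.
  have ph : p_gradient u (fun x => ereal_inf (range (h ^~ x))).
    by apply: p_gradient_einfs => k; have [] := hP k.
  exists (fun x => ereal_inf (range (h ^~ x))); split => //.
  apply/lee_addgt0Pr => e; move=> e_gt0.
  have [k _ kP] := near_infty_natSinv_lt (PosNum e_gt0).
  apply: (@le_trans _ _ (I n + (k.+1%:R^-1)%:E)).
    apply: le_trans (hP k).2; apply: F_le => //; first exact: (hP k).1.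
    by move=> x; apply: ereal_inf_lbound; exists k.
  by apply: leeD2l; rewrite lee_fin ltW//; exact: kP (leqnn k).
(* Including [g0] makes the infimum locally p-integrable. *)
pose G' n := if n is k.+1 then G k else g0.
pose g x := ereal_inf (range (G' ^~ x)).
have gG n x : g x <= G' n x by apply: ereal_inf_lbound; exists n.
have pg : p_gradient u g.
  by apply: p_gradient_einfs => -[//|k]; have [] := GP k.
have mg := p_gradient_borel pg; have gge0 := p_gradient_ge0 pg.
have lg : Lp_loc_fun mu p g.
  by apply: (Lp_loc_le mg0 g00) => //; exact: (gG 0%N).
exists g; split => //; first exact: p_gradient_weak.
move=> h wh lh; have ph := weak_p_gradient wh lh.
have mh := p_gradient_borel ph; have h0 := p_gradient_ge0 ph.
(* The minimum of [g] and [h] competes with [g], which has the least energy on each [V n]. As this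
   energy is finite, the two agree there almost everywhere. *)
have pgh := p_gradient_mine pg ph.
pose N := [set x | mine (g x) (h x) `^ p < g x `^ p].
have NE : [set x | ~ g x <= h x] `<=` \bigcup_n (V n `&` N).
  move=> x /= ngh; have [n _ Vx] : (\bigcup_n V n) x by rewrite VT.
  exists n => //; split => //; rewrite /N/= ltNge; apply/negP => le.
  have := poweR_le_inj p0 (gge0 x) _ le; rewrite le_min gge0 h0 => /(_ isT).
  by rewrite le_min lexx/=; exact/negP/negP.
have N0 n : m (V n `&` N) = 0.
  apply: (@ge0_integral_le_null _ XB) => //.
  - exact: bV.
  - by apply: mp; exact: p_gradient_borel pgh.
  - exact: mp.
  - by move=> x; exact: poweR_ge0.
  - move=> x; apply: lee_poweR (ltW p0) (p_gradient_ge0 pgh x) _.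
    by rewrite ge_min lexx.
  - apply: le_lt_trans (Voo n); apply: F_le => // x.
    by rewrite ge_min (gG 0%N).
  - apply: (@le_trans _ _ (I n)).
      apply: le_trans (GP n).2; apply: F_le => //; first exact: (GP n).1.
      exact: (gG n.+1).
    by apply: ereal_inf_lbound; exists (fun x => mine (g x) (h x)).
apply/eqP; rewrite eq_le outer_measure_ge0 andbT.
apply: le_trans (le_outer_measure mu _ _ NE) _.
apply: le_trans (outer_measure_sigma_subadditive mu _) _.
by rewrite eseries0// => n _ _; rewrite -mu_m.1; exact: N0.
Qed.

Lemma min_gradP u g0 : p_gradient u g0 -> Lp_loc_fun mu p g0 ->
  is_min_grad mu p u (min_grad mu p u).
Proof. by move=> pg lg; apply: xgetPex; exact: is_min_grad_ex pg lg. Qed.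

End minimal_gradients.

(** * Comparison of minimal gradients *)

Section gradient_comparison.
Context {R : realType} {X : pmetricType R}.
Local Notation XB := (g_sigma_algebraType (@open X)).
Variables (mu : {outer_measure set X -> \bar R}) (m : {measure set XB -> \bar R}).
Hypothesis mu_m : borel_trace mu m.
Hypothesis sX : separable_space X.
Variable p : R.
Hypothesis p0 : (0 < p)%R.
Implicit Types (c : curve X) (g h rho : X -> \bar R) (u v : X -> R).

Definition locally_dirichlet u :=
  exists2 g, p_gradient m p u g & Lp_loc_fun mu p g.

Lemma min_grad_gradient u : locally_dirichlet u ->
  p_gradient m p u (min_grad mu p u).
Proof.
move=> [g pg lg]; have [wg lG _] := min_gradP mu_m sX p0 pg lg.
exact: (weak_p_gradient mu_m).
Qed.

Lemma min_grad_Lp_loc u : locally_dirichlet u ->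
  Lp_loc_fun mu p (min_grad mu p u).
Proof. by move=> [g pg lg]; have [_ + _] := min_gradP mu_m sX p0 pg lg. Qed.

Lemma min_grad_borel u : locally_dirichlet u -> borel_fun (min_grad mu p u).
Proof. by move/min_grad_gradient/p_gradient_borel. Qed.

Lemma min_grad_ge0 u : locally_dirichlet u -> forall x, 0 <= min_grad mu p u x.
Proof. by move/min_grad_gradient/p_gradient_ge0. Qed.

Lemma min_grad_le u h : p_gradient m p u h -> Lp_loc_fun mu p h ->
  mu [set x | ~ min_grad mu p u x <= h x] = 0.
Proof.
move=> ph lh; have [_ _] := min_gradP mu_m sX p0 ph lh; apply => //.
exact: (p_gradient_weak mu_m).
Qed.

(** The gradient of [u], exchanged for that of [v] on [O], is still a gradient of [u] and hence
    dominates the minimal one. *)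
Lemma min_grad_open u v (O : set X) : open O -> (forall x, O x -> u x = v x) ->
  locally_dirichlet u -> locally_dirichlet v ->
  mu (O `&` [set x | ~ min_grad mu p u x <= min_grad mu p v x]) = 0.
Proof.
move=> oO uv lu lv; set h := patch (min_grad mu p u) O (min_grad mu p v).
have ph : p_gradient m p u h.
  by apply: p_gradient_open uv _ _ => //; exact: min_grad_gradient.
have lh : Lp_loc_fun mu p h.
  apply: (Lp_loc_le_max mu_m p0 _ _ _ _ _ _ _
    (min_grad_Lp_loc lu) (min_grad_Lp_loc lv)).
  - exact: min_grad_borel.
  - exact: min_grad_ge0.
  - exact: min_grad_borel.
  - exact: min_grad_ge0.
  - exact: p_gradient_borel ph.
  - exact: p_gradient_ge0 ph.
  - by move=> x; rewrite /h /patch le_max; case: ifP; rewrite lexx ?orbT.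
apply/eqP; rewrite eq_le outer_measure_ge0 andbT -(min_grad_le ph lh).
apply: le_outer_measure => x [Ox /= ngh]; rewrite /h /patch mem_set//.
Qed.

Lemma min_grad_openE u v (O : set X) : open O -> (forall x, O x -> u x = v x) ->
  locally_dirichlet u -> locally_dirichlet v ->
  mu (O `&` [set x | min_grad mu p u x <> min_grad mu p v x]) = 0.
Proof.
move=> oO uv lu lv.
have A0 := min_grad_open oO uv lu lv.
have B0 := min_grad_open oO (fun x Ox => esym (uv x Ox)) lv lu.
apply/eqP; rewrite eq_le outer_measure_ge0 andbT.
rewrite -[leRHS]adde0 -{1}A0 -B0.
apply: le_trans (outer_measureU2 mu _ _); apply: le_outer_measure.
move=> x [Ox /= ne]; have [le|nle] := pselect (min_grad mu p u x <= min_grad mu p v x).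
  by right; split => //= ge; apply: ne; apply/eqP; rewrite eq_le le ge.
by left.
Qed.

Lemma Lp_locZ g (k : R) : (0 <= k)%R -> borel_fun g -> (forall x, 0 <= g x) ->
  Lp_loc_fun mu p g -> Lp_loc_fun mu p (fun x => k%:E * g x).
Proof.
move=> k0 mg g0 lg x; have [U [oU Ux Uoo]] := lg x; exists U; split => //.
have bU := open_borel oU.
have mkg : borel_fun (fun y => k%:E * g y) by exact: (@measurable_funeM _ XB).
have kg0 y : 0 <= k%:E * g y by rewrite mule_ge0.
move: Uoo; rewrite !(integral_of_poweR mu_m)//.
rewrite (@integral_poweRZ _ XB)//; last exact: measurable_funTS.
by move=> Uoo; rewrite lte_mul_pinfty// lee_fin powR_ge0.
Qed.

Lemma locally_dirichletZ u v (k : R) : (0 <= k)%R ->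
  (forall x y, `|v x - v y| <= k * `|u x - u y|)%R ->
  locally_dirichlet u -> locally_dirichlet v.
Proof.
move=> k0 vu [g pg lg]; exists (fun x => k%:E * g x).
  by have [rho H ug] := pg; exists rho => //; exact: ug_alongZ ug.
by apply: Lp_locZ => //; [exact: p_gradient_borel pg|exact: p_gradient_ge0 pg].
Qed.

Lemma min_gradZ u v (k : R) : (0 <= k)%R ->
  (forall x y, `|v x - v y| <= k * `|u x - u y|)%R ->
  locally_dirichlet u ->
  mu [set x | ~ min_grad mu p v x <= k%:E * min_grad mu p u x] = 0.
Proof.
move=> k0 vu lu; apply: min_grad_le.
  have [rho H ug] := min_grad_gradient lu; exists rho => //.
  exact: ug_alongZ ug.
apply: Lp_locZ => //; [exact: min_grad_borel|exact: min_grad_ge0|].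
exact: min_grad_Lp_loc.
Qed.

Lemma min_grad_fold u (k : R) : continuous u -> locally_dirichlet u ->
  mu [set x | ~ min_grad mu p u x <= min_grad mu p (fun x => `|u x - k|)%R x]
  = 0.
Proof.
move=> cu lu; have lv : locally_dirichlet (fun x => `|u x - k|)%R.
  apply: (@locally_dirichletZ u _ 1%R) => // x y; rewrite mul1r.
  have -> : (u x - u y = (u x - k) - (u y - k))%R by ring.
  exact: ler_dist_dist.
have [rho [mrho rho0 rhooo] ug] := min_grad_gradient lv.
apply: min_grad_le; last exact: min_grad_Lp_loc.
by exists rho => //; exact: ug_along_fold ug.
Qed.

Lemma dirichlet_gradient u : dirichlet mu p u ->
  exists2 g, p_gradient m p u g & \int[m]_x g x `^ p < +oo.
Proof.
move=> [_ [g [mg g0 ug] goo]].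
have goo' : \int[m]_x g x `^ p < +oo.
  by rewrite -(integral_of_poweRT mu_m).
(* An upper gradient in L^p serves as its own weight. *)
by exists g => //; exists g => //; split => // c rc gc; split => //; exact: ug.
Qed.

Lemma integrable_Lp_loc g : borel_fun g -> (forall x, 0 <= g x) ->
  \int[m]_x g x `^ p < +oo -> Lp_loc_fun mu p g.
Proof.
move=> mg g0 goo x; exists setT; split => //; first exact: openT.
by rewrite (integral_of_poweRT mu_m).
Qed.

Lemma dirichlet_locally u : dirichlet mu p u -> locally_dirichlet u.
Proof.
move=> /dirichlet_gradient[g pg goo]; exists g => //.
by apply: integrable_Lp_loc goo; [exact: p_gradient_borel pg|
  exact: p_gradient_ge0 pg].
Qed.

Lemma continuous_measurable_for u : (forall B, borel B -> mu.-caratheodory B) ->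
  continuous u -> measurable_for mu u.
Proof.
move=> cmu cu; rewrite /measurable_for.
apply: (@measurability _ _ _ _ _ _ _ (RGenOpens.measurableE R)).
move=> _ [_ [x [y ->]] <-]; rewrite setTI; apply: cmu; apply: open_borel.
by apply: open_comp; [move=> z _; exact: cu|apply: interval_open].
Qed.

Lemma gradient_dirichlet u g : (forall B, borel B -> mu.-caratheodory B) ->
  continuous u -> p_gradient m p u g -> \int[m]_x g x `^ p < +oo ->
  dirichlet mu p u.
Proof.
move=> cmu cu pg goo; split; first exact: continuous_measurable_for.
apply: (weak_ug_upper_gradient mu_m p0 (p_gradient_weak mu_m p0 pg)).
rewrite (integral_of_poweRT mu_m)//; first exact: p_gradient_borel pg.
exact: p_gradient_ge0 pg.
Qed.

End gradient_comparison.

(** * Lipschitz functions *)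

Lemma ler_norm_min (R : realFieldType) (a b c d : R) :
  (`|Num.min a b - Num.min c d| <= Num.max `|a - c| `|b - d|)%R.
Proof.
rewrite le_max !ler_norml; have [ab|ab] := leP a b; have [cd|cd] := leP c d.
- by have := ler_norml (a - c)%R (`|a - c|)%R; rewrite lexx => <-.
- have := ler_norm (a - c)%R; have := ler_norm (c - a)%R; rewrite distrC.
  have := ler_norm (b - d)%R; have := ler_norm (d - b)%R; rewrite (distrC d).
  move: `|a - c|%R `|b - d|%R => x y; case: (leP d a) => da; move=> *.
    by apply/orP; right; apply/andP; split; lra.
  by apply/orP; left; apply/andP; split; lra.
- have := ler_norm (a - c)%R; have := ler_norm (c - a)%R; rewrite distrC.
  have := ler_norm (b - d)%R; have := ler_norm (d - b)%R; rewrite (distrC d).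
  move: `|a - c|%R `|b - d|%R => x y; case: (leP b c) => da; move=> *.
    by apply/orP; right; apply/andP; split; lra.
  by apply/orP; left; apply/andP; split; lra.
- have := ler_norml (b - d)%R (`|b - d|)%R; rewrite lexx => <-.
  by rewrite orbT.
Qed.

Section lipschitz_functions.
Context {R : realType} {Y : pmetricType R}.
Local Notation YB := (g_sigma_algebraType (@open Y)).
Variables (nu : {outer_measure set Y -> \bar R}) (n : {measure set YB -> \bar R}).
Hypothesis nu_n : borel_trace nu n.
Hypothesis cnu : forall B, borel B -> nu.-caratheodory B.
Hypothesis fnu : forall A, mbounded A -> nu A < +oo.
Variable p : R.
Hypothesis p0 : (0 < p)%R.
Implicit Types (u v : Y -> R) (G : set Y).

Lemma open_mball (a : Y) (r : R) : open [set y | (mdist a y < r)%R].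
Proof.
apply: (open_comp (f := mdist a) _ (@open_lt _ r)) => x _.
apply: (@lipschitz_continuous _ _ _ 1%R) => y z.
by rewrite !(metric_sym a); exact: mdistl_lip.
Qed.

Lemma mbounded_mball (a : Y) (r : R) : mbounded [set y | (mdist a y < r)%R].
Proof.
exists (r + r)%R => x y /= ax ay; apply: le_trans (metric_triangle _ a _) _.
by rewrite metric_sym lerD// ltW.
Qed.

Lemma mboundedW G G' : G `<=` G' -> mbounded G' -> mbounded G.
Proof. by move=> GG' [M MP]; exists M => x y /GG' Gx /GG' Gy; exact: MP. Qed.

Lemma Lip_nonneg u : Lip u ->
  exists2 L : R, (0 <= L)%R & forall x y, (`|u x - u y| <= L * mdist x y)%R.
Proof.
move=> [L lip]; exists `|L|%R => // x y; apply: le_trans (lip x y) _.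
by rewrite ler_wpM2r ?mdist_ge0// ler_norm.
Qed.

Lemma Lip_continuous u : Lip u -> continuous u.
Proof. by move=> [L]; exact: lipschitz_continuous. Qed.

Lemma Lp_weight0 : Lp_weight n p (cst 0).
Proof.
split => [|x|]; [exact: (@measurable_cst _ _ YB)|by []|].
have -> : \int[n]_x (cst 0 x : \bar R) `^ p = \int[n]_x cst 0 x.
  by apply: eq_integral => x _; rewrite /cst poweR0r// gt_eqF.
by rewrite integral0.
Qed.

Lemma Lip_gradient u (L : R) : (0 <= L)%R ->
  (forall x y, (`|u x - u y| <= L * mdist x y)%R) ->
  p_gradient n p u (cst L%:E).
Proof.
by move=> L0 lip; exists (cst 0); [exact: Lp_weight0|exact: ug_along_lip].
Qed.

Lemma Lp_loc_cst (L : R) : (0 <= L)%R -> Lp_loc_fun nu p (cst L%:E).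
Proof.
move=> L0 x; exists [set y | (mdist x y < 1)%R].
have oB := open_mball x 1; split; [exact: oB|by rewrite /= mdistxx|].
rewrite (integral_of_poweR nu_n)//; last 2 first.
- exact: open_borel.
- exact: (@measurable_cst _ _ YB).
rewrite (eq_integral (cst (L `^ p)%:E)); last first.
  by move=> y _; rewrite /cst poweR_EFin.
rewrite (@integral_cst _ YB)//; last exact: open_borel.
rewrite lte_mul_pinfty ?lee_fin ?powR_ge0// [ltLHS]nu_n.1.
by apply: fnu; exact: mbounded_mball.
Qed.

Lemma Lip_locally_dirichlet u : Lip u -> locally_dirichlet nu n p u.
Proof.
move=> /Lip_nonneg[L L0 lip]; exists (cst L%:E); first exact: Lip_gradient.
exact: Lp_loc_cst.
Qed.

Lemma Lip_support_dirichlet v : Lip v -> mbounded [set y | v y != 0%R] ->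
  dirichlet nu p v.
Proof.
move=> lv bv; have cv := Lip_continuous lv.
have [L L0 lip] := Lip_nonneg lv.
set S := [set y | v y != 0%R] in bv.
have bS : borel S.
  rewrite (_ : S = ~` (v @^-1` [set 0%R])).
    apply: open_borel; apply: closed_openC.
    by apply: closed_comp => // x _; exact: cv.
  by apply/seteqP; split => x /= /eqP.
have [mr r0 roo] := Lp_weight0.
apply: (@gradient_dirichlet _ _ _ _ nu_n _ p0 _ (patch (cst 0) S (cst L%:E))) => //.
  exists (cst 0) => //; apply: ug_along_support => //; exact: ug_along_lip.
rewrite (_ : \int[n]_x _ = \int[n]_(x in S) (L `^ p)%:E).
  rewrite (@integral_cst _ YB)// lte_mul_pinfty ?lee_fin ?powR_ge0//.
  by rewrite [ltLHS]nu_n.1; exact: fnu.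
rewrite [RHS]integral_mkcond; apply: eq_integral => x _.
by rewrite /patch /cst; case: ifP => // _; rewrite poweR0r// gt_eqF.
Qed.

Lemma Lip_min u v : Lip u -> Lip v -> Lip (fun x => Num.min (u x) (v x)).
Proof.
move=> /Lip_nonneg[L L0 lu] /Lip_nonneg[M M0 lv]; exists (L + M)%R => x y.
apply: le_trans (ler_norm_min _ _ _ _) _; rewrite ge_max mulrDl.
have Ld : (0 <= L * mdist x y)%R by rewrite mulr_ge0// mdist_ge0.
have Md : (0 <= M * mdist x y)%R by rewrite mulr_ge0// mdist_ge0.
have := lu x y; have := lv x y; move: Ld Md.
move: (L * _)%R (M * _)%R `|u x - u y|%R `|v x - v y|%R => a b c d *.
by apply/andP; split; lra.
Qed.

Lemma Lip_opp u : Lip u -> Lip (fun x => - u x)%R.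
Proof.
by move=> [L lu]; exists L => x y; rewrite -opprD normrN.
Qed.

Lemma LipZ u (k : R) : Lip u -> Lip (fun x => k * u x)%R.
Proof.
move=> [L lu]; exists (`|k| * L)%R => x y.
by rewrite -mulrBr normrM -mulrA ler_wpM2l.
Qed.

Lemma LipD u v : Lip u -> Lip v -> Lip (fun x => u x + v x)%R.
Proof.
move=> [L lu] [M lv]; exists (L + M)%R => x y.
by rewrite opprD addrACA (le_trans (ler_normD _ _))// mulrDl lerD.
Qed.

(** Truncating [u] between [-psi] and [psi] preserves the Lipschitz property without a product. The
    cone [psi] vanishes outside a ball and is at least [K] on [G], and [K] bounds the absolute value
    of [u] there. *)
Lemma Lip_cutoff u G : Lip u -> mbounded G ->
  exists v, [/\ Lip v, dirichlet nu p v & forall y, G y -> v y = u y].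
Proof.
move=> lu [M MP].
have [[a Ga]|G0] := pselect (exists a, G a); last first.
  exists (cst 0%R); split => //.
  - by exists 0%R => x y; rewrite subrr normr0 mul0r.
  - apply: Lip_support_dirichlet.
      by exists 0%R => x y; rewrite subrr normr0 mul0r.
    by exists 0%R => x y /=; rewrite eqxx.
  - by move=> y Gy; exfalso; apply: G0; exists y.
have [L L0 lip] := Lip_nonneg lu.
pose K : R := (`|u a| + L * M)%R.
pose psi y : R := Num.max 0%R (K + M - mdist a y)%R.
have lpsi : Lip (fun y => - psi y)%R.
  have -> : (fun y => - psi y)%R = fun y => Num.min 0%R (- (K + M - mdist a y))%R.
    by apply/funext => y; rewrite /psi oppr_max oppr0.
  apply: Lip_min; first by exists 0%R => x y; rewrite subrr normr0 mul0r.
  exists 1%R => x y.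
  rewrite (_ : (_ - _)%R = mdist a x - mdist a y)%R; last by ring.
  by rewrite !(metric_sym a); exact: mdistl_lip.
have lpsi' : Lip psi.
  have := Lip_opp lpsi; congr Lip; apply/funext => y; exact: opprK.
(* This is the maximum of [-psi] and the minimum of [u] and [psi], written with minima only so that
   [Lip_min] and [Lip_opp] apply. *)
pose v y : R := (- Num.min (psi y) (- Num.min (u y) (psi y)))%R.
have lv : Lip v by apply: Lip_opp; apply: Lip_min => //; exact/Lip_opp/Lip_min.
exists v; split => //.
  apply: Lip_support_dirichlet => //.
  apply: (mboundedW _ (mbounded_mball a (K + M)%R)) => y /= vy0.
  rewrite ltNge; apply: contra vy0 => Kd.
  have -> : v y = 0%R; last by [].
  have psi0 : psi y = 0%R by rewrite /psi (max_idPl _)// subr_le0.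
  rewrite /v psi0; case: (leP (u y) (0%R : R)) => uy; last first.
    by rewrite oppr0 minxx oppr0.
  by rewrite (min_idPl _) ?oppr0// oppr_ge0.
move=> y Gy; have Kpsi : (K <= psi y)%R.
  have := MP a y Ga Gy; rewrite /psi le_max => ay; apply/orP; right; lra.
have uK : (`|u y| <= K)%R.
  rewrite -(subrK (u a) (u y)) (le_trans (ler_normD _ _))// addrC lerD2l.
  apply: le_trans (lip y a) _; apply: ler_wpM2l => //.
  by rewrite metric_sym; exact: MP.
have := le_trans uK Kpsi; rewrite ler_norml => /andP[u1 u2].
by rewrite /v (min_idPl u2) (min_idPr _) ?opprK// lerNl.
Qed.

End lipschitz_functions.

(** * Gradients of compositions *)

Section composition_gradient.
Context {R : realType} {X Y : pmetricType R}.
Local Notation XB := (g_sigma_algebraType (@open X)).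
Local Notation YB := (g_sigma_algebraType (@open Y)).
Variables (mu : {outer_measure set X -> \bar R}) (m : {measure set XB -> \bar R}).
Variables (nu : {outer_measure set Y -> \bar R}) (n : {measure set YB -> \bar R}).
Hypothesis mu_m : borel_trace mu m.
Hypothesis nu_n : borel_trace nu n.
Hypothesis sX : separable_space X.
Hypothesis cnu : forall B, borel B -> nu.-caratheodory B.
Hypothesis fnu : forall A, mbounded A -> nu A < +oo.
Variables (p q : R) (phi : X -> Y).
Hypothesis p0 : (0 < p)%R.
Hypothesis q0 : (0 < q)%R.
Hypothesis cphi : continuous phi.
Hypothesis ind : forall u : Y -> R, dirichlet nu p u -> Lip u ->
  dirichlet mu q (u \o phi).
Implicit Types (u v : Y -> R) (G B : set Y).

Local Notation gradX v := (min_grad mu q (v \o phi)).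

Lemma borel_preimage B : borel B -> borel (phi @^-1` B).
Proof.
move=> bB; have mphi : measurable_fun setT (phi : XB -> YB).
  apply: (@measurability _ _ XB YB setT phi (@open Y)) => // _ [U oU <-].
  rewrite setTI; apply: open_borel; apply: open_comp => // x _; exact: cphi.
by rewrite -[X in borel X]setTI; exact: mphi.
Qed.

Lemma comp_locally_dirichlet v : dirichlet nu p v -> Lip v ->
  locally_dirichlet mu m q (v \o phi).
Proof. by move=> dv lv; apply: (dirichlet_locally mu_m) => //; exact: ind. Qed.

Lemma mu_null_bigcup (A : set X) (A_ : nat -> set X) :
  A `<=` \bigcup_k A_ k -> (forall k, mu (A_ k) = 0) -> mu A = 0.
Proof.
move=> AA A0; apply/eqP; rewrite eq_le outer_measure_ge0 andbT.
apply: le_trans (le_outer_measure mu _ _ AA) _.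
apply: le_trans (outer_measure_sigma_subadditive mu _) _.
by rewrite eseries0.
Qed.

Let ball_ (k : nat) : set Y := [set y | (mdist point y < k.+1%:R)%R].

Let ball_cover y : exists k, ball_ k y.
Proof.
exists (Num.bound (mdist point y)); rewrite /ball_/=.
apply: lt_le_trans (archi_boundP (mdist_ge0 _ _)) _.
by rewrite ler_nat.
Qed.

(** The gradients of cutoffs are placed on the preimages of the disjoint shells between consecutive
    balls, so a single term of the series survives at each point. Another function equal to [u] on
    [G] agrees with [v k] on the part of [G] in the k-th ball, and locality identifies their
    gradients there. *)
Lemma is_comp_grad_ex u : Lip u -> exists g, is_comp_grad mu nu p q phi u g.
Proof.
move=> lu.
have /choice[v vP] : forall k, exists v,
    [/\ Lip v, dirichlet nu p v & forall y, ball_ k y -> v y = u y].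
  by move=> k; apply: (Lip_cutoff nu_n) => //; exact: mbounded_mball.
have lD k : locally_dirichlet mu m q (v k \o phi).
  by have [? ? _] := vP k; exact: comp_locally_dirichlet.
pose A k := phi @^-1` (seqDU ball_ k).
have bball k : borel (ball_ k) by apply: open_borel; exact: open_mball.
have bA k : borel (A k).
  apply: borel_preimage; apply: (@measurableD _ YB); first exact: bball.
  by apply: (@bigsetU_measurable _ YB) => i _; exact: bball.
have b0 : borel_fun (cst 0 : X -> \bar R) by exact: (@measurable_cst _ _ XB).
pose f k := patch (cst 0) (A k) (gradX (v k)).
have bf k : borel_fun (f k).
  by apply: borel_fun_patch => //; exact: (min_grad_borel mu_m sX q0).
have f0 k x : 0 <= f k x.
  rewrite /f /patch; case: ifP => // _; exact: (min_grad_ge0 mu_m sX q0).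
pose g x := \sum_(k <oo) f k x.
have gE k x : A k x -> g x = gradX (v k) x.
  move=> Ax; rewrite /g (@nneseriesD1 _ _ k)// eseries0 ?adde0.
    by rewrite /f /patch mem_set.
  move=> i _ /= ik; rewrite /f /patch memNset// => Aix.
  move/trivIsetP: (trivIset_seqDU ball_) => /(_ i k Logic.I Logic.I ik) ik0.
  have : (seqDU ball_ i `&` seqDU ball_ k) (phi x) by split.
  by rewrite ik0.
exists g; split => [|x|G w oG bG dw lw wu].
- apply: (@ge0_emeasurable_sum _ XB R setT f xpredT) => [k x _ _|k _].
    exact: f0.
  exact: bf.
- by apply: nneseries_ge0 => k _ _; exact: f0.
apply: (@mu_null_bigcup _ (fun k => phi @^-1` (G `&` ball_ k) `&`
   [set x | gradX (v k) x <> gradX w x])).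
  move=> x [Gx /= ne].
  have [k _ Ak] : (\bigcup_k seqDU ball_ k) (phi x).
    by rewrite -seqDU_bigcup_eq; have [k bk] := ball_cover (phi x); exists k.
  exists k => //; split; last by rewrite /= -gE.
  by split => //; have [] := Ak.
move=> k; apply: (min_grad_openE mu_m sX q0).
- apply: open_comp => [x _|]; first exact: cphi.
  by apply: openI => //; exact: open_mball.
- by move=> x [Gx bx] /=; have [_ _ vu] := vP k; rewrite wu// vu.
- exact: lD.
- exact: comp_locally_dirichlet.
Qed.

Lemma comp_gradP u : Lip u ->
  is_comp_grad mu nu p q phi u (comp_grad mu nu p q phi u).
Proof. by move=> lu; apply: xgetPex; exact: is_comp_grad_ex. Qed.

Lemma comp_grad_min_grad u : dirichlet nu p u -> Lip u ->
  mu [set x | comp_grad mu nu p q phi u x <> gradX u x] = 0.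
Proof.
move=> du lu; have [_ _ H] := comp_gradP lu.
apply: (@mu_null_bigcup _ (fun k => phi @^-1` ball_ k `&`
   [set x | comp_grad mu nu p q phi u x <> gradX u x])).
  by move=> x ne; have [k bk] := ball_cover (phi x); exists k.
by move=> k; apply: H => //; [exact: open_mball|exact: mbounded_mball].
Qed.

End composition_gradient.

(** * Localization of test functions *)

Section distance_to_set.
Context {R : realType} {Y : pmetricType R}.
Implicit Types (F W : set Y) (y z : Y).

Definition dist_to F y : R := inf [set mdist y z | z in F].

Lemma dist_to_le F y z : F z -> (dist_to F y <= mdist y z)%R.
Proof.
move=> Fz; apply: ge_inf; last by exists z.
by exists 0%R => _ [w _ <-]; exact: mdist_ge0.
Qed.

Lemma dist_to_ge F y (r : R) : F !=set0 ->
  (forall z, F z -> (r <= mdist y z)%R) -> (r <= dist_to F y)%R.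
Proof.
move=> [z Fz] rF; apply: lb_le_inf; first by exists (mdist y z), z.
by move=> _ [w Fw <-]; exact: rF.
Qed.

Lemma dist_to_lt F y (r : R) : F !=set0 -> (dist_to F y < r)%R ->
  exists2 z, F z & (mdist y z < r)%R.
Proof.
move=> F0 yr; apply: contrapT => nz; move: yr; rewrite ltNge => /negP; apply.
apply: dist_to_ge => // z Fz; rewrite leNgt; apply/negP => yz.
by apply: nz; exists z.
Qed.

Lemma dist_to_ge0 F y : F !=set0 -> (0 <= dist_to F y)%R.
Proof. by move=> F0; apply: dist_to_ge => // z _; exact: mdist_ge0. Qed.

Lemma dist_to_in F y : F y -> dist_to F y = 0%R.
Proof.
move=> Fy; apply/eqP; rewrite eq_le dist_to_ge0 ?andbT; last by exists y.
by rewrite -(mdistxx y) dist_to_le.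
Qed.

Lemma dist_to_lip F x y : F !=set0 ->
  (`|dist_to F x - dist_to F y| <= 1 * mdist x y)%R.
Proof.
move=> F0; have half a b : (dist_to F a - dist_to F b <= mdist a b)%R.
  rewrite lerBlDr -lerBlDl; apply: dist_to_ge => // z Fz.
  by rewrite lerBlDl (le_trans (dist_to_le _ Fz))// metric_triangle.
by rewrite mul1r ler_norml half andbT lerNl opprB metric_sym half.
Qed.

Lemma dist_to_eq0 F y : F !=set0 -> closed F -> (dist_to F y <= 0)%R -> F y.
Proof.
move=> F0 cF y0; apply: contrapT => nFy.
have /nbhs_ballP[e /= e0 eF] : nbhs y (~` F).
  by apply: open_nbhs_nbhs; split => //; exact: closed_openC.
have [|z Fz yz] := @dist_to_lt F y e F0; first exact: le_lt_trans e0.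
by have := eF z; rewrite ballEmdist; apply.
Qed.

(** A Lebesgue number argument. The strict inequality between [r k] and the radius makes the sets
    [V k] open, and since they increase, compactness yields a single index. *)
Lemma compact_dist_to F W : F !=set0 -> compact F -> open W -> F `<=` W ->
  exists2 d : R, (0 < d)%R & [set y | (dist_to F y < d)%R] `<=` W.
Proof.
move=> F0 cF oW FW.
pose r (k : nat) : R := k.+1%:R^-1%R.
have r0 k : (0 < r k)%R by rewrite invr_gt0.
pose V k := [set x | exists2 e : R, (r k < e)%R &
  forall y, (mdist x y < e)%R -> W y].
have oV k : open (V k).
  rewrite openE => x [e re eW].
  pose d := ((e - r k) / 2)%R.
  have d0 : (0 < d)%R by rewrite divr_gt0// subr_gt0.
  apply/nbhs_ballP; exists d => // y; rewrite ballEmdist/= => xy.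
  exists (e - d)%R => [|z yz]; first by rewrite /d; lra.
  apply: eW; apply: le_lt_trans (metric_triangle _ y _) _.
  by rewrite -(subrK d e) addrC ltrD.
have ndV n k : (n <= k)%N -> V n `<=` V k.
  move=> nk x [e re eW]; exists e => //; apply: le_lt_trans re.
  by rewrite lef_pV2 ?posrE ?ltr0n// ler_nat ltnS.
have FV : F `<=` \bigcup_k V k.
  move=> x /FW Wx; have /nbhs_ballP[e /= e0 eW] : nbhs x W.
    exact: open_nbhs_nbhs.
  have [k _ kP] := near_infty_natSinv_lt (PosNum e0).
  exists k => //; exists e; first exact: kP (leqnn k).
  by move=> y xy; apply: eW; rewrite ballEmdist.
have [k Fk] := compact_in_exhaustion cF oV ndV FV.
exists (r k) => // y /= yd.
have [z Fz yz] := dist_to_lt F0 yd; have [e re eW] := Fk z Fz.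
by apply: eW; rewrite metric_sym (lt_trans yz).
Qed.

End distance_to_set.

Section folding.
Context {R : realType}.

(* Each step folds the line at the midpoint of the current range, which halves
   the range; as the slopes remain 1 or -1, this makes a bounded function small
   without changing its gradient. *)
Fixpoint fold (M : R) k (t : R) : R :=
  if k is k'.+1 then `|fold M k' t - M / 2 ^+ k|%R else `|t - 0|%R.

Lemma fold_ge0 M k t : (0 <= fold M k t)%R.
Proof. by case: k => [|k] /=; exact: normr_ge0. Qed.

Lemma fold_le M k t : (`|t| <= M)%R -> (fold M k t <= M / 2 ^+ k)%R.
Proof.
move=> tM; elim: k => [|k IH] /=; first by rewrite subr0 expr0 divr1.
have f0 := fold_ge0 M k t.
have e : (M / 2 ^+ k = M / 2 ^+ k.+1 + M / 2 ^+ k.+1)%R.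
  by rewrite [LHS]splitr exprSr invfM mulrA.
by move: IH; rewrite e ler_norml => ?; apply/andP; split; lra.
Qed.

Lemma fold_lip M k s t : (`|fold M k s - fold M k t| <= `|s - t|)%R.
Proof.
elim: k => [|k IH] /=; first by rewrite !subr0; exact: ler_dist_dist.
apply: le_trans (ler_dist_dist _ _) _; apply: le_trans IH.
by rewrite opprB addrA subrK.
Qed.

End folding.

(** * Inner regularity of integrals, energy near compact sets and folded compositions *)

Section inner_regularity.
Context {R : realType} {X : pmetricType R}.
Local Notation XB := (g_sigma_algebraType (@open X)).
Variables (mu : {outer_measure set X -> \bar R}) (m : {measure set XB -> \bar R}).
Hypothesis mu_m : borel_trace mu m.
Hypothesis rmu : radon mu.
Hypothesis fmu : forall A, mbounded A -> mu A < +oo.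

Lemma compact_borel (K : set X) : compact K -> borel K.
Proof.
move=> cK; apply: closed_borel; apply: compact_closed => //.
exact: metric_hausdorff.
Qed.

(** Truncating the function at height [k] and the set to a ball makes both the integral and the
    measure finite. A compact set of almost full measure then loses little of the bounded
    integrand. *)
Lemma integral_inner_regular (f : X -> \bar R) (E : set X) (b : R) :
  borel_fun f -> (forall x, 0 <= f x) -> borel E ->
  b%:E < \int[m]_(x in E) f x ->
  exists K, [/\ compact K, K `<=` E & b%:E < \int[m]_(x in K) f x].
Proof.
move=> mf f0 bE bf.
pose En k := E `&` [set x | (mdist point x < k%:R)%R].
have bEn k : borel (En k).
  by apply: (@measurableI _ XB) => //; apply: open_borel; exact: open_mball.
pose fk k x := mine (f x) (k%:R)%:E.
have m_cst (a : \bar R) : borel_fun (cst a : X -> \bar R).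
  exact: (@measurable_cst _ _ XB).
have mfk k : borel_fun (fk k) by apply: (@measurable_mine _ XB) => //; exact: m_cst.
have fk0 k x : 0 <= fk k x by rewrite le_min f0 lee_fin ler0n.
pose h k := patch (cst 0) (En k) (fk k).
have mh k : borel_fun (h k) by apply: borel_fun_patch => //; exact: m_cst.
have h0 k x : 0 <= h k x by rewrite /h /patch; case: ifP.
have hcvg x : h ^~ x @ \oo --> patch (cst 0) E f x.
  rewrite {1}/patch; have [/set_mem Ex|nEx] := boolP (x \in E); last first.
    apply: cvg_near_cst; apply: nearW => k; rewrite /h /patch ifN//.
    by apply: contra nEx => /set_mem[Ex _]; exact/mem_set.
  have inE : \forall k \near \oo, En k x.
    exists (Num.bound (mdist point x)) => // k /= xk; split => //=.
    apply: lt_le_trans (archi_boundP (mdist_ge0 _ _)) _.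
    by rewrite ler_nat.
  case fx : (f x) => [r| |].
  - apply: cvg_near_cst; near=> k.
    rewrite /h /patch ifT; last by apply/mem_set; near: k.
    rewrite /fk fx; apply/min_idPl; rewrite lee_fin; near: k.
    exists (Num.bound r) => // k /= rk; have r0 : (0 <= r)%R.
      by have := f0 x; rewrite fx.
    by apply: le_trans (ltW (archi_boundP r0)) _; rewrite ler_nat.
  - apply/cvgeyPge => A; near=> k.
    rewrite /h /patch ifT; last by apply/mem_set; near: k.
    rewrite /fk fx le_min leey/= lee_fin; near: k.
    exists (Num.bound `|A|) => // k /= Ak.
    apply: le_trans (ler_norm A) _.
    by apply: le_trans (ltW (archi_boundP (normr_ge0 _))) _; rewrite ler_nat.
  - by have := f0 x; rewrite fx.
have hnd x : {homo h^~ x : a c / (a <= c)%N >-> a <= c}.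
  move=> a c ac; rewrite /h /patch; case: ifPn => [/set_mem[Ex xa]|_]; last first.
    by case: ifP.
  rewrite ifT; last by apply/mem_set; split => //=; rewrite (lt_le_trans xa)// ler_nat.
  by rewrite /fk le_min !ge_min lexx/= lee_fin ler_nat ac orbT.
have [k bk] : exists k, b%:E < \int[m]_x h k x.
  apply: contrapT => nk; move: bf; rewrite ltNge => /negP; apply.
  have := @cvg_monotone_convergence _ XB R m setT measurableT h mh
    (fun k x _ => h0 k x) (fun x _ => hnd x).
  rewrite (_ : \int[m]_(x in setT) _ = \int[m]_(x in E) f x); last first.
    rewrite [RHS]integral_mkcond; apply: eq_integral => x _.
    by apply/cvg_lim => //; exact: hcvg.
  apply: cvge_le; apply: nearW => k; rewrite leNgt; apply/negP => bk.
  by apply: nk; exists k.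
have hE : \int[m]_x h k x = \int[m]_(x in En k) fk k x by rewrite [RHS]integral_mkcond.
have Efin : m (En k) < +oo.
  rewrite [ltLHS]mu_m.1; apply: fmu.
  apply: (mboundedW _ (mbounded_mball point k%:R)) => x; by case.
have Ifin : \int[m]_x h k x \is a fin_num.
  rewrite ge0_fin_numE; last by apply: integral_ge0 => x _; exact: h0.
  rewrite hE; apply: (@le_lt_trans _ _ (\int[m]_(x in En k) (k%:R)%:E)).
    apply: ge0_le_integral => //; [exact: bEn| |].
      exact: (@measurable_funTS _ _ XB _ _ _ (mfk k)).
    by move=> x _; rewrite ge_min lexx orbT.
  rewrite (@integral_cst _ XB)//; last exact: bEn.
  by rewrite lte_mul_pinfty.
move: bk; rewrite -(fineK Ifin) lte_fin; set i := fine _ => bi.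
(* The loss is at most [k] times [d]; dividing by [k.+1] keeps it strictly below [i - b] and allows
   [k] to be zero. *)
pose d := ((i - b) / k.+1%:R)%R.
have d0 : (0 < d)%R by rewrite divr_gt0// subr_gt0.
have [rg _ rsup] := rmu.
have := rsup (En k) (rg.1 _ (bEn k)).
have Efin' : mu (En k) \is a fin_num by rewrite ge0_fin_numE// -mu_m.1.
move=> supE; have : mu (En k) - d%:E < mu (En k).
  by rewrite lteBlDr// lteDl// lte_fin.
rewrite {2}supE => /ereal_sup_gt[_ [K [cK KE] <-] Kd].
have bK := compact_borel cK.
exists K; split => //; first by move=> x /KE[].
have mEKb : borel (En k `\` K) by exact: (@measurableD _ XB _ _ (bEn k) bK).
have mEK : m (En k `\` K) < d%:E.
  rewrite (@measureD _ XB R m _ _ (bEn k) bK Efin).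
  suff H : mu (En k) - mu K < d%:E.
    have KI : mu K = m (En k `&` K) by rewrite setIidr// mu_m.1.
    by move: H; rewrite KI -mu_m.1.
  have Kfin : mu K \is a fin_num.
    by rewrite ge0_fin_numE ?outer_measure_ge0// (le_lt_trans (le_outer_measure mu _ _ KE))// -ge0_fin_numE.
  by rewrite lteBlDr// addeC -lteBlDr.
have fK0 : \int[m]_x h k x <= \int[m]_(x in K) f x + (k%:R * d)%:E.
  have mfkS (D : set XB) : measurable_fun D (fk k).
    exact: (@measurable_funTS _ _ XB _ _ _ (mfk k)).
  have mfS (D : set XB) : measurable_fun D f.
    exact: (@measurable_funTS _ _ XB _ _ _ mf).
  rewrite hE -(setDUK KE) (@ge0_integral_setU _ XB)//; last first.
    by apply/disj_setPS => x [Kx [_ /(_ Kx)]].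
  rewrite EFinM; apply: leeD.
    apply: ge0_le_integral => //.
    by move=> x _; rewrite ge_min lexx.
  apply: (@le_trans _ _ (\int[m]_(x in En k `\` K) (k%:R)%:E)).
    apply: ge0_le_integral => //.
    by move=> x _; rewrite ge_min lexx orbT.
  rewrite (@integral_cst _ XB)//.
  by apply: lee_wpmul2l; [rewrite lee_fin|exact: ltW].
rewrite -(fineK Ifin) -/i in fK0.
rewrite -(@lteD2rE _ (k%:R * d)%:E)//; apply: lt_le_trans fK0.
rewrite -EFinD lte_fin -ltrBrDl.
have -> : (i - b = k.+1%:R * d)%R by rewrite /d mulrC divfK.
by rewrite ltr_pM2r// ltr_nat.
Unshelve. all: end_near. Qed.

End inner_regularity.

Section localization.
Context {R : realType} {X Y : pmetricType R}.
Local Notation XB := (g_sigma_algebraType (@open X)).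
Local Notation YB := (g_sigma_algebraType (@open Y)).
Variables (mu : {outer_measure set X -> \bar R}) (m : {measure set XB -> \bar R}).
Variables (nu : {outer_measure set Y -> \bar R}) (n : {measure set YB -> \bar R}).
Hypothesis mu_m : borel_trace mu m.
Hypothesis nu_n : borel_trace nu n.
Hypothesis sX : separable_space X.
Hypothesis sY : separable_space Y.
Hypothesis fnu : forall A, mbounded A -> nu A < +oo.
Variables (p q : R) (phi : X -> Y).
Hypothesis p0 : (0 < p)%R.
Hypothesis q0 : (0 < q)%R.
Implicit Types (u : Y -> R) (B F : set Y).

Local Notation gradX v := (min_grad mu q (v \o phi)).
Local Notation gradY u := (min_grad nu p u).

Lemma gradY_borel u : Lip u -> borel_fun (gradY u).
Proof.
move=> lu; apply: (min_grad_borel nu_n sY p0).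
exact: Lip_locally_dirichlet.
Qed.

Lemma gradY_ge0 u y : Lip u -> 0 <= gradY u y.
Proof.
move=> lu; apply: (min_grad_ge0 nu_n sY p0).
exact: Lip_locally_dirichlet.
Qed.

Lemma Lip_energy_lty u B : Lip u -> borel B -> mbounded B ->
  \int[n]_(y in B) gradY u y `^ p < +oo.
Proof.
move=> lu bB mB; have [L L0 lip] := Lip_nonneg lu.
have pL := Lip_gradient n p0 L0 lip.
have lL := Lp_loc_cst nu_n fnu p L0.
have mg := gradY_borel lu.
apply: (@le_lt_trans _ _ (\int[n]_(y in B) (L `^ p)%:E)); last first.
  rewrite (@integral_cst _ YB)// lte_mul_pinfty ?lee_fin ?powR_ge0//.
  by rewrite [ltLHS]nu_n.1; exact: fnu.
apply: (@ae_ge0_le_integral _ YB) => //.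
- by move=> x _; exact: poweR_ge0.
- apply: (@measurable_funTS _ _ YB); exact: (@measurable_poweR_comp _ YB).
- by move=> x _; rewrite lee_fin powR_ge0.
exists [set x | ~ gradY u x <= cst L%:E x]; split.
- rewrite -[X in measurable X]setTI.
  rewrite (_ : [set x | _] = [set x | cst L%:E x < gradY u x]).
    apply: (@measurable_lte _ YB _ _ (@measurableT _ YB)).
      exact: (@measurable_cst _ _ YB).
    exact: mg.
  by apply/seteqP; split => x /=; rewrite ltNge => /negP.
- by rewrite [LHS]nu_n.1; exact: (min_grad_le nu_n sY p0).
- move=> x /= nle le; apply: nle => _; rewrite -poweR_EFin.
  exact: lee_poweR (ltW p0) (gradY_ge0 x lu) le.
Qed.

Lemma compact_mbounded F : compact F -> mbounded F.
Proof.
move=> cF; pose V k := [set y : Y | (mdist point y < k%:R)%R].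
have [|k1 k2 k12 y /= yk|y Fy|k Fk] := @compact_in_exhaustion _ F V cF.
- by move=> k; exact: open_mball.
- by apply: lt_le_trans yk _; rewrite ler_nat.
- exists (Num.bound (mdist point y)) => //.
  exact: archi_boundP (mdist_ge0 _ _).
exact: mboundedW Fk (mbounded_mball _ _).
Qed.

Lemma open_dist_to F (r : R) : F !=set0 -> open [set y | (dist_to F y < r)%R].
Proof.
move=> F0; apply: (open_comp (f := dist_to F) _ (@open_lt _ r)) => y _.
apply: (@lipschitz_continuous _ _ _ 1%R) => x z; exact: dist_to_lip.
Qed.

Lemma mbounded_dist_to F (r : R) : F !=set0 -> mbounded F ->
  mbounded [set y | (dist_to F y < r)%R].
Proof.
move=> F0 [M MP]; exists (r + M + r)%R => x y /= xr yr.
have [x' Fx xx'] := dist_to_lt F0 xr; have [y' Fy yy'] := dist_to_lt F0 yr.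
apply: le_trans (metric_triangle _ y' _) _; apply: lerD; last first.
  by rewrite metric_sym ltW.
apply: le_trans (metric_triangle _ x' _) _; apply: lerD; first exact: ltW.
exact: MP.
Qed.

(** Neighbourhoods of the closed set [F] shrink to [F], and the first of them is bounded and so has
    finite energy: dominated convergence. *)
Lemma Lip_energy_near u F (d0 e : R) : Lip u -> compact F -> F !=set0 ->
  (0 < d0)%R -> (0 < e)%R ->
  exists2 d : R, (0 < d <= d0)%R &
    \int[n]_(y in [set y | (dist_to F y < d)%R]) gradY u y `^ p <=
    \int[n]_(y in F) gradY u y `^ p + e%:E.
Proof.
move=> lu cF F0 d00 e0.
have mF := compact_mbounded cF.
pose V (k : nat) := [set y | (dist_to F y < k.+1%:R^-1)%R].
have bV k : borel (V k) by apply: open_borel; exact: open_dist_to.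
have bF : borel F by exact: compact_borel.
have cF' : closed F by apply: compact_closed => //; exact: metric_hausdorff.
pose g y := gradY u y `^ p.
have g0 y : 0 <= g y by exact: poweR_ge0.
have mg : borel_fun g by apply: (@measurable_poweR_comp _ YB); exact: gradY_borel.
have m0 : borel_fun (cst 0 : Y -> \bar R) by exact: (@measurable_cst _ _ YB).
have Ffin : \int[n]_(y in F) g y \is a fin_num.
  by rewrite ge0_fin_numE ?integral_ge0//; exact: Lip_energy_lty.
have [k kP] : exists k, \int[n]_(y in V k) g y <= \int[n]_(y in F) g y + e%:E.
  apply: contrapT => nk.
  have gt k : \int[n]_(y in F) g y + e%:E <= \int[n]_y patch (cst 0) (V k) g y.
    rewrite -(@integral_mkcond _ YB R n (V k) g) ltW// ltNge; apply/negP => le.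
    by apply: nk; exists k.
  suff : \int[n]_(y in F) g y + e%:E <= \int[n]_y patch (cst 0) F g y.
    rewrite -(@integral_mkcond _ YB R n F g) leNgt => /negP; apply.
    by rewrite lteDl// lte_fin.
  apply: (@ge0_dominated_le _ YB R n (fun k => patch (cst 0) (V k) g) _
    (patch (cst 0) (V 0%N) g)) => //.
  - by move=> k; exact: borel_fun_patch.
  - exact: borel_fun_patch.
  - exact: borel_fun_patch.
  - move=> k y; rewrite /patch; case: ifPn => [/set_mem Vy|_]; last first.
      by rewrite /cst lexx/=; case: ifP.
    rewrite g0 ifT ?lexx//; apply/mem_set; apply: lt_le_trans Vy _.
    by rewrite lef_pV2 ?posrE ?ltr0n// ler_nat.
  - rewrite -(@integral_mkcond _ YB R n (V 0%N) g); apply: Lip_energy_lty => //.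
    exact: mbounded_dist_to.
  - move=> y; apply: cvg_near_cst; rewrite /patch; case: ifPn => yF.
      apply: nearW => k; rewrite ifT//; apply/mem_set; rewrite /V/=.
      by rewrite (dist_to_in (set_mem yF)) invr_gt0.
    have dy : (0 < dist_to F y)%R.
      rewrite ltNge; apply: contra yF => le; apply/mem_set.
      exact: dist_to_eq0.
    have [k0 _ k0P] := near_infty_natSinv_lt (PosNum dy).
    exists k0 => // k /= kk; rewrite ifN//; apply/negP => /set_mem.
    by rewrite /V/= ltNge => /negP; apply; apply: ltW; exact: k0P.
have k0 : (0 < k.+1%:R^-1 :> R)%R by rewrite invr_gt0.
exists (Num.min d0 k.+1%:R^-1)%R; first by rewrite lt_min d00 k0 ge_min lexx.
apply: le_trans kP; apply: (@ge0_subset_integral _ YB) => //.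
- by apply: open_borel; exact: open_dist_to.
- exact: bV.
- exact: (@measurable_funTS _ _ YB _ _ _ mg).
- by move=> y _; exact: poweR_ge0.
- by move=> y /=; rewrite lt_min => /andP[].
Qed.

Lemma fold_gradX u (M : R) k : continuous (u \o phi) ->
  locally_dirichlet mu m q (u \o phi) ->
  mu [set x | ~ gradX u x <= gradX (fold M k \o u) x] = 0.
Proof.
move=> cu lu.
have cf j : continuous ((fold M j \o u) \o phi).
  move=> x; apply/cvgrPdist_lt => e e0.
  have /cvgrPdist_lt/(_ e e0) := cu x; apply: filterS => y.
  by apply: le_lt_trans; exact: fold_lip.
have lf j : locally_dirichlet mu m q ((fold M j \o u) \o phi).
  apply: (locally_dirichletZ mu_m (u := u \o phi) (k := 1%R)) => // x y.
  by rewrite mul1r; exact: fold_lip.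
(* The base case is a fold at level 0, which is why [fold] starts with the distance to 0 rather than
   with a bare absolute value. *)
elim: k => [|k IH]; first exact: (min_grad_fold mu_m sX q0 0%R).
have H := min_grad_fold mu_m sX q0 (M / 2 ^+ k.+1)%R (cf k) (lf k).
apply/eqP; rewrite eq_le outer_measure_ge0 andbT.
rewrite -[leRHS]adde0 -{1}IH -H.
apply: le_trans (outer_measureU2 mu _ _); apply: le_outer_measure => x /= nle.
have [le|nle'] := pselect (gradX u x <= gradX (fold M k \o u) x); last by left.
by right => le'; apply: nle; exact: le_trans le'.
Qed.

End localization.

Lemma ler_dist_max0 (R : realFieldType) (a b : R) :
  (`|Num.max 0 a - Num.max 0 b| <= `|a - b|)%R.
Proof.
have := ler_norm_min 0%R (- a)%R 0%R (- b)%R.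
have E (x : R) : Num.min 0%R (- x)%R = (- Num.max 0 x)%R.
  by rewrite oppr_max oppr0.
rewrite !E subrr normr0 (max_idPr (normr_ge0 _)).
by rewrite -!opprD !normrN.
Qed.

(** * Localization near a compact set *)

Section localization_lemma.
Context {R : realType} {X Y : pmetricType R}.
Local Notation XB := (g_sigma_algebraType (@open X)).
Local Notation YB := (g_sigma_algebraType (@open Y)).
Variables (mu : {outer_measure set X -> \bar R}) (m : {measure set XB -> \bar R}).
Variables (nu : {outer_measure set Y -> \bar R}) (n : {measure set YB -> \bar R}).
Hypothesis mu_m : borel_trace mu m.
Hypothesis nu_n : borel_trace nu n.
Hypothesis sX : separable_space X.
Hypothesis sY : separable_space Y.
Hypothesis cnu : forall B, borel B -> nu.-caratheodory B.
Hypothesis fnu : forall A, mbounded A -> nu A < +oo.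
Variables (p q : R) (phi : X -> Y).
Hypothesis p0 : (0 < p)%R.
Hypothesis q0 : (0 < q)%R.
Hypothesis cphi : continuous phi.
Hypothesis ind : forall u : Y -> R, dirichlet nu p u -> Lip u ->
  dirichlet mu q (u \o phi).
Implicit Types (u v : Y -> R) (B F W : set Y) (K : set X).

Local Notation gradX v := (min_grad mu q (v \o phi)).
Local Notation gradY u := (min_grad nu p u).
Local Notation cgrad u := (comp_grad mu nu p q phi u).

(** Multiplying by a cutoff would add the size of [u] times the slope of the cutoff to the gradient.
    After folding, the function is at most [a] near [F], so a cutoff of height [2 * a] and slope at
    most [c] suffices, and taking the minimum costs only the larger of the two gradients. *)
Lemma Lip_compress u F (d c : R) : Lip u -> F !=set0 -> mbounded F ->
  (0 < d)%R -> (0 < c)%R ->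
  exists v, exists M : R, exists k : nat, [/\
    Lip v, forall y, v y != 0%R -> (dist_to F y < d)%R,
    forall y, (dist_to F y < d / 2)%R -> v y = fold M k (u y) &
    forall rho g, borel_fun rho -> (forall y, 0 <= rho y) ->
      ug_along rho u g -> ug_along rho v
      (patch (cst 0) [set y | v y != 0%R] (fun y => maxe (g y) c%:E))].
Proof.
move=> lu F0 mF d0 c0.
have [L L0 lip] := Lip_nonneg lu.
have [D DP] := mbounded_dist_to d F0 mF.
have [z Fz] := F0.
have zS : (dist_to F z < d)%R by rewrite dist_to_in.
(* A bound for [u] on the [d]-neighbourhood of [F], whose diameter is at most [D]; the summand 1
   makes it positive. *)
pose M : R := (`|u z| + L * D + 1)%R.
have D0 : (0 <= D)%R by rewrite -(mdistxx z) DP.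
have M0 : (0 < M)%R by rewrite ltr_wpDl// addr_ge0// mulr_ge0.
have uM y : (dist_to F y < d)%R -> (`|u y| <= M)%R.
  move=> yS; rewrite -(subrK (u z) (u y)) (le_trans (ler_normD _ _))//.
  rewrite addrC /M -addrA lerD2l (le_trans (lip _ _))//.
  rewrite (@le_trans _ _ (L * D)%R)//; last by rewrite lerDl.
  by rewrite ler_wpM2l// DP.
(* Folded so often that the slope [2 * a / d] of the cutoff does not exceed [c]. *)
have [k kP] : exists k, (M / 2 ^+ k <= c * (d / 2))%R.
  have cd : (0 < c * (d / 2))%R by rewrite mulr_gt0// divr_gt0.
  exists (Num.bound (M / (c * (d / 2)))%R).
  have := archi_boundP (divr_ge0 (ltW M0) (ltW cd)).
  set j := Num.bound _ => jP; rewrite ler_pdivrMr ?exprn_gt0//.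
  rewrite -ler_pdivrMl// mulrC (le_trans (ltW jP))// -natrX ler_nat.
  by rewrite ltnW// ltn_expl.
pose a : R := (M / 2 ^+ k)%R.
have a0 : (0 < a)%R by rewrite divr_gt0// exprn_gt0.
(* The cutoff is still [a], the bound of the folded function, at distance [d / 2] and vanishes from
   distance [d] on. *)
pose psi y : R := Num.max 0%R (2 * a - (2 * a / d) * dist_to F y)%R.
have ad : (2 * a / d <= c)%R.
  rewrite ler_pdivrMr//; have kP' : (a <= c * (d / 2))%R := kP.
  by rewrite -ler_pdivlMl// mulrC -mulrA.
have psi_lip x y : (`|psi x - psi y| <= c * mdist x y)%R.
  apply: le_trans (ler_dist_max0 _ _) _.
  rewrite (_ : (_ - _)%R = (2 * a / d * (dist_to F y - dist_to F x))%R); last by ring.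
  have ad0 : (0 <= 2 * a / d)%R by rewrite divr_ge0// ?mulr_ge0// ltW.
  rewrite normrM ger0_norm//.
  apply: (@le_trans _ _ (2 * a / d * mdist x y)%R).
    rewrite ler_wpM2l// distrC.
    by apply: le_trans (dist_to_lip _ _ F0) _; rewrite mul1r.
  by rewrite ler_wpM2r// mdist_ge0.
have psi0 y : (0 <= psi y)%R by rewrite le_max lexx.
pose v y : R := Num.min (fold M k (u y)) (psi y).
have v0 y : (0 <= v y)%R by rewrite le_min fold_ge0 psi0.
have flip : Lip (fun y => fold M k (u y)).
  by exists L => x y; apply: le_trans (fold_lip _ _ _ _) (lip x y).
have lv : Lip v by apply: Lip_min => //; exists c.
exists v, M, k; split => // [y vy|y yd|rho g mrho rho0 ug].
- rewrite ltNge; apply: contra vy => dy.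
  have psiy : psi y = 0%R.
    apply/max_idPl; rewrite subr_le0 mulrAC ler_pdivlMr// ler_wpM2l//.
    by rewrite mulr_ge0// ltW.
  by rewrite eq_le v0 andbT /v psiy ge_min lexx orbT.
- rewrite /v; apply/min_idPl.
  have yd' : (dist_to F y < d)%R by apply: lt_trans yd _; rewrite ltr_pdivrMr// ltr_pMr// ltr1n.
  apply: le_trans (fold_le _ (uM y yd')) _; rewrite -/a /psi le_max; apply/orP; right.
  have : (2 * a / d * dist_to F y <= 2 * a / d * (d / 2))%R.
    by rewrite ler_wpM2l ?ltW// divr_gt0// mulr_gt0.
  have -> : (2 * a / d * (d / 2) = a)%R.
    by rewrite mulrA divfK ?gt_eqF// mulrAC divff ?mul1r// pnatr_eq0.
  by move: (_ * dist_to F y)%R a0 => w; lra.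
- apply: ug_along_support => //; first exact: Lip_continuous.
  apply: (@ug_along_max _ _ _ (fun y => fold M k (u y)) psi).
  + by move=> x y; exact: ler_norm_min.
  + by apply: ug_along_le ug => x y; exact: fold_lip.
  + by apply: ug_along_lip => //; exact: ltW.
Qed.

(** The explicit gradient [g] is returned together with [v], because it vanishes everywhere off [W],
    not just almost everywhere. This makes energies of functions with disjoint neighbourhoods add
    exactly. *)
Lemma localize u K W (e : R) : Lip u -> compact K -> K !=set0 -> open W ->
  phi @` K `<=` W -> (0 < e)%R ->
  exists v, exists g, [/\ Lip v, dirichlet nu p v, p_gradient n p v g,
    forall y, ~ W y -> v y = 0%R /\ g y = 0 &
    \int[n]_y g y `^ p <= \int[n]_(y in phi @` K) gradY u y `^ p + e%:E /\
    mu (K `&` [set x | ~ cgrad u x <= gradX v x]) = 0].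
Proof.
move=> lu cK [x0 Kx0] oW KW e0; set F := phi @` K.
have F0 : F !=set0 by exists (phi x0), x0.
have cF : compact F.
  by apply: continuous_compact => //; exact: continuous_subspaceT.
have mF := compact_mbounded cF.
have e20 : (0 < e / 2)%R by rewrite divr_gt0.
have [d1 d10 dW] := compact_dist_to F0 cF oW KW.
have [d /andP[d0 dd1] dE] :=
  Lip_energy_near nu_n sY fnu p0 lu cF F0 d10 e20.
set S := [set y | (dist_to F y < d)%R] in dE.
have oS : open S by exact: open_dist_to.
have bS := open_borel oS.
have mS : mbounded S by exact: mbounded_dist_to.
have mc (r : \bar R) : borel_fun (cst r : Y -> \bar R).
  exact: (@measurable_cst _ _ YB).
have lD := Lip_locally_dirichlet nu_n fnu p0 lu.
(* The slope [c] is chosen so that the constant [c] on [S] costs at most [e / 2]; the other half of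
   [e] was spent on the choice of [d]. *)
pose one : Y -> \bar R := patch (cst 0) S (cst 1%:E).
have mone : borel_fun one by exact: borel_fun_patch.
have one0 y : 0 <= one y by rewrite /one /patch; case: ifP.
have oneoo : \int[n]_y one y `^ p < +oo.
  rewrite (_ : \int[n]_y _ = \int[n]_(y in S) 1); last first.
    rewrite [RHS]integral_mkcond; apply: eq_integral => y _.
    rewrite /one /patch /cst; case: ifP => _; first exact: poweR1r.
    by rewrite poweR0r// gt_eqF.
  by rewrite (@integral_cst _ YB)// mul1e [ltLHS]nu_n.1; exact: fnu.
have [c c0 cE] := p_integrable_rescale (m := n) p0 mone one0 oneoo e20.
have [v [M [k [lv vS vfold vug]]]] := Lip_compress lu F0 mF d0 c0.
have [rho H ug] := min_grad_gradient nu_n sY p0 lD.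
have [mrho rho0 _] := H.
have mv : mbounded [set y | v y != 0%R].
  by apply: mboundedW mS => y; exact: vS.
have dv : dirichlet nu p v by exact: (Lip_support_dirichlet nu_n).
have ugv := vug rho _ mrho rho0 ug.
set g := patch _ _ _ in ugv.
have pg : p_gradient n p v g by exists rho.
have mg := p_gradient_borel pg; have g0 := p_gradient_ge0 pg.
have mgu := p_gradient_borel (min_grad_gradient nu_n sY p0 lD).
have gu0 := p_gradient_ge0 (min_grad_gradient nu_n sY p0 lD).
exists v, g; split => //; last split.
- move=> y nWy; have vy0 : v y = 0%R.
    apply: contrapT => /eqP/vS yd; apply: nWy.
    by apply: dW; exact: lt_le_trans yd dd1.
  by split => //; rewrite /g /patch memNset//= vy0 eqxx.
- have mgup : borel_fun (fun y => gradY u y `^ p).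
    exact: (@measurable_poweR_comp _ YB).
  apply: (@le_trans _ _ (\int[n]_y
      (patch (cst 0) S (fun y => gradY u y `^ p) y + (c%:E * one y) `^ p))).
    apply: ge0_le_integral => //.
    + by move=> y _; exact: poweR_ge0.
    + exact: (@measurable_poweR_comp _ YB).
    + apply: (@emeasurable_funD _ YB); first exact: borel_fun_patch.
      apply: (@measurable_poweR_comp _ YB); exact: (@measurable_funeM _ YB).
    + move=> y _; rewrite {1}/g {1}/patch; case: ifPn => [/set_mem/vS yS|_]; last first.
        rewrite /cst poweR0r ?gt_eqF// adde_ge0 ?poweR_ge0//.
        by rewrite /patch; case: ifP => // _; exact: poweR_ge0.
      rewrite /one /patch mem_set// /cst mule1 /maxe; case: ifP => _.
        by rewrite leeDr// poweR_ge0.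
      by rewrite leeDl// poweR_ge0.
  rewrite (@ge0_integralD _ YB)//; last 4 first.
  + by move=> y _; rewrite /patch; case: ifP => // _; exact: poweR_ge0.
  + exact: borel_fun_patch.
  + by move=> y _; exact: poweR_ge0.
  + apply: (@measurable_poweR_comp _ YB); exact: (@measurable_funeM _ YB).
  rewrite -(@integral_mkcond _ YB R n S (fun y => gradY u y `^ p)).
  apply: le_trans (leeD dE cE) _.
  by rewrite -addeA -EFinD -splitr.
- set O := [set y | (dist_to F y < d / 2)%R].
  have oO : open O by exact: open_dist_to.
  have mO : mbounded O by exact: mbounded_dist_to.
  (* [u] itself need not be in the Dirichlet space, so a cutoff [w] equal to [u] near [F] mediates:
     [comp_grad] of [u] is linked to the gradients of [w], of the folded [w] and of [v] after
     composition, each link holding off a null set. *)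
  have [w [lw dw wu]] := Lip_cutoff nu_n cnu fnu p0 lu mO.
  have [_ _ cgP] := comp_gradP mu_m nu_n sX cnu fnu p0 q0 cphi ind lu.
  have N1 := cgP O w oO mO dw lw wu.
  have lwX := comp_locally_dirichlet mu_m ind dw lw.
  have lvX := comp_locally_dirichlet mu_m ind dv lv.
  have cwX : continuous (w \o phi).
    by move=> x; apply: continuous_comp; [exact: cphi|exact: Lip_continuous].
  have N2 := fold_gradX mu_m sX q0 M k cwX lwX.
  have lf : locally_dirichlet mu m q ((fold M k \o w) \o phi).
    apply: (locally_dirichletZ mu_m (u := w \o phi) (k := 1%R)) => // x y.
    by rewrite mul1r; exact: fold_lip.
  have oO' : open (phi @^-1` O).
    by apply: open_comp => // x _; exact: cphi.
  have fv x : (phi @^-1` O) x -> (fold M k \o w) (phi x) = v (phi x).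
    by move=> Ox; rewrite vfold//= wu.
  have N3 := min_grad_open mu_m sX q0 oO' fv lf lvX.
  apply/eqP; rewrite eq_le outer_measure_ge0 andbT.
  rewrite -[leRHS]adde0 -{1}N1 -[X in _ + X]adde0 -{1}N2 -N3.
  apply: le_trans; last first.
    by apply: leeD2l; exact: (outer_measureU2 mu).
  apply: le_trans; last exact: (outer_measureU2 mu).
  apply: le_outer_measure => x [Kx /= nle].
  have Ox : O (phi x).
    by rewrite /O/= dist_to_in ?divr_gt0//; exists x.
  have [E1|] := pselect (cgrad u x = gradX w x); last by left.
  have [E2|] := pselect (gradX w x <= gradX (fold M k \o w) x); last by right; left.
  right; right; split => //= E3; apply: nle; rewrite E1.
  exact: le_trans E3.
Qed.

End localization_lemma.

Section ae_comparison.
Context {R : realType} {X : pmetricType R}.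
Local Notation XB := (g_sigma_algebraType (@open X)).
Variables (mu : {outer_measure set X -> \bar R}) (m : {measure set XB -> \bar R}).
Hypothesis mu_m : borel_trace mu m.
Variable q : R.
Hypothesis q0 : (0 < q)%R.

Lemma ae_power_integral_le (A : set X) (f h : X -> \bar R) : borel A ->
  borel_fun f -> (forall x, 0 <= f x) -> borel_fun h -> (forall x, 0 <= h x) ->
  mu (A `&` [set x | ~ f x <= h x]) = 0 ->
  \int[m]_(x in A) f x `^ q <= \int[m]_(x in A) h x `^ q.
Proof.
move=> bA mf f0 mh h0 N0; apply: (@ae_ge0_le_integral _ XB) => //.
- by move=> x _; exact: poweR_ge0.
- apply: (@measurable_funTS _ _ XB); exact: (@measurable_poweR_comp _ XB).
- by move=> x _; exact: poweR_ge0.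
- apply: (@measurable_funTS _ _ XB); exact: (@measurable_poweR_comp _ XB).
exists (A `&` [set x | ~ f x <= h x]); split.
- rewrite (_ : [set x | _] = [set x | h x < f x]).
    apply: (@measurable_lte _ XB _ _ bA); exact: (@measurable_funTS _ _ XB).
  by apply/seteqP; split => x /=; rewrite ltNge => /negP.
- by rewrite [LHS]mu_m.1.
- move=> x /= nle; split; first by apply: contrapT => nAx; apply: nle => /nAx.
  by move=> le; apply: nle => _; exact: lee_poweR (ltW q0) (f0 x) le.
Qed.

End ae_comparison.

Lemma lte_real_between (R : realType) (a : R) (x : \bar R) : a%:E < x ->
  exists2 b : R, (a < b)%R & b%:E < x.
Proof.
case: x => [r| |]//; last by move=> _; exists (a + 1)%R; rewrite ?ltrDl// ltry.
rewrite lte_fin => ar; exists ((a + r) / 2)%R; first by rewrite midf_lt.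
by rewrite lte_fin midf_lt.
Qed.

Section localization_levels.
Context {R : realType} {X Y : pmetricType R}.
Local Notation XB := (g_sigma_algebraType (@open X)).
Local Notation YB := (g_sigma_algebraType (@open Y)).
Variables (mu : {outer_measure set X -> \bar R}) (m : {measure set XB -> \bar R}).
Variables (nu : {outer_measure set Y -> \bar R}) (n : {measure set YB -> \bar R}).
Hypothesis mu_m : borel_trace mu m.
Hypothesis nu_n : borel_trace nu n.
Hypothesis sX : separable_space X.
Hypothesis sY : separable_space Y.
Hypothesis rmu : radon mu.
Hypothesis fmu : forall A, mbounded A -> mu A < +oo.
Hypothesis cnu : forall B, borel B -> nu.-caratheodory B.
Hypothesis fnu : forall A, mbounded A -> nu A < +oo.
Variables (p q : R) (phi : X -> Y).
Hypothesis p0 : (0 < p)%R.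
Hypothesis q0 : (0 < q)%R.
Hypothesis cphi : continuous phi.
Hypothesis ind : forall u : Y -> R, dirichlet nu p u -> Lip u ->
  dirichlet mu q (u \o phi).
Implicit Types (u v : Y -> R) (B W : set Y) (K : set X).

Local Notation gradX v := (min_grad mu q (v \o phi)).
Local Notation gradY u := (min_grad nu p u).
Local Notation cgrad u := (comp_grad mu nu p q phi u).

(** [K] is chosen before [W], since in the application [W] depends on two such compact sets. The
    strict gap between the level and the integral leaves room to scale the localized function down
    until its energy is at most 1 again. *)
Lemma localize_level u B (b : R) : Lip u -> borel B ->
  \int[n]_(y in B) gradY u y `^ p <= 1 ->
  b = 0%R \/ (0 < b)%R /\
    (b `^ q)%:E < \int[m]_(x in phi @^-1` B) cgrad u x `^ q ->
  exists K, [/\ compact K, K `<=` phi @^-1` B & forall W, open W ->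
    phi @` K `<=` W -> exists v, exists g, [/\ Lip v, p_gradient n p v g,
      forall y, ~ W y -> v y = 0%R /\ g y = 0, \int[n]_y g y `^ p <= 1 &
      (b `^ q)%:E <= \int[m]_(x in K) gradX v x `^ q]].
Proof.
move=> lu bB uB [->|[b0 bu]].
  (* At level zero nothing has to be carried, so the empty set and the zero function do. *)
  exists set0; split; [exact: compact0|by []|move=> W _ _].
  have L0 (x y : Y) : (`|cst 0 x - cst 0 y : R| <= 0 * mdist x y)%R.
    by rewrite subrr normr0 mul0r.
  exists (cst 0%R), (cst 0); split => //.
  - by exists 0%R.
  - exact: Lip_gradient.
  - rewrite (eq_integral (cst 0)) ?integral0// => y _.
    by rewrite /cst poweR0r// gt_eqF.
  - by rewrite powR0 ?gt_eqF// integral_ge0// => x _; exact: poweR_ge0.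
have [mc c0 _] := comp_gradP mu_m nu_n sX cnu fnu p0 q0 cphi ind lu.
have [beta bbeta betau] := lte_real_between bu.
have beta0 : (0 < beta)%R by apply: le_lt_trans bbeta; exact: powR_ge0.
have [|||K [cK KB Kbeta]] := integral_inner_regular mu_m rmu fmu _ _ _ betau.
- exact: (@measurable_poweR_comp _ XB).
- by move=> x; exact: poweR_ge0.
- exact: borel_preimage.
have bK := compact_borel cK.
have K0 : K !=set0.
  apply/set0P/eqP => K0; move: Kbeta; rewrite K0 integral_set0 ltNge.
  by rewrite lee_fin ltW.
exists K; split => // W oW KW.
have bb0 : (0 < b `^ q / beta)%R by rewrite divr_gt0// powR_gt0.
(* The largest scaling down that the gap between [b] to the power [q] and [beta] permits. *)
pose s : R := ((b `^ q / beta) `^ q^-1)%R.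
have s0 : (0 < s)%R by rewrite powR_gt0.
have sq : (s `^ q * beta = b `^ q)%R.
  by rewrite /s -powRrM mulVf ?gt_eqF// powRr1 ?(ltW bb0)// divfK// gt_eqF.
have s1 : (s < 1)%R.
  have -> : (1 = 1 `^ q^-1 :> R)%R by rewrite powR1.
  apply: gt0_ltr_powR; rewrite ?invr_gt0 ?nnegrE ?(ltW bb0)//.
  by rewrite ltr_pdivrMr// mul1r.
have sp0 : (0 < s `^ p)%R by rewrite powR_gt0.
(* Precisely the excess energy that scaling by [s] removes: the p-th power of [s] times [1 + e] is
   1. *)
pose e : R := ((s `^ p)^-1 - 1)%R.
have e0 : (0 < e)%R.
  rewrite subr_gt0 invf_gt1//.
  have -> : (1 = 1 `^ p :> R)%R by rewrite powR1.
  by apply: gt0_ltr_powR; rewrite ?nnegrE ?(ltW s0).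
have [v [g [lv dv pg gW [gE vN]]]] :=
  localize mu_m nu_n sX sY cnu fnu p0 q0 cphi ind lu cK K0 oW KW e0.
have mg := p_gradient_borel pg; have g0 := p_gradient_ge0 pg.
pose v' y := (s * v y)%R; pose g' y := s%:E * g y.
have lv' : Lip v' by exact: LipZ.
have pg' : p_gradient n p v' g'.
  have [rho H ug] := pg; exists rho => //.
  apply: ug_alongZ ug; first exact: ltW.
  by move=> x y; rewrite -mulrBr normrM ger0_norm// ltW.
have g'E : \int[n]_y g' y `^ p <= 1.
  rewrite (@integral_poweRZ _ YB)//; last exact: ltW.
  apply: (@le_trans _ _ ((s `^ p)%:E * (1 + e%:E))).
    apply: lee_wpmul2l; first by rewrite lee_fin powR_ge0.
    apply: le_trans gE _; apply: leeD2r; apply: le_trans uB.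
    apply: (@ge0_subset_integral _ YB) => //.
    - apply: compact_borel; apply: continuous_compact => //.
      exact: continuous_subspaceT.
    - apply: (@measurable_funTS _ _ YB); apply: (@measurable_poweR_comp _ YB).
      apply: (min_grad_borel nu_n sY p0); exact: Lip_locally_dirichlet.
    - by move=> y _; exact: poweR_ge0.
    - by move=> _ [x Kx <-]; exact: KB.
  by rewrite -EFinD -EFinM lee_fin /e addrC subrK mulfV// gt_eqF.
exists v', g'; split => //.
  by move=> y /gW[vy0 gy0]; rewrite /v' /g' vy0 gy0 mulr0 mule0.
have dv' : dirichlet nu p v'.
  apply: (gradient_dirichlet nu_n p0 cnu _ pg'); first exact: Lip_continuous.
  by apply: le_lt_trans g'E _; rewrite ltry.
have lvX := comp_locally_dirichlet mu_m ind dv lv.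
have lv'X := comp_locally_dirichlet mu_m ind dv' lv'.
have mvX := min_grad_borel mu_m sX q0 lvX.
have vX0 := min_grad_ge0 mu_m sX q0 lvX.
have mv'X := min_grad_borel mu_m sX q0 lv'X.
have v'X0 := min_grad_ge0 mu_m sX q0 lv'X.
have sV0 : (0 <= s^-1)%R by rewrite invr_ge0 ltW.
have N : mu [set x | ~ gradX v x <= s^-1%:E * gradX v' x] = 0.
  apply: (min_gradZ mu_m sX q0 sV0) => // x y.
  by rewrite /v' /= -mulrBr normrM (gtr0_norm s0) mulKf// gt_eqF.
have msv : borel_fun (fun x => s^-1%:E * gradX v' x).
  exact: (@measurable_funeM _ XB).
have sv0 x : 0 <= s^-1%:E * gradX v' x by rewrite mule_ge0.
have I1 := ae_power_integral_le mu_m q0 bK mc c0 mvX vX0 vN.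
have I2 : \int[m]_(x in K) gradX v x `^ q <=
    \int[m]_(x in K) (s^-1%:E * gradX v' x) `^ q.
  apply: (ae_power_integral_le mu_m q0) => //.
  apply/eqP; rewrite eq_le outer_measure_ge0 andbT -N.
  by apply: le_outer_measure => x [].
have mv'K : measurable_fun (K : set XB) (gradX v').
  exact: (@measurable_funTS _ _ XB).
rewrite (@integral_poweRZ _ XB R m q _ _ _ bK sV0 mv'K v'X0) in I2.
have I3 := le_trans (ltW Kbeta) (le_trans I1 I2).
rewrite -sq EFinM; apply: (@le_trans _ _ ((s `^ q)%:E *
    ((s^-1 `^ q)%:E * \int[m]_(x in K) gradX v' x `^ q))).
  by apply: lee_wpmul2l I3; rewrite lee_fin powR_ge0.
have ss : (s `^ q * s^-1 `^ q = 1)%R.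
  by rewrite -powRM ?(ltW s0) ?invr_ge0 ?(ltW s0)// mulfV ?powR1// gt_eqF.
by rewrite muleA -EFinM ss mul1e lexx.
Qed.

End localization_levels.

(** * The set function Psi *)

Section Psi_basics.
Context {R : realType} {X Y : pmetricType R}.
Local Notation XB := (g_sigma_algebraType (@open X)).
Local Notation YB := (g_sigma_algebraType (@open Y)).
Variables (mu : {outer_measure set X -> \bar R}) (m : {measure set XB -> \bar R}).
Variables (nu : {outer_measure set Y -> \bar R}) (n : {measure set YB -> \bar R}).
Hypothesis mu_m : borel_trace mu m.
Hypothesis nu_n : borel_trace nu n.
Hypothesis sX : separable_space X.
Hypothesis sY : separable_space Y.
Hypothesis cnu : forall B, borel B -> nu.-caratheodory B.
Hypothesis fnu : forall A, mbounded A -> nu A < +oo.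
Variables (p q sigma : R) (phi : X -> Y).
Hypothesis p0 : (0 < p)%R.
Hypothesis q0 : (0 < q)%R.
Hypothesis sigma0 : (0 < sigma)%R.
Hypothesis cphi : continuous phi.
Hypothesis ind : forall u : Y -> R, dirichlet nu p u -> Lip u ->
  dirichlet mu q (u \o phi).
Implicit Types (u v w : Y -> R) (G B : set Y).

Local Notation gradX v := (min_grad mu q (v \o phi)).
Local Notation gradY u := (min_grad nu p u).
Local Notation cgrad u := (comp_grad mu nu p q phi u).
Local Notation Psi := (Psi mu nu p q phi sigma).

Lemma cgrad_borel u : Lip u -> borel_fun (cgrad u).
Proof. by move=> /(comp_gradP mu_m nu_n sX cnu fnu p0 q0 cphi ind)[]. Qed.

Lemma cgrad_ge0 u x : Lip u -> 0 <= cgrad u x.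
Proof. by move=> /(comp_gradP mu_m nu_n sX cnu fnu p0 q0 cphi ind)[]. Qed.

Lemma gradient_energy_le u g B : Lip u -> borel B -> p_gradient n p u g ->
  Lp_loc_fun nu p g ->
  \int[n]_(y in B) gradY u y `^ p <= \int[n]_(y in B) g y `^ p.
Proof.
move=> lu bB pg lg; apply: (ae_power_integral_le nu_n p0) => //.
- exact: (gradY_borel nu_n sY fnu p0).
- by move=> y; exact: (gradY_ge0 nu_n sY fnu p0).
- exact: p_gradient_borel pg.
- exact: p_gradient_ge0 pg.
apply/eqP; rewrite eq_le outer_measure_ge0 andbT.
rewrite -(min_grad_le nu_n sY p0 pg lg).
by apply: le_outer_measure => y [].
Qed.

Lemma Lip0 : Lip (cst 0%R : Y -> R).
Proof. by exists 0%R => x y; rewrite subrr normr0 mul0r. Qed.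

Lemma energy0 B : borel B -> \int[n]_(y in B) gradY (cst 0%R) y `^ p <= 1.
Proof.
move=> bB; apply: (@le_trans _ _ (\int[n]_(y in B) (cst 0 y) `^ p)).
  apply: gradient_energy_le => //; [exact: Lip0| |exact: (Lp_loc_cst nu_n fnu p (lexx 0%R))].
  by apply: Lip_gradient => // x y; rewrite subrr normr0 mul0r.
rewrite (eq_integral (cst 0)) ?integral0// => y _.
by rewrite /cst poweR0r// gt_eqF.
Qed.

Lemma Psi_sup B : borel B -> Psi B = (ereal_sup
  [set (\int[m]_(x in phi @^-1` B) cgrad u x `^ q) `^ q^-1 | u in
    [set u | Lip u /\ \int[n]_(y in B) gradY u y `^ p <= 1]]) `^ sigma.
Proof.
move=> bB; rewrite /Psi; congr (ereal_sup _ `^ _).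
have bB' := borel_preimage cphi bB.
have EX u : Lip u -> integral_of mu (phi @^-1` B) (fun x => cgrad u x `^ q) =
    \int[m]_(x in phi @^-1` B) cgrad u x `^ q.
  move=> lu; apply: (integral_of_poweR mu_m) => //; first exact: cgrad_borel.
  by move=> x; exact: cgrad_ge0.
have EY u : Lip u -> integral_of nu B (fun y => gradY u y `^ p) =
    \int[n]_(y in B) gradY u y `^ p.
  move=> lu; apply: (integral_of_poweR nu_n) => //.
    exact: (gradY_borel nu_n sY fnu p0).
  by move=> y; exact: (gradY_ge0 nu_n sY fnu p0).
apply/seteqP; split => _ [u [lu uB] <-]; exists u; rewrite /= ?EX//.
- by rewrite -EY.
- by rewrite EY.
Qed.

Lemma Psi_ge0 B : 0 <= Psi B. Proof. exact: poweR_ge0. Qed.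

Lemma Psi_ub u B (M : \bar R) : Lip u -> borel B ->
  \int[n]_(y in B) gradY u y `^ p <= 1 -> Psi B <= M ->
  \int[m]_(x in phi @^-1` B) cgrad u x `^ q <= M `^ (q / sigma).
Proof.
move=> lu bB uB; rewrite Psi_sup// => PM.
set I := \int[m]_(x in _) _.
have I0 : 0 <= I by apply: integral_ge0 => x _; exact: poweR_ge0.
have IS : (I `^ q^-1) `^ sigma <= M.
  apply: le_trans PM; apply: lee_poweR; [exact: ltW|exact: poweR_ge0|].
  by apply: ereal_sup_ubound; exists u.
have M0 : 0 <= M by apply: le_trans IS; exact: poweR_ge0.
have qs : (0 <= q / sigma)%R by rewrite divr_ge0 ?ltW.
have := lee_poweR qs (poweR_ge0 _ _) IS.
rewrite -!poweRrM (_ : _ * _ = 1)%R ?poweRe1//.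
by rewrite [(sigma * _)%R]mulrC divfK ?mulVf ?gt_eqF.
Qed.

(* A real [b] such that Psi B is at least [b `^ sigma], as witnessed by a
   single function. *)
Definition Psi_level B (b : R) := exists u, [/\ Lip u,
  \int[n]_(y in B) gradY u y `^ p <= 1 & b = 0%R \/ (0 < b)%R /\
    (b `^ q)%:E < \int[m]_(x in phi @^-1` B) cgrad u x `^ q].

(** A value of the supremum exceeding the bound would leave room for a real level strictly in
    between, with the same witness. *)
Lemma Psi_le_levels B (M : \bar R) : borel B -> 0 <= M ->
  (forall b, Psi_level B b -> (b `^ sigma)%:E <= M) -> Psi B <= M.
Proof.
move=> bB M0 lev; rewrite Psi_sup// -(poweRK sigma0 M0).
have M0' : 0 <= M `^ sigma^-1 by exact: poweR_ge0.
apply: lee_poweR; first exact: ltW.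
  (* Monotonicity of the power needs a nonnegative supremum; the zero function is a competitor that
     ensures it. *)
  apply: (@le_trans _ _ ((\int[m]_(x in phi @^-1` B) cgrad (cst 0%R) x `^ q)
      `^ q^-1)); first exact: poweR_ge0.
  apply: ereal_sup_ubound; exists (cst 0%R) => //; split; first exact: Lip0.
  exact: energy0.
apply: ge_ereal_sup => _ [u [lu uB] <-].
set I := \int[m]_(x in _) _.
have I0 : 0 <= I by apply: integral_ge0 => x _; exact: poweR_ge0.
rewrite leNgt; apply/negP => lt.
have Mfin : M `^ sigma^-1 \is a fin_num.
  by rewrite ge0_fin_numE//; apply: lt_le_trans lt _; rewrite leey.
move: lt; rewrite -(fineK Mfin) => lt.
have [b ltb blt] := lte_real_between lt.
have b0 : (0 < b)%R by apply: le_lt_trans ltb; exact: fine_ge0.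
have q0' : (0 <= q^-1)%R by rewrite invr_ge0 ltW.
have s0' : (0 <= sigma^-1)%R by rewrite invr_ge0 ltW.
have /lev bM : Psi_level B b.
  exists u; split => //; right; split => //.
  rewrite ltNge; apply/negP => le; move: blt; rewrite ltNge => /negP; apply.
  have := lee_poweR q0' I0 le.
  by rewrite poweR_EFin -powRrM mulfV ?gt_eqF// powRr1// ltW.
have bs0 : 0 <= (b `^ sigma)%:E by rewrite lee_fin powR_ge0.
have := lee_poweR s0' bs0 bM.
rewrite poweR_EFin -powRrM mulfV ?gt_eqF// powRr1 ?(ltW b0)// -(fineK Mfin).
by rewrite lee_fin leNgt ltb.
Qed.

Lemma comp_gradZ u (k : R) : Lip u -> (0 < k)%R ->
  mu [set x | ~ cgrad u x <= k^-1%:E * cgrad (fun y => k * u y)%R x] = 0.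
Proof.
move=> lu k0; have lk := LipZ k lu.
have [_ _ H] := comp_gradP mu_m nu_n sX cnu fnu p0 q0 cphi ind lu.
have [_ _ Hk] := comp_gradP mu_m nu_n sX cnu fnu p0 q0 cphi ind lk.
pose G (j : nat) := [set y : Y | (mdist point y < j%:R)%R].
have bG j : mbounded (G j) by exact: mbounded_mball.
have oG j : open (G j) by exact: open_mball.
apply: (@mu_null_bigcup _ _ mu _ (fun j => phi @^-1` G j `&`
  [set x | ~ cgrad u x <= k^-1%:E * cgrad (fun y => k * u y)%R x])).
  move=> x nle; exists (Num.bound (mdist point (phi x))) => //; split => //.
  exact: archi_boundP (mdist_ge0 _ _).
move=> j; have [v [lv dv vu]] := Lip_cutoff nu_n cnu fnu p0 lu (bG j).
pose w y := (k * v y)%R.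
have lw : Lip w by exact: LipZ.
have dw : dirichlet nu p w.
  have [g pg goo] := dirichlet_gradient nu_n dv.
  have mg := p_gradient_borel pg; have g0 := p_gradient_ge0 pg.
  have pg' : p_gradient n p w (fun y => k%:E * g y).
    have [rho Hr ug] := pg; exists rho => //; apply: ug_alongZ ug; first exact: ltW.
    by move=> x y; rewrite -mulrBr normrM gtr0_norm.
  apply: (gradient_dirichlet nu_n p0 cnu (Lip_continuous lw) pg').
  rewrite (@integral_poweRZ _ YB R n p _ _ _ (@measurableT _ YB) (ltW k0) mg g0).
  by rewrite lte_mul_pinfty// lee_fin powR_ge0.
have N1 := H (G j) v (oG j) (bG j) dv lv vu.
have N2 := Hk (G j) w (oG j) (bG j) dw lw
  (fun y Gy => congr1 (fun z => k * z)%R (vu y Gy)).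
have N3 : mu [set x | ~ gradX v x <= k^-1%:E * gradX w x] = 0.
  have lwX := comp_locally_dirichlet mu_m ind dw lw.
  have k0' : (0 <= k^-1)%R by rewrite invr_ge0 ltW.
  apply: (min_gradZ mu_m sX q0 k0') => // x y.
  by rewrite /w /= -mulrBr normrM (gtr0_norm k0) mulKf// gt_eqF.
apply/eqP; rewrite eq_le outer_measure_ge0 andbT.
rewrite -[leRHS]adde0 -{1}N1 -[X in _ + X]adde0 -{1}N2 -N3.
apply: le_trans; last by apply: leeD2l; exact: (outer_measureU2 mu).
apply: le_trans; last exact: (outer_measureU2 mu).
apply: le_outer_measure => x [Gx /= nle].
have [E1|] := pselect (cgrad u x = gradX v x); last by left.
have [E2|] := pselect (cgrad (fun y => k * u y)%R x = gradX w x); last by right; left.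
by right; right => /= le; apply: nle; rewrite E1 E2.
Qed.

Lemma Psi_scale u B (a : R) (M : \bar R) : Lip u -> borel B -> (0 < a)%R ->
  \int[n]_(y in B) gradY u y `^ p <= a%:E -> Psi B <= M ->
  \int[m]_(x in phi @^-1` B) cgrad u x `^ q <=
    (a `^ (q / p))%:E * M `^ (q / sigma).
Proof.
move=> lu bB a0 uB PM.
(* Normalizes the energy bound [a] to 1. *)
pose t : R := (a `^ (- p^-1))%R.
have t0 : (0 < t)%R by rewrite powR_gt0.
pose w y := (t * u y)%R.
have lw : Lip w by exact: LipZ.
have bB' := borel_preimage cphi bB.
have mgu := gradY_borel nu_n sY fnu p0 lu.
have u0 y := gradY_ge0 nu_n sY fnu p0 y lu.
have lD := Lip_locally_dirichlet nu_n fnu p0 lu.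
have wB : \int[n]_(y in B) gradY w y `^ p <= 1.
  have pw : p_gradient n p w (fun y => t%:E * gradY u y).
    have [rho Hr ug] := min_grad_gradient nu_n sY p0 lD; exists rho => //.
    apply: ug_alongZ ug; first exact: ltW.
    by move=> x y; rewrite -mulrBr normrM gtr0_norm.
  have lw' : Lp_loc_fun nu p (fun y => t%:E * gradY u y).
    apply: (Lp_locZ nu_n (ltW t0) mgu u0).
    exact: (min_grad_Lp_loc nu_n sY p0).
  apply: le_trans (gradient_energy_le lw bB pw lw') _.
  have mguB : measurable_fun (B : set YB) (gradY u).
    exact: (@measurable_funTS _ _ YB).
  rewrite (@integral_poweRZ _ YB R n p _ _ _ bB (ltW t0) mguB u0).
  apply: (@le_trans _ _ ((t `^ p)%:E * a%:E)).
    by apply: lee_wpmul2l uB; rewrite lee_fin powR_ge0.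
  rewrite -EFinM lee_fin /t -powRrM mulNr mulVf ?gt_eqF// powRN powRr1 ?(ltW a0)//.
  by rewrite mulVf// gt_eqF.
have N := comp_gradZ lu t0.
have mc := cgrad_borel lu; have c0 x := cgrad_ge0 x lu.
have mw := cgrad_borel lw; have w0 x := cgrad_ge0 x lw.
have ti0 : (0 <= t^-1)%R by rewrite invr_ge0 ltW.
have mtw : borel_fun (fun x => t^-1%:E * cgrad w x) by exact: (@measurable_funeM _ XB).
have tw0 x : 0 <= t^-1%:E * cgrad w x by rewrite mule_ge0.
apply: (@le_trans _ _ (\int[m]_(x in phi @^-1` B) (t^-1%:E * cgrad w x) `^ q)).
  apply: (ae_power_integral_le mu_m q0) => //.
  apply/eqP; rewrite eq_le outer_measure_ge0 andbT -N.
  by apply: le_outer_measure => y [].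
have mwB : measurable_fun (phi @^-1` B : set XB) (cgrad w).
  exact: (@measurable_funTS _ _ XB).
rewrite (@integral_poweRZ _ XB R m q _ _ _ bB' ti0 mwB w0).
have -> : (t^-1 `^ q)%R = (a `^ (q / p))%R.
  by rewrite /t powRN invrK -powRrM mulrC.
apply: lee_wpmul2l; first by rewrite lee_fin powR_ge0.
exact: Psi_ub lw bB wB PM.
Qed.

End Psi_basics.

(** * Superadditivity *)

Lemma compact_separation (R : realType) (Y : pmetricType R) (F1 F2 : set Y) :
  compact F1 -> compact F2 -> F1 `&` F2 = set0 ->
  exists W1 W2, [/\ open W1, open W2, F1 `<=` W1, F2 `<=` W2 &
    forall y, W1 y -> ~ W2 y].
Proof.
move=> c1 c2 F12; have [F10|F1N] := eqVneq F1 set0.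
  by exists set0, setT; rewrite F10; split => //; [exact: open0|exact: openT].
have F1n : F1 !=set0 by exact/set0P.
have cF2 : closed F2 by apply: compact_closed => //; exact: metric_hausdorff.
have [|d d0 dF] := compact_dist_to F1n c1 (closed_openC cF2).
  by move=> y F1y F2y; have : (F1 `&` F2) y by []; rewrite F12.
exists [set y | (dist_to F1 y < d / 2)%R], [set y | (d / 2 < dist_to F1 y)%R].
split.
- exact: open_dist_to.
- apply: (open_comp (f := dist_to F1) _ (@open_gt _ (d / 2)%R)) => y _.
  by apply: (@lipschitz_continuous _ _ _ 1%R) => x z; exact: dist_to_lip.
- by move=> y F1y; rewrite /= dist_to_in// divr_gt0.
- move=> y F2y; rewrite /= ltNge; apply/negP => le.
  have /dF : (dist_to F1 y < d)%R.
    by apply: le_lt_trans le _; rewrite ltr_pdivrMr// ltr_pMr// ltr1n.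
  by apply.
- by move=> y /= lt1 lt2; move: (lt_trans lt1 lt2); rewrite ltxx.
Qed.

Lemma poweR_add_disjoint (R : realType) (a b : \bar R) (p : R) : (p != 0)%R ->
  a = 0 \/ b = 0 -> (a + b) `^ p = a `^ p + b `^ p.
Proof.
by move=> p0 [->|->]; rewrite poweR0r ?(add0e, adde0).
Qed.

(* [t1] and [t2] are the multipliers of equality in Hölder's inequality. *)
Lemma holder_multipliers (R : realType) (p q sigma a1 a2 : R) :
  (0 < p)%R -> (0 < sigma)%R -> (q / p + q / sigma = 1)%R ->
  (0 <= a1)%R -> (0 <= a2)%R -> (a1 `^ sigma + a2 `^ sigma != 0)%R ->
  exists t1 t2 : R, [/\ (0 <= t1)%R, (0 <= t2)%R,
    (t1 `^ p + t2 `^ p = 1)%R &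
    (t1 `^ q * a1 `^ q + t2 `^ q * a2 `^ q =
       (a1 `^ sigma + a2 `^ sigma) `^ (q / sigma))%R].
Proof.
move=> p0 sigma0 pq a10 a20; set s := (_ + _)%R => sN0.
have s0 : (0 < s)%R by rewrite lt_neqAle eq_sym sN0 addr_ge0// powR_ge0.
pose x b := (b `^ sigma / s)%R.
have x0 b : (0 <= x b)%R by rewrite divr_ge0// ?powR_ge0// ltW.
have tp b : ((x b `^ p^-1) `^ p = x b)%R.
  by rewrite -powRrM mulVf ?gt_eqF// powRr1.
have piece b : (0 <= b)%R ->
    ((x b `^ p^-1) `^ q * b `^ q = x b * s `^ (q / sigma))%R.
  move=> b0; have -> : (b `^ q = x b `^ (q / sigma) * s `^ (q / sigma))%R.
    rewrite -powRM// ?(ltW s0)// /x divfK ?gt_eqF//.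
    by rewrite -powRrM mulrC divfK// gt_eqF.
  rewrite mulrA -powRrM (mulrC p^-1%R) -powRD; last by rewrite pq oner_eq0.
  by rewrite pq powRr1.
have xx : (x a1 + x a2 = 1)%R by rewrite /x -mulrDl mulfV.
exists (x a1 `^ p^-1)%R, (x a2 `^ p^-1)%R; split; try exact: powR_ge0.
  exact: etrans (congr2 +%R (tp a1) (tp a2)) xx.
by apply: etrans (congr2 +%R (piece _ a10) (piece _ a20)) _; rewrite -mulrDl xx mul1r.
Qed.

Section Psi_superadditivity.
Context {R : realType} {X Y : pmetricType R}.
Local Notation XB := (g_sigma_algebraType (@open X)).
Local Notation YB := (g_sigma_algebraType (@open Y)).
Variables (mu : {outer_measure set X -> \bar R}) (m : {measure set XB -> \bar R}).
Variables (nu : {outer_measure set Y -> \bar R}) (n : {measure set YB -> \bar R}).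
Hypothesis mu_m : borel_trace mu m.
Hypothesis nu_n : borel_trace nu n.
Hypothesis sX : separable_space X.
Hypothesis sY : separable_space Y.
Hypothesis rmu : radon mu.
Hypothesis fmu : forall A, mbounded A -> mu A < +oo.
Hypothesis cnu : forall B, borel B -> nu.-caratheodory B.
Hypothesis fnu : forall A, mbounded A -> nu A < +oo.
Variables (p q sigma : R) (phi : X -> Y).
Hypothesis p0 : (0 < p)%R.
Hypothesis q0 : (0 < q)%R.
Hypothesis sigma0 : (0 < sigma)%R.
Hypothesis pq : (q / p + q / sigma = 1)%R.
Hypothesis cphi : continuous phi.
Hypothesis ind : forall u : Y -> R, dirichlet nu p u -> Lip u ->
  dirichlet mu q (u \o phi).
Implicit Types (u v w : Y -> R) (B W : set Y) (K : set X).

Local Notation gradX v := (min_grad mu q (v \o phi)).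
Local Notation gradY u := (min_grad nu p u).
Local Notation cgrad u := (comp_grad mu nu p q phi u).
Local Notation Psi := (Psi mu nu p q phi sigma).

Lemma level_piece v w W K (t beta : R) : (0 <= t)%R ->
  Lip v -> dirichlet nu p v -> Lip w -> dirichlet nu p w -> open W ->
  (forall y, W y -> w y = t * v y)%R -> compact K -> K `<=` phi @^-1` W ->
  beta%:E <= \int[m]_(x in K) gradX v x `^ q ->
  (t `^ q * beta)%:E <= \int[m]_(x in K) cgrad w x `^ q.
Proof.
move=> t0 lv dv lw dw oW wv cK KW bv; have bK := compact_borel cK.
have [->|tN0] := eqVneq t 0%R.
  rewrite powR0 ?gt_eqF// mul0r integral_ge0// => x _; exact: poweR_ge0.
have {}t0 : (0 < t)%R by rewrite lt_neqAle eq_sym tN0.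
have ti0 : (0 <= t^-1)%R by rewrite invr_ge0 ltW.
have lvX := comp_locally_dirichlet mu_m ind dv lv.
have lwX := comp_locally_dirichlet mu_m ind dw lw.
pose z y := (t * v y)%R.
have zv x y : (`|z x - z y| <= t * `|v x - v y|)%R.
  by rewrite /z -mulrBr normrM gtr0_norm.
have lzX : locally_dirichlet mu m q (z \o phi).
  by apply: (locally_dirichletZ mu_m (u := v \o phi) (ltW t0)) => // x y; exact: zv.
have N1 : mu [set x | ~ gradX v x <= t^-1%:E * gradX z x] = 0.
  apply: (min_gradZ mu_m sX q0 ti0) => // x y.
  by rewrite /z /= -mulrBr normrM (gtr0_norm t0) mulKf// gt_eqF.
have oW' : open (phi @^-1` W) by apply: open_comp => // x _; exact: cphi.
have zw x : (phi @^-1` W) x -> (z \o phi) x = (w \o phi) x.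
  by move=> Wx; rewrite /= wv.
have N2 := min_grad_open mu_m sX q0 oW' zw lzX lwX.
have N3 := comp_grad_min_grad mu_m nu_n sX cnu fnu p0 q0 cphi ind dw lw.
have mc := cgrad_borel mu_m nu_n sX cnu fnu p0 q0 cphi ind lw.
have c0 x : 0 <= cgrad w x by exact: (cgrad_ge0 mu_m nu_n sX cnu fnu p0 q0 cphi ind).
have mtc : borel_fun (fun x => t^-1%:E * cgrad w x) by exact: (@measurable_funeM _ XB).
have tc0 x : 0 <= t^-1%:E * cgrad w x by rewrite mule_ge0.
have I1 : \int[m]_(x in K) gradX v x `^ q <=
    \int[m]_(x in K) (t^-1%:E * cgrad w x) `^ q.
  apply: (ae_power_integral_le mu_m q0) => //.
  - exact: (min_grad_borel mu_m sX q0).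
  - by move=> x; exact: (min_grad_ge0 mu_m sX q0).
  apply/eqP; rewrite eq_le outer_measure_ge0 andbT.
  rewrite -[leRHS]adde0 -{1}N1 -[X in _ + X]adde0 -{1}N2 -N3.
  apply: le_trans; last by apply: leeD2l; exact: (outer_measureU2 mu).
  apply: le_trans; last exact: (outer_measureU2 mu).
  apply: le_outer_measure => x [Kx /= nle].
  have [E1|] := pselect (gradX v x <= t^-1%:E * gradX z x); last by left.
  have [E2|nE2] := pselect (gradX z x <= gradX w x); last first.
    by right; left; split => //; exact: KW.
  right; right => /= E3; apply: nle; apply: le_trans E1 _.
  by rewrite E3; apply: lee_wpmul2l => //; rewrite lee_fin.
have mcK : measurable_fun (K : set XB) (cgrad w) by exact: (@measurable_funTS _ _ XB).
rewrite (@integral_poweRZ _ XB R m q _ _ _ bK ti0 mcK c0) in I1.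
have tt : (t `^ q * t^-1 `^ q = 1)%R.
  by rewrite -powRM ?(ltW t0)// mulfV ?powR1.
rewrite EFinM; apply: (@le_trans _ _ ((t `^ q)%:E *
    ((t^-1 `^ q)%:E * \int[m]_(x in K) cgrad w x `^ q))).
  by apply: lee_wpmul2l; [rewrite lee_fin powR_ge0|exact: le_trans bv I1].
by rewrite muleA -EFinM tt mul1e lexx.
Qed.

(** The localized witnesses live in disjoint neighbourhoods of the two compact images, so their
    energies and the lower bounds on the compact sets add up separately; the Hölder weights then
    turn the sum of the q-th powers into that of the sigma-th powers. *)
Lemma Psi_level_add B1 B2 B (b1 b2 : R) : borel B1 -> borel B2 -> borel B ->
  B1 `&` B2 = set0 -> B1 `<=` B -> B2 `<=` B ->
  Psi_level mu m nu n p q phi B1 b1 -> Psi_level mu m nu n p q phi B2 b2 ->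
  (b1 `^ sigma + b2 `^ sigma)%:E <= Psi B.
Proof.
move=> bB1 bB2 bB B12 B1B B2B [u1 [lu1 u1B1 lev1]] [u2 [lu2 u2B2 lev2]].
have b10 : (0 <= b1)%R by case: lev1 => [->//|[/ltW]].
have b20 : (0 <= b2)%R by case: lev2 => [->//|[/ltW]].
have [K1 [cK1 KB1 loc1]] := localize_level mu_m nu_n sX sY rmu fmu cnu fnu
  p0 q0 cphi ind lu1 bB1 u1B1 lev1.
have [K2 [cK2 KB2 loc2]] := localize_level mu_m nu_n sX sY rmu fmu cnu fnu
  p0 q0 cphi ind lu2 bB2 u2B2 lev2.
have cphiK K : compact K -> compact (phi @` K).
  by move=> cK; apply: continuous_compact => //; exact: continuous_subspaceT.
have K12 : (phi @` K1) `&` (phi @` K2) = set0.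
  apply/seteqP; split => // _ [[x1 K1x1 <-] [x2 K2x2 x12]].
  rewrite -B12; split; first exact: KB1.
  by rewrite -x12; exact: KB2.
have [W1 [W2 [oW1 oW2 KW1 KW2 W12]]] :=
  compact_separation (cphiK _ cK1) (cphiK _ cK2) K12.
have [v1 [g1 [lv1 pg1 vg1 E1 I1]]] := loc1 W1 oW1 KW1.
have [v2 [g2 [lv2 pg2 vg2 E2 I2]]] := loc2 W2 oW2 KW2.
(* The weights divide by this sum; when it vanishes there is nothing to prove. *)
have [s_0|sN0] := eqVneq (b1 `^ sigma + b2 `^ sigma)%R 0%R.
  by rewrite s_0; exact: Psi_ge0.
have [t1 [t2 [t10 t20 tp tq]]] := holder_multipliers p0 sigma0 pq b10 b20 sN0.
pose v y := (t1 * v1 y + t2 * v2 y)%R.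
pose g y := t1%:E * g1 y + t2%:E * g2 y.
(* At each point one of the two gradients is zero, so p-th powers add without a constant. *)
have gE y : g y `^ p = (t1%:E * g1 y) `^ p + (t2%:E * g2 y) `^ p.
  apply: poweR_add_disjoint; first exact: lt0r_neq0 p0.
  have [W1y|nW1y] := pselect (W1 y).
    by right; rewrite (vg2 _ (W12 _ W1y)).2 mule0.
  by left; rewrite (vg1 _ nW1y).2 mule0.
have vW1 y : W1 y -> v y = (t1 * v1 y)%R.
  move=> W1y; have [v2y _] := vg2 _ (W12 _ W1y); clear vg1 vg2.
  by rewrite /v v2y mulr0 addr0.
have vW2 y : W2 y -> v y = (t2 * v2 y)%R.
  move=> W2y; have [|v1y _] := vg1 y; clear vg1 vg2; first by move=> /W12.
  by rewrite /v v1y mulr0 add0r.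
clear vg1 vg2.
have lv : Lip v by apply: LipD; exact: LipZ.
have mg1 := p_gradient_borel pg1; have g10 := p_gradient_ge0 pg1.
have mg2 := p_gradient_borel pg2; have g20 := p_gradient_ge0 pg2.
have pg : p_gradient n p v g.
  have [rho [H ug1 ug2]] := p_gradient_pair p0 pg1 pg2; exists rho => //.
  apply: (@ug_along_add _ _ rho (fun y => t1 * v1 y)%R (fun y => t2 * v2 y)%R).
  - move=> x y; rewrite /v opprD addrACA; exact: ler_normD.
  - apply: ug_alongZ ug1 => // x y; by rewrite -mulrBr normrM ger0_norm.
  - apply: ug_alongZ ug2 => // x y; by rewrite -mulrBr normrM ger0_norm.
have mt1 : borel_fun (fun y => t1%:E * g1 y) by exact: (@measurable_funeM _ YB).
have mt2 : borel_fun (fun y => t2%:E * g2 y) by exact: (@measurable_funeM _ YB).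
have tg10 y : 0 <= t1%:E * g1 y by rewrite mule_ge0// lee_fin.
have tg20 y : 0 <= t2%:E * g2 y by rewrite mule_ge0// lee_fin.
have Eg : \int[n]_y g y `^ p <= 1.
  rewrite (eq_integral (fun y : YB => (t1%:E * g1 y) `^ p + (t2%:E * g2 y) `^ p)); last first.
    by move=> y _; exact: gE.
  rewrite (@ge0_integralD _ YB R n setT (@measurableT _ YB)
    (fun y : YB => (t1%:E * g1 y) `^ p) (fun y => (t2%:E * g2 y) `^ p)); first last.
  - exact: (@measurable_poweR_comp _ YB).
  - by move=> y _; exact: poweR_ge0.
  - exact: (@measurable_poweR_comp _ YB).
  - by move=> y _; exact: poweR_ge0.
  rewrite (@integral_poweRZ _ YB R n p _ _ _ (@measurableT _ YB) t10 mg1 g10).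
  rewrite (@integral_poweRZ _ YB R n p _ _ _ (@measurableT _ YB) t20 mg2 g20).
  apply: (@le_trans _ _ ((t1 `^ p)%:E * 1 + (t2 `^ p)%:E * 1)).
    by apply: leeD; apply: lee_wpmul2l => //; rewrite lee_fin powR_ge0.
  by rewrite !mule1 -EFinD lee_fin tp.
have mg := p_gradient_borel pg; have g0 := p_gradient_ge0 pg.
have goo : \int[n]_y g y `^ p < +oo by apply: le_lt_trans Eg _; rewrite ltry.
have dir u h : Lip u -> p_gradient n p u h -> \int[n]_y h y `^ p <= 1 ->
    dirichlet nu p u.
  move=> lu ph Eh; apply: (gradient_dirichlet nu_n p0 cnu (Lip_continuous lu) ph).
  by apply: le_lt_trans Eh _; rewrite ltry.
have dv := dir _ _ lv pg Eg.
have dv1 := dir _ _ lv1 pg1 E1; have dv2 := dir _ _ lv2 pg2 E2.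
have vB : \int[n]_(y in B) gradY v y `^ p <= 1.
  have lg := integrable_Lp_loc nu_n mg g0 goo.
  apply: le_trans (gradient_energy_le nu_n sY fnu p0 lv bB pg lg) _.
  apply: le_trans Eg; apply: (@ge0_subset_integral _ YB) => //.
  - exact: (@measurable_poweR_comp _ YB).
  - by move=> y _; exact: poweR_ge0.
have J1 : (t1 `^ q * b1 `^ q)%:E <= \int[m]_(x in K1) cgrad v x `^ q.
  apply: (level_piece t10 lv1 dv1 lv dv oW1 vW1 cK1 _ I1) => x Kx.
  by apply: KW1; exists x.
have J2 : (t2 `^ q * b2 `^ q)%:E <= \int[m]_(x in K2) cgrad v x `^ q.
  apply: (level_piece t20 lv2 dv2 lv dv oW2 vW2 cK2 _ I2) => x Kx.
  by apply: KW2; exists x.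
have mc := cgrad_borel mu_m nu_n sX cnu fnu p0 q0 cphi ind lv.
have mcp : borel_fun (fun x => cgrad v x `^ q) by exact: (@measurable_poweR_comp _ XB).
have bK1 := compact_borel cK1; have bK2 := compact_borel cK2.
have J : (t1 `^ q * b1 `^ q + t2 `^ q * b2 `^ q)%:E <=
    \int[m]_(x in phi @^-1` B) cgrad v x `^ q.
  rewrite EFinD; apply: le_trans (leeD J1 J2) _.
  rewrite -(@ge0_integral_setU _ XB R m K1 K2 bK1 bK2 (fun x => cgrad v x `^ q)); first last.
  - apply/disj_setPS => x [K1x K2x].
    have : (phi @` K1 `&` phi @` K2) (phi x) by split; exists x.
    by rewrite K12.
  - by move=> x _; exact: poweR_ge0.
  - exact: (@measurable_funTS _ _ XB).
  apply: (@ge0_subset_integral _ XB).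
  - exact: (@measurableU _ XB).
  - exact: borel_preimage.
  - exact: (@measurable_funTS _ _ XB).
  - by move=> x _; exact: poweR_ge0.
  - by move=> x [/KB1|/KB2]; [exact: B1B|exact: B2B].
have JM := le_trans J (Psi_ub mu_m nu_n sX sY cnu fnu p0 q0 sigma0 cphi ind
  lv bB vB (lexx _)).
rewrite tq -poweR_EFin in JM.
have qs : (0 < q / sigma)%R by rewrite divr_gt0.
by apply: (poweR_le_inj qs) JM; [rewrite lee_fin addr_ge0// powR_ge0|exact: Psi_ge0].
Qed.

(** The suprema over the two levels are taken one at a time. Level zero, which every Borel set has,
    shows that [Psi B2] is finite when [Psi B] is, so that it can be subtracted. *)
Lemma Psi_super B1 B2 B : borel B1 -> borel B2 -> borel B ->
  B1 `&` B2 = set0 -> B1 `<=` B -> B2 `<=` B -> Psi B1 + Psi B2 <= Psi B.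
Proof.
move=> bB1 bB2 bB B12 B1B B2B.
have H b1 b2 : Psi_level mu m nu n p q phi B1 b1 ->
    Psi_level mu m nu n p q phi B2 b2 ->
    (b1 `^ sigma + b2 `^ sigma)%:E <= Psi B by exact: Psi_level_add.
have L A (M : \bar R) := @Psi_le_levels _ _ _ mu m nu n mu_m nu_n sX sY cnu fnu
  p q sigma phi p0 q0 sigma0 cphi ind A M.
have level0 A : borel A -> Psi_level mu m nu n p q phi A 0%R.
  by move=> bA; exists (cst 0%R); split; [exact: Lip0|exact: energy0|left].
move: H; have := Psi_ge0 mu nu p q sigma phi B.
case: (Psi B) => [r _ H|_ _|//]; last exact: leey.
have H1 b1 : Psi_level mu m nu n p q phi B1 b1 ->
    Psi B2 <= (r - b1 `^ sigma)%:E.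
  move=> lev1; apply: L => //.
    have := H _ _ lev1 (level0 _ bB2); rewrite powR0 ?gt_eqF// addr0.
    by rewrite !lee_fin subr_ge0.
  by move=> b2 lev2; have := H _ _ lev1 lev2; rewrite !lee_fin lerBrDl.
have B2fin : Psi B2 \is a fin_num.
  rewrite ge0_fin_numE; last exact: Psi_ge0.
  by apply: le_lt_trans (H1 _ (level0 _ bB1)) _; rewrite ltry.
rewrite -leeBrDr//; apply: L => //.
  rewrite leeBrDr// add0e.
  by have := H1 _ (level0 _ bB1); rewrite powR0 ?gt_eqF// subr0.
move=> b1 lev1; rewrite leeBrDr//; have := H1 _ lev1.
by rewrite -(fineK B2fin) -EFinD !lee_fin lerBrDl.
Qed.

End Psi_superadditivity.

(** * Finiteness, countable subadditivity and the measure *)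

Lemma young_level_arith (R : fieldType) (A th th' r s a d : R) :
  (A != 0 -> th' != 0 -> s != 0 ->
  A * (th * (r / s) + th' * (a + d / (A * th'))) =
  A * (th / s) * r + A * th' * a + d)%R.
Proof. by move=> A0 t0 s0; field; rewrite A0 t0 s0. Qed.

Section Psi_measure.
Context {R : realType} {X Y : pmetricType R}.
Local Notation XB := (g_sigma_algebraType (@open X)).
Local Notation YB := (g_sigma_algebraType (@open Y)).
Variables (mu : {outer_measure set X -> \bar R}) (m : {measure set XB -> \bar R}).
Variables (nu : {outer_measure set Y -> \bar R}) (n : {measure set YB -> \bar R}).
Hypothesis mu_m : borel_trace mu m.
Hypothesis nu_n : borel_trace nu n.
Hypothesis sX : separable_space X.
Hypothesis sY : separable_space Y.
Hypothesis rmu : radon mu.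
Hypothesis fmu : forall A, mbounded A -> mu A < +oo.
Hypothesis cnu : forall B, borel B -> nu.-caratheodory B.
Hypothesis fnu : forall A, mbounded A -> nu A < +oo.
Variables (p q sigma : R) (phi : X -> Y).
Hypothesis p0 : (0 < p)%R.
Hypothesis q0 : (0 < q)%R.
Hypothesis sigma0 : (0 < sigma)%R.
Hypothesis pq : (q / p + q / sigma = 1)%R.
Hypothesis cphi : continuous phi.
Hypothesis ind : induces_bounded_composition mu nu p q phi.
Implicit Types (u : Y -> R) (B F : set Y).

Local Notation gradX v := (min_grad mu q (v \o phi)).
Local Notation gradY u := (min_grad nu p u).
Local Notation cgrad u := (comp_grad mu nu p q phi u).
Local Notation Psi := (Psi mu nu p q phi sigma).

Let le_levels B (M : \bar R) := @Psi_le_levels _ _ _ mu m nu n mu_m nu_n sX sY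
  cnu fnu p q sigma phi p0 q0 sigma0 cphi ind.1 B M.

Lemma Psi0 : Psi set0 = 0.
Proof.
apply/eqP; rewrite eq_le Psi_ge0 andbT; apply: le_levels => //.
  exact: (@measurable0 _ YB).
move=> b [u [lu _ [->|[b0]]]]; first by rewrite powR0// gt_eqF.
by rewrite preimage_set0 integral_set0 ltNge lee_fin powR_ge0.
Qed.

(** Restricting a test function from [B'] to [B] goes the wrong way for the energy constraint;
    localization, in the form of superadditivity with an empty set, supplies the missing
    direction. *)
Lemma le_Psi B B' : borel B -> borel B' -> B `<=` B' -> Psi B <= Psi B'.
Proof.
move=> bB bB' BB'; rewrite -[leLHS]adde0 -Psi0.
apply: (Psi_super mu_m nu_n sX sY rmu fmu cnu fnu p0 q0 sigma0 pq cphi ind.1) => //.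
- exact: (@measurable0 _ YB).
- by rewrite setI0.
Qed.

(** On the whole space the energy constraint puts [u] into the Dirichlet space, so the operator
    bound applies directly. The absolute value of [C] is used because [C] may be negative. *)
Lemma Psi_setT_lty : Psi setT < +oo.
Proof.
have [C CP] := ind.2.
apply: (@le_lt_trans _ _ (`|C| `^ sigma)%:E); last by rewrite ltry.
apply: le_levels; [exact: (@measurableT _ YB)|by rewrite lee_fin powR_ge0|].
move=> b [u [lu uY [->|[b0 bI]]]]; first by rewrite powR0 ?gt_eqF// lee_fin powR_ge0.
have lD := Lip_locally_dirichlet nu_n fnu p0 lu.
have mg := gradY_borel nu_n sY fnu p0 lu.
have g0 y : 0 <= gradY u y by exact: (gradY_ge0 nu_n sY fnu p0).
have du : dirichlet nu p u.
  apply: (gradient_dirichlet nu_n p0 cnu (Lip_continuous lu)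
    (min_grad_gradient nu_n sY p0 lD)).
  by apply: le_lt_trans uY _; rewrite ltry.
have luX := comp_locally_dirichlet mu_m ind.1 du lu.
have mG := min_grad_borel mu_m sX q0 luX.
have G0 := min_grad_ge0 mu_m sX q0 luX.
have mc := cgrad_borel mu_m nu_n sX cnu fnu p0 q0 cphi ind.1 lu.
have c0 x : 0 <= cgrad u x by exact: (cgrad_ge0 mu_m nu_n sX cnu fnu p0 q0 cphi ind.1).
have N := comp_grad_min_grad mu_m nu_n sX cnu fnu p0 q0 cphi ind.1 du lu.
have I1 : \int[m]_(x in phi @^-1` setT) cgrad u x `^ q <=
    \int[m]_x gradX u x `^ q.
  rewrite preimage_setT.
  apply: (ae_power_integral_le mu_m q0) => //; first exact: (@measurableT _ XB).
  apply/eqP; rewrite eq_le outer_measure_ge0 andbT -N.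
  by apply: le_outer_measure => x [_ /= nle] E; apply: nle; rewrite E.
have := CP u du lu.
rewrite (integral_of_poweRT mu_m q mG G0) (integral_of_poweRT nu_n p mg g0) => I2.
have I3 : (\int[m]_x gradX u x `^ q) `^ q^-1 <= `|C|%:E.
  apply: le_trans I2 _.
  set J := (\int[n]_y gradY u y `^ p) `^ p^-1.
  have J0 : 0 <= J by exact: poweR_ge0.
  have J1 : J <= 1.
    rewrite -(poweR1r p^-1); apply: lee_poweR => //.
      by rewrite invr_ge0 ltW.
    by apply: integral_ge0 => y _; exact: poweR_ge0.
  apply: (@le_trans _ _ (`|C|%:E * J)).
    by apply: lee_wpmul2r => //; rewrite lee_fin ler_norm.
  by rewrite -[leRHS]mule1; apply: lee_wpmul2l.
have q0' : (0 <= q^-1)%R by rewrite invr_ge0 ltW.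
have bq0 : 0 <= (b `^ q)%:E by rewrite lee_fin powR_ge0.
have := le_trans (lee_poweR q0' bq0 (le_trans (ltW bI) I1)) I3.
rewrite poweR_EFin -powRrM mulfV ?gt_eqF// powRr1 ?(ltW b0)// !lee_fin => bC.
by apply: ge0_ler_powR => //; rewrite ?nnegrE ?(ltW b0)// ltW.
Qed.

Lemma Psi_fin_num B : borel B -> Psi B \is a fin_num.
Proof.
move=> bB; rewrite ge0_fin_numE; last exact: Psi_ge0.
apply: le_lt_trans Psi_setT_lty; apply: le_Psi => //.
exact: (@measurableT _ YB).
Qed.

(** Young's inequality with the conjugate exponents p/q and sigma/q, applied after dividing [r] by
    the total [s]. Equality holds when [a] is the share [r / s], so summation over the pieces loses
    nothing. *)
Lemma young_level (s r a : R) : (0 < s)%R -> (0 <= r)%R -> (0 < a)%R ->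
  (a `^ (q / p) * r `^ (q / sigma) <=
   s `^ (q / sigma) * (q / sigma * (r / s) + q / p * a))%R.
Proof.
move=> s0 r0 a0; set th := (q / sigma)%R; set th' := (q / p)%R.
have th0 : (0 < th)%R by rewrite divr_gt0.
have th'0 : (0 < th')%R by rewrite divr_gt0.
have rE : (r `^ th = s `^ th * (r / s) `^ th)%R.
  by rewrite -powRM ?(ltW s0) ?divr_ge0// ?(ltW s0)// mulrC divfK// gt_eqF.
rewrite rE mulrCA ler_wpM2l ?powR_ge0//.
have x0 : (0 <= r / s)%R by rewrite divr_ge0// ltW.
have := @conjugate_powR _ (a `^ th')%R ((r / s) `^ th)%R th'^-1%R th^-1%R
  (powR_ge0 _ _) (powR_ge0 _ _).
rewrite !invr_gt0 th0 th'0 !invrK => /(_ isT isT pq).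
rewrite -!powRrM !mulfV ?gt_eqF// !powRr1 ?(ltW a0)// => H.
by apply: le_trans H _; rewrite addrC mulrC [(a * _)%R]mulrC.
Qed.

Lemma Psi_bigcup_le (B_ : nat -> set Y) : (forall k, borel (B_ k)) ->
  trivIset setT B_ -> Psi (\bigcup_k B_ k) <= \sum_(k <oo) Psi (B_ k).
Proof.
move=> bB tB; set S := \sum_(k <oo) _.
have bU : borel (\bigcup_k B_ k) by exact: (@bigcupT_measurable _ YB).
have S0 : 0 <= S by apply: nneseries_ge0 => k _ _; exact: Psi_ge0.
have [->|Soo] := eqVneq S +oo; first exact: leey.
have Sfin : S \is a fin_num by rewrite ge0_fin_numE// lt_neqAle Soo leey.
apply/lee_addgt0Pr => e e0.
(* Positive even when every [Psi (B_ k)] vanishes, so that shares of [s] make sense. *)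
pose s := (fine S + e)%R.
have s0 : (0 < s)%R by rewrite ltr_wpDl// fine_ge0.
have Ss : S <= s%:E by rewrite -(fineK Sfin) lee_fin lerDl ltW.
have -> : S + e%:E = s%:E by rewrite /s EFinD fineK.
apply: le_levels => //; first by rewrite lee_fin ltW.
move=> b [u [lu uB [->|[b0 bI]]]]; first by rewrite powR0 ?gt_eqF// lee_fin ltW.
pose th := (q / sigma)%R; pose th' := (q / p)%R.
have th0 : (0 < th)%R by rewrite divr_gt0.
have th'0 : (0 < th')%R by rewrite divr_gt0.
have mg := gradY_borel nu_n sY fnu p0 lu.
have g0 y : 0 <= gradY u y by exact: (gradY_ge0 nu_n sY fnu p0).
have mc := cgrad_borel mu_m nu_n sX cnu fnu p0 q0 cphi ind.1 lu.
have c0 x : 0 <= cgrad u x by exact: (cgrad_ge0 mu_m nu_n sX cnu fnu p0 q0 cphi ind.1).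
have mgp : borel_fun (fun y => gradY u y `^ p) by exact: (@measurable_poweR_comp _ YB).
have mcp : borel_fun (fun x => cgrad u x `^ q) by exact: (@measurable_poweR_comp _ XB).
pose a k := \int[n]_(y in B_ k) gradY u y `^ p.
have a0 k : 0 <= a k by apply: integral_ge0 => y _; exact: poweR_ge0.
have aE : \sum_(k <oo) a k <= 1.
  apply: le_trans uB; rewrite (@ge0_integral_bigcup _ YB)//.
  - exact: (@measurable_funTS _ _ YB).
  - by move=> y _; exact: poweR_ge0.
have afin k : a k \is a fin_num.
  rewrite ge0_fin_numE//; apply: le_lt_trans (_ : a k <= 1) _; last by rewrite ltry.
  apply: le_trans aE; rewrite (@nneseriesD1 _ _ k)//.
  by rewrite leeDl// nneseries_ge0.
pose I k := \int[m]_(x in phi @^-1` B_ k) cgrad u x `^ q.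
have IE : \int[m]_(x in phi @^-1` (\bigcup_k B_ k)) cgrad u x `^ q =
    \sum_(k <oo) I k.
  rewrite preimage_bigcup (@ge0_integral_bigcup _ XB)//.
  - by move=> k; exact: borel_preimage.
  - exact: (@measurable_funTS _ _ XB).
  - by move=> x _; exact: poweR_ge0.
  - apply/trivIsetP => i j _ _ ij; rewrite -preimage_setI.
    by move/trivIsetP: tB => /(_ _ _ Logic.I Logic.I ij) ->; rewrite preimage_set0.
(* The coefficients from [young_level], linear in the measure and in the energy of a piece. As the
   exponents add up to 1, [c1 * s + c2] is the power [th] of [s]. *)
pose c1 := (s `^ th * (th / s))%R; pose c2 := (s `^ th * th')%R.
have c10 : (0 <= c1)%R by rewrite mulr_ge0 ?powR_ge0// divr_ge0// ltW.
have c20 : (0 < c2)%R by rewrite mulr_gt0// powR_gt0.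
have Ik k : I k <= c1%:E * Psi (B_ k) + c2%:E * a k.
  have Pfin := Psi_fin_num (bB k).
  set r := fine (Psi (B_ k)).
  have r0 : (0 <= r)%R by rewrite fine_ge0// Psi_ge0.
  apply/lee_addgt0Pr => d d0.
  (* [Psi_scale] needs a positive energy bound and [a k] may be zero; the surplus is later
     multiplied by [c2] and contributes exactly [d]. *)
  pose ak := (fine (a k) + d / c2)%R.
  have dc0 : (0 < d / c2)%R by rewrite divr_gt0.
  have ak0 : (0 < ak)%R by rewrite ltr_wpDl// fine_ge0.
  have uak : a k <= ak%:E by rewrite -(fineK (afin k)) lee_fin lerDl ltW.
  have := Psi_scale mu_m nu_n sX sY cnu fnu p0 q0 sigma0 cphi ind.1 lu (bB k) ak0 uak
    (lexx _).
  rewrite -(fineK Pfin) -/r poweR_EFin -EFinM => /le_trans; apply.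
  rewrite -(fineK (afin k)) -!EFinM -!EFinD lee_fin.
  apply: le_trans (young_level s0 r0 ak0) _; rewrite -/th -/th'.
  rewrite le_eqVlt; apply/orP; left; apply/eqP.
  by apply: young_level_arith; rewrite gt_eqF// powR_gt0.
have Isum : \sum_(k <oo) I k <= c1%:E * S + c2%:E * \sum_(k <oo) a k.
  apply: le_trans (_ : _ <= \sum_(k <oo) (c1%:E * Psi (B_ k) + c2%:E * a k)) _.
    apply: lee_nneseries => // k _ _.
    by apply: integral_ge0 => x _; exact: poweR_ge0.
  rewrite nneseriesD; last 2 first.
  - by move=> k _ _; rewrite mule_ge0// Psi_ge0.
  - by move=> k _ _; rewrite mule_ge0// lee_fin ltW.
  by rewrite !nneseriesZl ?lexx// => k _; exact: Psi_ge0.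
have bs : (b `^ q < s `^ th)%R.
  rewrite -lte_fin; apply: lt_le_trans bI _; rewrite IE; apply: le_trans Isum _.
  apply: (@le_trans _ _ (c1%:E * s%:E + c2%:E * 1)).
    by apply: leeD; apply: lee_wpmul2l => //; rewrite lee_fin// ltW.
  rewrite mule1 -EFinM -EFinD lee_fin /c1 /c2 -mulrA divfK ?gt_eqF//.
  by rewrite -mulrDr addrC pq mulr1.
rewrite lee_fin.
have := @ge0_ler_powR _ (sigma / q)%R _ _ _ _ _ (ltW bs).
rewrite divr_ge0 ?(ltW sigma0) ?(ltW q0)// !nnegrE !powR_ge0 => /(_ isT isT isT).
rewrite -!powRrM [(q * _)%R]mulrC divfK ?gt_eqF// /th.
by rewrite mulrA divfK ?gt_eqF// mulfV ?gt_eqF// powRr1// ltW.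
Qed.

Lemma Psi_sigma_additive :
  semi_sigma_additive (Psi : set YB -> \bar R).
Proof.
move=> F mF tF mU.
have fin_le k : \sum_(0 <= i < k) Psi (F i) <= Psi (\bigcup_i F i).
  apply: (@le_trans _ _ (Psi (\big[setU/set0]_(i < k) F i))); last first.
    apply: le_Psi => //; last exact: bigsetU_bigcup.
    by apply: (@bigsetU_measurable _ YB) => i _; exact: mF.
  elim: k => [|k IH]; first by rewrite big_geq// Psi_ge0.
  rewrite big_nat_recr//= big_ord_recr/=.
  apply: le_trans (leeD2r _ IH) _.
  have mUk : borel (\big[setU/set0]_(i < k) F i).
    by apply: (@bigsetU_measurable _ YB) => i _; exact: mF.
  apply: (Psi_super mu_m nu_n sX sY rmu fmu cnu fnu p0 q0 sigma0 pq cphi ind.1) => //.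
  - exact: mF.
  - by apply: (@measurableU _ YB) => //; exact: mF.
  - rewrite -bigcup_mkord setI_bigcupl; apply: bigcup0 => i /= ik.
    by move/trivIsetP: tF; apply => //; rewrite ltn_eqF.
have cv : cvgn (fun k => \sum_(0 <= i < k) Psi (F i)).
  by apply: is_cvg_nneseries => i _ _; exact: Psi_ge0.
have -> : Psi (\bigcup_i F i) = \sum_(i <oo) Psi (F i); last exact: cv.
apply/eqP; rewrite eq_le; apply/andP; split; first exact: Psi_bigcup_le.
by apply: lime_le => //; apply: nearW => k; exact: fin_le.
Qed.

Lemma Psi_measure_ex :
  exists P : {measure set YB -> \bar R}, forall B, P B = Psi B.
Proof.
pose F := isMeasure.Build _ YB R (Psi : set YB -> \bar R) Psi0
  (Psi_ge0 mu nu p q sigma phi) Psi_sigma_additive.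
pose P : {measure set YB -> \bar R} := HB.pack (Psi : set YB -> \bar R) F.
by exists P.
Qed.

End Psi_measure.

(** * Regularity of finite Borel measures *)

Section finite_borel_measure.
Context {R : realType} {Y : pmetricType R}.
Local Notation YB := (g_sigma_algebraType (@open Y)).
Variable P : {measure set YB -> \bar R}.
Hypothesis fP : P setT < +oo.
Implicit Types (A B F U : set Y).

Lemma nonincreasing_measure_small (D : (set Y)^nat) (e : R) :
  (forall k, borel (D k)) -> nonincreasing_seq D ->
  P (\bigcap_k D k) < e%:E -> exists k, P (D k) < e%:E.
Proof.
move=> bD dD lte.
have D0 : P (D 0%N) < +oo.
  by apply: le_lt_trans fP; apply: le_measure => //; rewrite inE//; exact: bD.
have cv := @nonincreasing_cvg_mu _ YB _ P D D0 bD
  (@bigcapT_measurable _ YB D bD) dD.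
have /cv[N _ HN] : nbhs (P (\bigcap_k D k)) [set x | x < e%:E].
  by apply: open_nbhs_nbhs; split => //; exact: open_ereal_lt_ereal.
by exists N; exact: (HN N (leqnn N)).
Qed.

(** Approximation from both sides is symmetric under complements, which outer approximation alone is
    not; this makes the sets with the property a sigma-algebra. *)
Definition closed_open_regular B := forall e : R, (0 < e)%R ->
  exists U F, [/\ open U, closed F, F `<=` B, B `<=` U & P (U `\` F) <= e%:E].

(** [U] is exhausted by the closed sets of points at distance at least 1/(k+1) from its complement,
    and [P] is finite, so the remainders become small. *)
Lemma closed_open_regular_open U : open U -> closed_open_regular U.
Proof.
move=> oU e e0; have [UT|UN] := eqVneq (~` U) set0.
  exists U, U; split => //; first by rewrite -[U]setCK UT setC0; exact: closedT.
  by rewrite setDv measure0 lee_fin ltW.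
have CU : (~` U) !=set0 by exact/set0P.
pose V (k : nat) := [set y | (dist_to (~` U) y < k.+1%:R^-1)%R].
have oV k : open (V k) by exact: open_dist_to.
have VE : \bigcap_k (U `&` V k) = set0.
  apply/seteqP; split => // y yV; have [Uy _] := yV 0%N Logic.I.
  suff : (~` U) y by apply.
  apply: dist_to_eq0 => //; first exact: open_closedC.
  rewrite leNgt; apply/negP => d0.
  have [k] := ltr_add_invr d0; rewrite add0r.
  by have [_ /= /lt_trans H /H] := yV k Logic.I; rewrite ltxx.
have [|||k /ltW Pk] := @nonincreasing_measure_small (fun k => U `&` V k) e _ _ _.
- by move=> k; apply: (@measurableI _ YB); exact: open_borel.
- apply/nonincreasing_seqP => k; apply/subsetPset => y [Uy /= Vy]; split => //=.
  apply: lt_le_trans Vy _.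
  by rewrite lef_pV2 ?posrE ?ltr0n// ler_nat.
- by rewrite VE measure0 lte_fin.
exists U, (U `&` ~` V k); split => //.
- have -> : U `&` ~` V k = ~` V k; last exact: open_closedC.
  apply/setIidPr => y /= nV; apply: contrapT => nU; apply: nV.
  by rewrite /V /= dist_to_in// invr_gt0.
- by apply: le_trans Pk; rewrite setDIr setDv set0U setDE setCK.
Qed.

Lemma closed_open_regularC B : closed_open_regular B ->
  closed_open_regular (~` B).
Proof.
move=> rB e e0; have [U [F [oU cF FB BU UF]]] := rB e e0.
exists (~` F), (~` U); split.
- exact: closed_openC.
- exact: open_closedC.
- exact: subsetC.
- exact: subsetC.
- by rewrite setDE setCK setIC -setDE.
Qed.

(** A countable union of closed sets need not be closed, so a finite part of it is kept and the rest
    is made small by continuity from above. Aiming at [e / 2] leaves the strict inequality needed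
    there. *)
Lemma closed_open_regular_bigcup (B_ : (set Y)^nat) :
  (forall k, closed_open_regular (B_ k)) ->
  closed_open_regular (\bigcup_k B_ k).
Proof.
move=> rB e e0; have e20 : (0 < e / 2)%R by rewrite divr_gt0.
pose d k : R := (e / 2 / (2 ^ k.+1)%:R)%R.
have d0 k : (0 < d k)%R by rewrite divr_gt0// ltr0n expn_gt0.
have /choice[UF HUF] : forall k, exists UF : set Y * set Y,
    [/\ open UF.1, closed UF.2, UF.2 `<=` B_ k, B_ k `<=` UF.1 &
      P (UF.1 `\` UF.2) <= (d k)%:E].
  by move=> k; have [U [F H]] := rB k _ (d0 k); exists (U, F).
pose U := \bigcup_k (UF k).1.
have oU : open U by apply: bigcup_open => k _; have [] := HUF k.
pose F k := \big[setU/set0]_(i < k) (UF i).2.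
have cF k : closed (F k).
  by apply: closed_bigsetU => i _; have [] := HUF i.
have bU := open_borel oU.
have bUF k : borel ((UF k).1 `\` (UF k).2).
  have [oUk cFk _ _ _] := HUF k.
  by apply: (@measurableD _ YB); [exact: open_borel|exact: closed_borel].
have [|||k /ltW Pk] := @nonincreasing_measure_small (fun k => U `\` F k) e _ _ _.
- by move=> k; apply: (@measurableD _ YB) => //; exact: closed_borel.
- apply/nonincreasing_seqP => k; apply/subsetPset => y [Uy nF]; split => // Fy.
  by apply: nF; rewrite /F big_ord_recr; left.
- apply: (@le_lt_trans _ _ (e / 2)%:E); last first.
    by rewrite lte_fin ltr_pdivrMr// ltr_pMr// ltr1n.
  apply: le_trans (@measure_sigma_subadditive _ R YB P (\bigcap_k (U `\` F k))
    (fun k => (UF k).1 `\` (UF k).2) bUF _ _) _.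
  + apply: (@bigcapT_measurable _ YB) => k.
    by apply: (@measurableD _ YB) => //; exact: closed_borel.
  + move=> y yF; have [[i _ Ui] _] := yF 0%N Logic.I.
    exists i => //; split => // Fi; have [_] := yF i.+1 Logic.I; apply.
    by rewrite /F big_ord_recr; right.
  apply: le_trans (_ : _ <= \sum_(k <oo) (0 + (d k)%:E)) _.
    by apply: lee_nneseries => // k _; rewrite add0e; have [] := HUF k.
  apply: le_trans (@epsilon_trick R (fun=> 0) (e / 2)%R xpredT _ _) _ => //; first exact: ltW.
  by rewrite eseries0// add0e.
exists U, (F k); split => //.
- move=> y; rewrite /F -(bigcup_mkord _ (fun i => (UF i).2)) => -[i _ Fi]; exists i => //.
  by have [_ _ FB _ _] := HUF i; exact: FB.
- by move=> y [i _ Bi]; exists i => //; have [_ _ _ BU _] := HUF i; exact: BU.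
Qed.

Lemma borel_closed_open_regular B : borel B -> closed_open_regular B.
Proof.
apply: smallest_sub; last exact: closed_open_regular_open.
split.
- by apply: closed_open_regular_open; exact: open0.
- by move=> A rA; rewrite setTD; exact: closed_open_regularC.
- exact: closed_open_regular_bigcup.
Qed.

Lemma borel_outer_regular B (e : R) : borel B -> (0 < e)%R ->
  exists U, [/\ open U, B `<=` U & P U <= P B + e%:E].
Proof.
move=> bB e0; have [U [F [oU cF FB BU UF]]] := borel_closed_open_regular bB e0.
exists U; split => //; have bF := closed_borel cF; have bU := open_borel oU.
rewrite -(@setDUK _ F U); last exact: subset_trans BU.
apply: le_trans (@measureU2 _ YB R P _ _ _ _) _ => //.
  exact: (@measurableD _ YB).
apply: leeD => //.
by apply: (@le_measure _ R YB); rewrite ?inE.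
Qed.

Definition open_hull A := ereal_inf [set P U | U in [set U | open U /\ A `<=` U]].

(** The union of a countable Borel cover is Borel and is enlarged to an open set at small cost.
    Identifying the infimum over open sets with the Caratheodory extension gives countable
    subadditivity, agreement with [P] and measurability of Borel sets at once. *)
Lemma mu_ext_open_hull A : mu_ext (P : set YB -> \bar R) A = open_hull A.
Proof.
apply/eqP; rewrite eq_le; apply/andP; split.
  apply: le_ereal_inf_tmp => _ [U [oU AU] <-].
  rewrite -(measurable_mu_extE P (open_borel oU)).
  exact: le_mu_ext.
apply: le_ereal_inf_tmp => _ [B [mB AB] <-].
apply/lee_addgt0Pr => e e0.
have bB : borel (\bigcup_k B k) by exact: (@bigcupT_measurable _ YB).
have [U [oU BU PU]] := borel_outer_regular bB e0.
apply: (@le_trans _ _ (P U)).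
  by apply: ereal_inf_lbound; exists U => //; split => //; exact: subset_trans BU.
apply: le_trans PU _; apply: leeD2r.
by apply: (@measure_sigma_subadditive _ R YB).
Qed.

Lemma open_hull_ge0 A : 0 <= open_hull A.
Proof. by rewrite -mu_ext_open_hull; exact: mu_ext_ge0. Qed.

Lemma open_hull_borel B : borel B -> open_hull B = P B.
Proof. by move=> bB; rewrite -mu_ext_open_hull measurable_mu_extE. Qed.

(** The intersection of a sequence of almost optimal open supersets. *)
Lemma borel_hull A : exists B, [/\ borel B, A `<=` B & P B = open_hull A].
Proof.
have hfin : open_hull A \is a fin_num.
  rewrite ge0_fin_numE ?open_hull_ge0//; apply: le_lt_trans fP.
  by apply: ereal_inf_lbound; exists setT => //; split => //; exact: openT.
have /choice[U HU] : forall k, exists U,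
    [/\ open U, A `<=` U & P U < open_hull A + (k.+1%:R^-1)%:E].
  move=> k; have k0 : (0 < k.+1%:R^-1 :> R)%R by rewrite invr_gt0.
  by have [_ [U [oU AU] <-] lt] := lb_ereal_inf_adherent k0 hfin; exists U.
have bU k : borel (U k) by have [oUk _ _] := HU k; exact: open_borel.
have bI : borel (\bigcap_k U k) by exact: (@bigcapT_measurable _ YB).
have AI : A `<=` \bigcap_k U k by move=> y Ay k _; have [_ AU _] := HU k; exact: AU.
exists (\bigcap_k U k); split => //; apply/eqP; rewrite eq_le; apply/andP; split.
  apply/lee_addgt0Pr => e e0.
  have [k] := ltr_add_invr e0; rewrite add0r => ke.
  have [_ _ /ltW PU] := HU k.
  apply: (@le_trans _ _ (P (U k))).
    by apply: (@le_measure _ R YB); [exact: mem_set bI|exact: mem_set (bU k)|move=> y; apply].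
  by apply: le_trans PU _; apply: leeD2l; rewrite lee_fin ltW.
rewrite -(open_hull_borel bI) -!mu_ext_open_hull.
exact: le_mu_ext.
Qed.

Lemma open_hull_outer_measure :
  exists Q : {outer_measure set Y -> \bar R}, forall A, Q A = open_hull A.
Proof.
pose Q : {outer_measure set YB -> \bar R} := mu_ext (P : set YB -> \bar R).
by exists Q => A; exact: mu_ext_open_hull.
Qed.

Lemma open_hull_caratheodory B A : borel B ->
  open_hull A = open_hull (A `&` B) + open_hull (A `&` ~` B).
Proof.
by move=> bB; rewrite -!mu_ext_open_hull; exact: (caratheodory_measurable_mu_ext P bB A).
Qed.

End finite_borel_measure.

Theorem theorem3p4 (R : realType) (X Y : pmetricType R)
    (mu : {outer_measure set X -> \bar R})
    (nu : {outer_measure set Y -> \bar R})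
    (p q sigma : R) (phi : X -> Y) :
  metric_measure_space mu ->
  metric_measure_space nu ->
  radon mu ->
  (1 <= q)%R -> (q < p)%R -> (sigma^-1 = q^-1 - p^-1)%R ->
  continuous phi ->
  induces_bounded_composition mu nu p q phi ->
  exists Psit : {outer_measure set Y -> \bar R},
    [/\ forall A : set Y, Psit A =
          ereal_inf [set Psi mu nu p q phi sigma U |
                     U in [set U : set Y | open U /\ A `<=` U]],
        borel_regular Psit,
        Psit setT < +oo &
        forall B : set Y, borel B -> Psit B = Psi mu nu p q phi sigma B].
Proof.
move=> [sX [cmu _] _ fmu] [sY [cnu _] _ fnu] rmu q1 qp sigmaE cphi ind.
have [m mu_m] := borel_trace_ex cmu; have [n nu_n] := borel_trace_ex cnu.
have q0 : (0 < q)%R by exact: lt_le_trans ltr01 q1.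
have p0 : (0 < p)%R by exact: lt_trans qp.
have sigma0 : (0 < sigma)%R by rewrite -invr_gt0 sigmaE subr_gt0 ltf_pV2.
have pq : (q / p + q / sigma = 1)%R.
  by rewrite sigmaE mulrBr addrC subrK mulfV// gt_eqF.
have [P PE] := Psi_measure_ex mu_m nu_n sX sY rmu fmu cnu fnu p0 q0 sigma0 pq
  cphi ind.
have fP : P setT < +oo.
  rewrite PE; exact: (Psi_setT_lty mu_m nu_n sX sY cnu fnu p0 q0 sigma0 cphi ind).
have hullE A : open_hull P A = ereal_inf [set Psi mu nu p q phi sigma U |
    U in [set U : set Y | open U /\ A `<=` U]].
  by congr ereal_inf; apply: eq_imagel => U _; exact: PE.
have [Psit PsitE] := open_hull_outer_measure fP.
have PsitB B : borel B -> Psit B = P B.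
  by move=> bB; rewrite PsitE (open_hull_borel fP).
exists Psit; split.
- by move=> A; rewrite PsitE hullE.
- split=> [B bB A|A]; last first.
    have [B [bB AB PB]] := borel_hull fP A.
    by exists B; split => //; rewrite PsitB// PB PsitE.
  by rewrite !PsitE; exact: open_hull_caratheodory.
- by rewrite PsitB//; exact: (@measurableT _ (g_sigma_algebraType (@open Y))).
- by move=> B bB; rewrite PsitB.
Qed.
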